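(* Let $1\le p_0<2<q_0\le\infty$. For $p\in(2,q_0)$ put $$\gamma(p):=\max\Big(\frac1{p-p_0},\Big(\frac{q_0}p\Big)'\frac1{2q_0^*}\Big).$$ Let $p\in(2,q_0)$. There is a constant $C_0>0$ such that for every $\tfrac12$-sparse family $\mathcal S\subset\mathscr D$, all functions $f,g\in L^1_{\mathrm{loc}}(M,\mu)$, and every weight $w\in A_{p/p_0}\cap RH_{(q_0/p)'}$, with $\sigma:=w^{1-p^*}$, $$\sum_{P\in\mathcal S}\Big(\frac1{|5P|}\int_{5P}|f|^{p_0}d\mu\Big)^{2/p_0}\Big(\frac1{|5P|}\int_{5P}|g|^{q_0^*}d\mu\Big)^{1/q_0^*}|P|\le C_0\Big([w]_{A_{p/p_0}}[w]_{RH_{(q_0/p)'}}\Big)^{2\gamma(p)}\|f\|_{L^p(w)}^2\,\|g\|_{L^{p^*}(\sigma)}.$$ The constant $C_0$ is independent of both the weight and the sparse collection (and of $f,g$). Moreover the dependence on the weight characteristic is sharp: already for $M=\mathbb R$ with Lebesgue measure, for each $p\in(2,q_0)$ the exponent $2\gamma(p)$ cannot be replaced by any smaller exponent in an estimate of this form, valid for all $\tfrac12$-sparse families $\mathcal S\subset\mathscr D$, all functions $f,g\in L^1_{\mathrm{loc}}(\mathbb R)$ and all weights $w\in A_{p/p_0}\cap RH_{(q_0/p)'}$ (with $\sigma=w^{1-p^*}$), with a constant independent of $\mathcal S$, $f$, $g$ and $w$.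
   Context: **Space.** $(M,d,\mu)$ is a locally compact separable metric space with a Borel measure $\mu$ that is finite on compact sets and strictly positive on non-empty open sets; $|E|:=\mu(E)$. The measure is doubling: there is $C$ with $|B(x,2r)|\le C|B(x,r)|$ for all $x\in M$, $r>0$. Moreover there is a non-decreasing $\varphi:(0,\infty)\to(0,\infty)$ with $\varphi(1)=1$ and $|B(x,r)|\simeq\varphi(r/s)|B(x,s)|$ for all $x\in M$, $r,s>0$, where $X\simeq Y$ means two-sided comparability with uniform constants. **Dyadic cubes.** A dyadic system with parameters $0<c_0\le C_0'<\infty$, $\delta\in(0,1)$ is a family of open sets $(Q^l_\alpha)_{\alpha\in\mathcal A_l,\,l\in\mathbb Z}$ such that: for each $l$, $M$ is the disjoint union of the $Q^l_\alpha$, $\alpha\in\mathcal A_l$, and a $\mu$-null set; if $l\ge k$ then either $Q^l_\beta\subseteq Q^k_\alpha$ or $Q^l_\beta\cap Q^k_\alpha=\emptyset$; and for each $Q^l_\alpha$ there is $z^l_\alpha$ with $B(z^l_\alpha,c_0\delta^l)\subseteq Q^l_\alpha\subseteq B(z^l_\alpha,C_0'\delta^l)$. $\mathscr D=\bigcup_{b=1}^K\mathscr D^b$ is a fixed finite union of dyadic systems with the property that for every ball $B=B(x,r)$ there is $Q\in\mathscr D$ with $B\subseteq Q$ and $\mathrm{diam}(Q)\le Cr$. The side length of $P=Q^l_\alpha$ is $\ell(P)=\delta^l$, and for $\lambda\ge1$, $\lambda P:=\{x\in M: d(x,P)\le(\lambda-1)\ell(P)\}$. **Sparse.** $\mathcal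 S\subseteq\mathscr D$ is $\tfrac12$-sparse if there are pairwise disjoint sets $F_P\subset P$ ($P\in\mathcal S$) with $|F_P|>\tfrac12|P|$. **Exponents.** $q'$ is the Hölder conjugate of $q$; $q^*:=(q/2)'=q/(q-2)$ for $q>2$ (so $q_0^*=1$ and $(q_0/p)'=1$ if $q_0=\infty$). **Weights.** A weight is a positive locally integrable function; $\|f\|_{L^p(w)}^p=\int|f|^pw\,d\mu$. For $1<p<\infty$, $w\in A_p$ iff $[w]_{A_p}:=\sup_Q\big(\frac1{|Q|}\int_Qw\,d\mu\big)\big(\frac1{|Q|}\int_Qw^{1-p'}d\mu\big)^{p-1}<\infty$; for $q\ge1$, $w\in RH_q$ iff $[w]_{RH_q}:=\sup_Q\big(\frac1{|Q|}\int_Qw^qd\mu\big)^{1/q}\big(\frac1{|Q|}\int_Qw\,d\mu\big)^{-1}<\infty$ (so $[w]_{RH_1}=1$); the suprema are over all cubes $Q\in\mathscr D$. *)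

(* Defs.v *)
From HB Require Import structures.
From mathcomp Require Import all_boot all_order all_algebra.
From mathcomp Require Import all_classical all_reals all_analysis.
Set Implicit Arguments.
Unset Strict Implicit.
Unset Printing Implicit Defensive.
Import Order.TTheory GRing.Theory Num.Theory.
Import numFieldNormedType.Exports.
Local Open Scope classical_set_scope.
Local Open Scope ring_scope.

#[short(type="measurableMetricType")]
HB.structure Definition MeasurableMetric (d : measure_display) (R : realType) :=
  { M of Measurable d M & Metric R M }.

(* The real line, with its Borel sets, its usual topology and the distance    *)
(* `|y - x|; lebesgue_measure is a measure on measurableTypeR R.              *)
HB.instance Definition _ (R : realType) :=
  Measurable.copy (measurableTypeR R)
    (g_sigma_algebraType R.-ocitv.-measurable).
HB.instance Definition _ (R : realType) := Metric.copy (measurableTypeR R) R^o.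

Section space.
Context {d : measure_display} {R : realType} {M : measurableMetricType d R}.
Variable mu : {measure set M -> \bar R}.
Local Open Scope ereal_scope.

Definition separable_space := exists2 A : set M, countable A & dense A.

Definition doubling :=
  exists C : R, forall (x : M) (r : R), (0 < r)%R ->
    mu (ball x (2 * r)%R) <= C%:E * mu (ball x r).

Definition volume_growth :=
  exists phi : R -> R,
    [/\ forall t : R, (0 < t)%R -> (0 < phi t)%R,
        forall s t : R, (0 < s)%R -> (s <= t)%R -> (phi s <= phi t)%R,
        phi 1%R = 1%R &
        exists c C : R, [/\ (0 < c)%R, (0 < C)%R &
          forall (x : M) (r s : R), (0 < r)%R -> (0 < s)%R ->
            (c * phi (r / s))%:E * mu (ball x s) <= mu (ball x r) /\
            mu (ball x r) <= (C * phi (r / s))%:E * mu (ball x s)]].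

Definition doubling_metric_measure_space :=
  locally_compact [set: M] /\ separable_space /\
  (measurable : set (set M)) = <<s [set U : set M | open U] >> /\
  (forall K : set M, compact K -> mu K < +oo) /\
  (forall U : set M, open U -> U !=set0 -> 0 < mu U) /\
  doubling /\ volume_growth.

Definition diam (A : set M) : \bar R :=
  ereal_sup [set (mdist xy.1 xy.2)%:E | xy in A `*` A].

Definition set_dist (x : M) (A : set M) : \bar R :=
  ereal_inf [set (mdist x y)%:E | y in A].

Definition avg (A : set M) (h : M -> R) : \bar R :=
  (mu A)^-1 * \int[mu]_(x in A) (h x)%:E.

Definition L1loc (f : M -> R) :=
  measurable_fun [set: M] f /\
  forall K : set M, compact K -> mu.-integrable K (EFin \o f).

Definition weight (w : M -> R) := (forall x, 0 < w x)%R /\ L1loc w.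

Definition weighted_norm (p : R) (w f : M -> R) : \bar R :=
  (\int[mu]_x (`|f x| `^ p * w x)%:E) `^ p^-1.

End space.

Section dyadic.
Context {d : measure_display} {R : realType} {M : measurableMetricType d R}.
Variable mu : {measure set M -> \bar R}.
Local Open Scope ereal_scope.

Record dyadic_system := DyadicSystem {
  inner_radius : R;
  outer_radius : R;
  ratio : R;
  dyadic_index : int -> choiceType;
  dyadic_cube : forall l : int, dyadic_index l -> set M;
  radii_ok : (0 < inner_radius <= outer_radius)%R;
  ratio_ok : (0 < ratio < 1)%R;
  cube_open : forall l a, open (@dyadic_cube l a);
  cube_disjoint : forall l, trivIset [set: dyadic_index l] (@dyadic_cube l);
  cube_cover_ae : forall l, mu (~` \bigcup_(a in [set: dyadic_index l]) dyadic_cube a) = 0;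
  cube_nested : forall (k l : int), (k <= l)%R ->
      forall (a : dyadic_index k) (b : dyadic_index l),
      dyadic_cube b `<=` dyadic_cube a \/
      dyadic_cube b `&` dyadic_cube a = set0;
  cube_round : forall l (a : dyadic_index l), exists z : M,
      ball z (inner_radius * ratio ^ l)%R `<=` dyadic_cube a /\
      dyadic_cube a `<=` ball z (outer_radius * ratio ^ l)%R
}.

Variables (K : nat) (D : 'I_K -> dyadic_system).

(* A cube of the union of the D b is kept together with its system b, its     *)
(* generation l and its index: the same set may be a cube of several          *)
(* generations, and its side length depends on the generation.                *)
Definition cube : choiceType :=
  {b : 'I_K & {l : int & dyadic_index (D b) l}}.

Definition cube_set (P : cube) : set M := dyadic_cube (tagged (tagged P)).

Definition side_length (P : cube) : R :=
  (ratio (D (tag P)) ^ tag (tagged P))%R.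

Definition dilate (lambda : R) (P : cube) : set M :=
  [set x | set_dist x (cube_set P) <= ((lambda - 1) * side_length P)%:E].

Definition covers_balls :=
  exists C : R, forall (x : M) (r : R), (0 < r)%R ->
    exists P : cube, ball x r `<=` cube_set P /\
                     diam (cube_set P) <= (C * r)%:E.

Definition half_sparse (S : set cube) :=
  exists F : cube -> set M,
    [/\ trivIset S F,
        forall P, S P -> measurable (F P),
        forall P, S P -> F P `<=` cube_set P &
        forall P, S P -> (2^-1)%:E * mu (cube_set P) < mu (F P)].

(* Real Hoelder conjugate of an extended real q > 1; it is 1 for q = +oo.     *)
Definition hconj (q : \bar R) : R := fine (hoelder_conjugate q).

Definition star (q : \bar R) : R := hconj (q / 2%:E).

Definition Ap_const (p : R) (w : M -> R) : \bar R :=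
  ereal_sup [set avg mu (cube_set Q) w *
      (avg mu (cube_set Q) (fun x => (w x `^ (1 - hconj p%:E))%R)) `^ (p - 1)
    | Q in [set: cube]].

Definition RH_const (q : R) (w : M -> R) : \bar R :=
  ereal_sup [set (avg mu (cube_set Q) (fun x => (w x `^ q)%R)) `^ q^-1 /
      avg mu (cube_set Q) w
    | Q in [set: cube]].

Definition gamma (p0 : R) (q0 : \bar R) (p : R) : R :=
  (Num.max (p - p0)^-1 (hconj (q0 / p%:E)%E / (2 * star q0)))%R.

(* The weighted estimate for the quadratic sparse form, with constant C and   *)
(* exponent eta of the weight characteristic.                                 *)
Definition sparse_estimate (p0 : R) (q0 : \bar R) (p eta C : R) :=
  forall S : set cube, half_sparse S ->
  forall f g : M -> R, L1loc mu f -> L1loc mu g ->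
  forall w : M -> R, weight mu w ->
  Ap_const (p / p0) w < +oo -> RH_const (hconj (q0 / p%:E)) w < +oo ->
  let ps := star p%:E in
  let sigma := fun x => (w x `^ (1 - ps))%R in
  \esum_(P in S)
    ((avg mu (dilate 5 P) (fun x => (`|f x| `^ p0)%R)) `^ (2 / p0) *
     (avg mu (dilate 5 P) (fun x => (`|g x| `^ star q0)%R)) `^ (star q0)^-1 *
     mu (cube_set P))
  <= C%:E *
     (Ap_const (p / p0) w * RH_const (hconj (q0 / p%:E)) w) `^ eta *
     (weighted_norm mu p w f) ^+ 2 * weighted_norm mu ps sigma g.

End dyadic.

(* Main.v *)
Require Import Defs.
From HB Require Import structures.
From mathcomp Require Import all_boot all_order all_algebra.
From mathcomp Require Import all_classical all_reals all_analysis.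
From mathcomp Require Import measurable_realfun ring lra.
From mathcomp Require finmap.

(* Upper bound. Every dilate 5P lies in a cube Q of comparable measure, and the
   part F of P carries at least half of the mass of P. Measure f against the
   measure w^(1-(p/p0)') dmu and g against w^((q0/p)') dmu, the two duals of w
   for p/p0 and q0/p. The averages over Q become averages for these measures,
   times their masses on Q; since a product of powers of the two densities is
   constant, Hoelder's inequality on F bounds these masses by those of F, and the
   loss is exactly the power 2 gamma(p) of the characteristic. The sets F being
   disjoint, the sum is then at most the product of the norms of two dyadic
   maximal functions, each bounded with a constant independent of the measure.

   Sharpness. On the real line let b be the distance to 0 truncated at t and 1,
   w = b^al, and let f, g be the powers of b restricted to (-1, 1) for which
   |f|^p w = |g|^{p*} sigma = 1/b, so that the norms contribute log(1/t). Take
   J ~ log(1/t) shrinking cubes around 0. Each term of the sparse sum is bounded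
   below, and it gains a power of log(1/t) if |f|^p0 or |g|^{q0*} is 1/b: this is
   al = p/p0 - 1 or al = -1/(q0/p)'. The corresponding powers of log(1/t) in the
   characteristic give the two terms in the maximum defining gamma(p). *)

Set Implicit Arguments.
Unset Strict Implicit.
Unset Printing Implicit Defensive.
Import Order.TTheory GRing.Theory Num.Theory.
Import numFieldNormedType.Exports.
Local Open Scope classical_set_scope.
Local Open Scope ring_scope.

(** * Power inequalities for real numbers and finite sums *)

Section real_inequalities.
Context {R : realType}.
Implicit Types x y t : R.

(** Origin of the exponent: let U, V be the masses on Q of the dual weights attached to p/p0 and
    q0/p, and UF, VF those on F; put P = p/p0 - 1, Z = 1 - p/q0. Once the averages of f and g are
    divided out, a term is at most the characteristic to the power 2/p times U^(2/p) V^(1-2/p).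
    Hoelder over the disjoint sets F needs UF, VF instead. What controls this exchange is that
    (U/UF)^P (V/VF)^Z is at most a constant times the characteristic; its power G - 2/p dominates
    (U/UF)^(2/p) (V/VF)^(1-2/p) as soon as G >= 2/(p-p0) and G >= (1-2/q0)/(1-p/q0), and the larger
    of these bounds is 2 gamma(p). The dual measures need not be doubling, so the maximal functions
    are taken over cubes of a single dyadic system, where nestedness gives a weak type bound for any
    measure. The cubes Q belong to several systems, and the sum is split accordingly. For sharpness,
    J cubes of size about q^j, j < J, are tested with t = q^(2J), so that J further scales remain
    below the smallest cube. *)

Lemma powR_expR x t : 0 < x -> x `^ t = expR (t * ln x).
Proof. by move=> x0; rewrite /powR gt_eqF. Qed.

Lemma weighted_AMGM t x y : 0 < t < 1 -> 0 <= x -> 0 <= y ->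
  x `^ t * y `^ (1 - t) <= t * x + (1 - t) * y.
Proof.
move=> /andP[t0 t1] x0 y0; have t1' : 0 < 1 - t by rewrite subr_gt0.
have := @conjugate_powR R (x `^ t) (y `^ (1 - t)) t^-1 (1 - t)^-1
  (powR_ge0 _ _) (powR_ge0 _ _).
rewrite !invr_gt0 !invrK => /(_ t0 t1'); rewrite -!powRrM !mulfV ?gt_eqF//.
by rewrite !powRr1// (mulrC x) (mulrC y); apply; rewrite addrC subrK.
Qed.

(** Dividing by the two sums [A] and [B] reduces Hoelder's inequality to weighted AM-GM, term by
    term. A vanishing sum is treated apart: then all its terms vanish. *)
Lemma sum_hoelder (I : eqType) (s : seq I) (F G : I -> R) t : 0 < t < 1 ->
  (forall i, i \in s -> 0 <= F i) -> (forall i, i \in s -> 0 <= G i) ->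
  \sum_(i <- s) F i `^ t * G i `^ (1 - t) <=
  (\sum_(i <- s) F i) `^ t * (\sum_(i <- s) G i) `^ (1 - t).
Proof.
move=> t01 F0 G0; have /andP[t0 t1] := t01.
have t1' : 0 < 1 - t by rewrite subr_gt0.
have SF : 0 <= \sum_(i <- s) F i by rewrite big_seq sumr_ge0.
have SG : 0 <= \sum_(i <- s) G i by rewrite big_seq sumr_ge0.
have [F_eq0|F_neq0] := eqVneq (\sum_(i <- s) F i) 0.
  rewrite F_eq0 powR0 ?gt_eqF// mul0r big_seq big1// => i si.
  move/eqP: F_eq0; rewrite big_seq psumr_eq0 // => /allP/(_ i si).
  by rewrite si/= => /eqP ->; rewrite powR0 ?gt_eqF// mul0r.
have [G_eq0|G_neq0] := eqVneq (\sum_(i <- s) G i) 0.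
  rewrite G_eq0 powR0 ?gt_eqF// mulr0 big_seq big1// => i si.
  move/eqP: G_eq0; rewrite big_seq psumr_eq0 // => /allP/(_ i si).
  by rewrite si/= => /eqP ->; rewrite powR0 ?gt_eqF// mulr0.
have A0 : 0 < \sum_(i <- s) F i by rewrite lt_neqAle eq_sym F_neq0.
have B0 : 0 < \sum_(i <- s) G i by rewrite lt_neqAle eq_sym G_neq0.
move: A0 B0; set A := \sum_(i <- s) F i; set B := \sum_(i <- s) G i => A0 B0.
rewrite -[leRHS]mulr1 -ler_pdivrMl ?mulr_gt0 ?powR_gt0// mulr_sumr.
apply: (@le_trans _ _ (\sum_(i <- s) (t / A * F i + (1 - t) / B * G i))).
  rewrite big_seq [leRHS]big_seq; apply: ler_sum => i si.
  have := @weighted_AMGM t (F i / A) (G i / B) t01.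
  rewrite !divr_ge0 ?F0 ?G0 ?(ltW A0) ?(ltW B0)// => /(_ isT isT).
  rewrite !powRM ?invr_ge0 ?F0 ?G0 ?(ltW A0) ?(ltW B0)//.
  rewrite -(powR_inv1 (ltW A0)) -(powR_inv1 (ltW B0)) !(powRAC _ (-1)).
  rewrite !powR_inv1 ?powR_ge0 ?(ltW A0) ?(ltW B0)//.
  by rewrite invfM; congr (_ <= _); ring.
rewrite big_split/= -!mulr_sumr -/A -/B !divfK ?gt_eqF//.
by rewrite addrC subrK.
Qed.

(* The ratio condition [tau 2^k < y] cuts the series at its largest term. *)
Lemma geometric_cutoff_sum (tau t y : R) n : 0 < tau -> 0 < t -> 0 <= y ->
  \sum_(k < n) (tau * 2 ^+ k) `^ t * (tau * 2 ^+ k < y)%R%:R <=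
  (1 - 2 `^ (- t))^-1 * y `^ t.
Proof.
move=> tau0 t0 y0; set c := _^-1.
have q1 : (2 : R) `^ (- t) < 1.
  by rewrite powR_expR// expR_lt1 mulNr oppr_lt0 mulr_gt0// ln_gt0// ltr1n.
have c0 : 0 < c by rewrite invr_gt0 subr_gt0.
have cE : c * 2 `^ (- t) + 1 = c.
  have : c * (1 - 2 `^ (- t)) = 1 by rewrite mulVf// gt_eqF// subr_gt0.
  lra.
have pos k : 0 < tau * 2 ^+ k by rewrite mulr_gt0// exprn_gt0.
(* The second bound, by the next scale instead of [y], carries the induction: as long as
   [tau 2^n < y] it implies the first one, and afterwards no term is added. *)
suff [//] : \sum_(k < n) (tau * 2 ^+ k) `^ t * (tau * 2 ^+ k < y)%R%:R <=
    c * y `^ t /\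
  \sum_(k < n) (tau * 2 ^+ k) `^ t * (tau * 2 ^+ k < y)%R%:R <=
    c * 2 `^ (- t) * (tau * 2 ^+ n) `^ t.
elim: n => [|n [IH1 IH2]].
  by rewrite big_ord0 !mulr_ge0// ?powR_ge0// ltW.
rewrite big_ord_recr/=.
have step : c * 2 `^ (- t) * (tau * 2 ^+ n.+1) `^ t = c * (tau * 2 ^+ n) `^ t.
  rewrite exprS mulrCA (powRM _ (ler0n _ 2) (ltW (pos n))) mulrA -(mulrA c); congr (_ * _).
  by rewrite powRN mulVf ?mulr1// gt_eqF// powR_gt0.
have [lt_y|ge_y] := ltP (tau * 2 ^+ n) y.
  rewrite mulr1 step.
  suff key : \sum_(i < n) (tau * 2 ^+ i) `^ t * (tau * 2 ^+ i < y)%R%:R +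
      (tau * 2 ^+ n) `^ t <= c * (tau * 2 ^+ n) `^ t.
    split=> //; apply: (le_trans key); apply: ler_wpM2l; first exact: ltW.
    by apply: ge0_ler_powR; rewrite ?nnegrE// ltW.
  by rewrite -[in leRHS]cE mulrDl mul1r lerD2r.
rewrite mulr0 addr0 step; split=> //; apply: (le_trans IH2).
rewrite ler_wpM2r ?powR_ge0//; nra.
Qed.

End real_inequalities.

(** * The power of the characteristic lost in one term *)

Section two_weight_inequality.
Context {R : realType}.
Implicit Types a p z G : R.

(* [v u^(phi-1) = 1] ties the two weights together: what a subset F of Q loses
   in the v-mass it must compensate in the u-mass, up to the characteristic W. *)
Lemma two_weight_log a p z G (lW lk lq lU lV lUF lVF : R) :
  0 < a -> a < p -> 2 < p -> p * z < 1 ->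
  2 / (p - a) <= G -> (1 - 2 * z) / (1 - p * z) <= G ->
  (1 - p * z) * (lV - lq) + (p / a - 1) * (lU - lq) <= lW ->
  (p / a - p * z) * lq <=
    (p / a - p * z) * lk + (1 - p * z) * lVF + (p / a - 1) * lUF ->
  lUF <= lU -> lVF <= lV ->
  2 / a * (lU - lq) + (1 - 2 * z) * (lV - lq) + lq <=
  G * lW + (G - 2 / p) * (p / a - p * z) * lk + 2 / p * lUF + (1 - 2 / p) * lVF.
Proof.
move=> a0 ap p2 pz G1 G2 hW hF hU hV.
have p0 : 0 < p by lra.
have R0 : 0 < 1 - p * z by lra.
have pa0 : 0 < p - a by lra.
set P := p / a - 1 in hW hF *; set Z := 1 - p * z in G2 hW hF R0 *.
have DE : p / a - p * z = Z + P by rewrite /Z /P; lra.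
rewrite DE in hF *.
have zE : z = (1 - Z) / p by rewrite /Z; field; rewrite gt_eqF.
have aE : 2 / a = 2 / p * (P + 1).
  by rewrite /P; field; rewrite !gt_eqF.
have P0 : 0 < P by rewrite /P subr_gt0 ltr_pdivlMr ?mul1r.
(* [m1] and [m2] are the two lower bounds on [G], solved for the coefficients with which [G - 2 / p]
   copies of [hAB] must pay for [lV - lVF] and [lU - lUF]. *)
have m1 : 1 - 2 / p <= (G - 2 / p) * Z.
  rewrite mulrBl lerBrDr; move: G2; rewrite ler_pdivrMr// => G2.
  apply: le_trans G2; rewrite zE le_eqVlt; apply/orP; left; apply/eqP.
  by field; rewrite gt_eqF.
have m2 : 2 / p <= (G - 2 / p) * P.
  have : 2 / (p - a) * P <= G * P by rewrite ler_wpM2r// ltW.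
  have -> : 2 / (p - a) * P = 2 / a by rewrite /P; field; rewrite !gt_eqF.
  by rewrite aE; lra.
have m0 : 0 <= G - 2 / p.
  rewrite -(pmulr_lge0 _ P0); apply: le_trans m2; rewrite divr_ge0//; lra.
have hAB : Z * (lV - lVF) + P * (lU - lUF) <= lW + (Z + P) * lk by lra.
have h1 : (1 - 2 / p) * (lV - lVF) <= (G - 2 / p) * Z * (lV - lVF).
  by rewrite ler_wpM2r// subr_ge0.
have h2 : 2 / p * (lU - lUF) <= (G - 2 / p) * P * (lU - lUF).
  by rewrite ler_wpM2r// subr_ge0.
have h3 := ler_wpM2l m0 hAB.
have h4 : 2 / p * (Z * (lV - lq) + P * (lU - lq)) <= 2 / p * lW.
  by rewrite ler_wpM2l// divr_ge0// ltW.
(* Splits off the part that the characteristic bounds directly, with factor [2 / p]; the rest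
   carries exactly the exponents [2 / p] and [1 - 2 / p] of the final Hoelder inequality. *)
have -> : 2 / a * (lU - lq) + (1 - 2 * z) * (lV - lq) + lq =
   2 / p * (Z * (lV - lq) + P * (lU - lq)) + 2 / p * lU + (1 - 2 / p) * lV.
  by rewrite aE zE; field; rewrite gt_eqF.
lra.
Qed.

(** Here [U], [V] are the masses of the dual weights on a cube of measure [q], and [UF], [VF] those
    on the sparse part. The left side is a term of the sparse form with the averages of f and g for
    the dual measures divided out. Taking logarithms makes everything linear. *)
Lemma two_weight_inequality a p z G (W k q U V UF VF : R) :
  0 < a -> a < p -> 2 < p -> p * z < 1 ->
  2 / (p - a) <= G -> (1 - 2 * z) / (1 - p * z) <= G ->
  0 < W -> 0 < k -> 0 < q -> 0 < UF -> 0 < VF ->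
  (V / q) `^ (1 - p * z) * (U / q) `^ (p / a - 1) <= W ->
  q `^ (p / a - p * z) <=
    k `^ (p / a - p * z) * VF `^ (1 - p * z) * UF `^ (p / a - 1) ->
  UF <= U -> VF <= V ->
  (U / q) `^ (2 / a) * (V / q) `^ (1 - 2 * z) * q <=
  k `^ ((G - 2 / p) * (p / a - p * z)) * W `^ G *
    (UF `^ (2 / p) * VF `^ (1 - 2 / p)).
Proof.
move=> a0 ap p2 pz G1 G2 W0 k0 q0 UF0 VF0 hW hF hU hV.
have U0 := lt_le_trans UF0 hU; have V0 := lt_le_trans VF0 hV.
have Uq0 : 0 < U / q by rewrite divr_gt0.
have Vq0 : 0 < V / q by rewrite divr_gt0.
rewrite -ler_ln ?posrE ?mulr_gt0 ?powR_gt0//.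
rewrite -ler_ln ?posrE ?mulr_gt0 ?powR_gt0// in hW.
rewrite -ler_ln ?posrE ?mulr_gt0 ?powR_gt0// in hF.
rewrite -ler_ln ?posrE// in hU; rewrite -ler_ln ?posrE// in hV.
move: hW hF; rewrite !lnM ?posrE ?mulr_gt0 ?powR_gt0 ?invr_gt0//.
rewrite !ln_powR !lnM ?posrE ?invr_gt0// !lnV ?posrE// => hW hF.
have := two_weight_log a0 ap p2 pz G1 G2 hW hF hU hV.
lra.
Qed.

End two_weight_inequality.

(** * Laminar families of sets and the weak type bound *)

Section laminar_families.
Context {d : measure_display} {T : measurableType d} {R : realType}.
Variable mu : {measure set T -> \bar R}.

Definition laminar (I : choiceType) (s : seq I) (A : I -> set T) :=
  forall i j, i \in s -> j \in s ->
    [\/ A i `<=` A j, A j `<=` A i | A i `&` A j = set0].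

(** A finite laminar union is the disjoint union of its maximal members, so the inequalities on the
    members add up. The induction extracts these members: the head is dropped if it lies in a later
    set; otherwise every later set that meets it is absorbed by it. The second case recurses on a
    filtered list, hence the induction on the size. *)
Lemma laminar_integral_le (I : choiceType) (s : seq I) (A : I -> set T)
    (f g : T -> \bar R) :
  (forall i, measurable (A i)) -> laminar s A ->
  measurable_fun [set: T] f -> measurable_fun [set: T] g ->
  (forall x, 0 <= f x)%E -> (forall x, 0 <= g x)%E ->
  (forall i, i \in s ->
    \int[mu]_(x in A i) f x <= \int[mu]_(x in A i) g x)%E ->
  (\int[mu]_(x in \big[setU/set0]_(i <- s) A i) f x <=
   \int[mu]_(x in \big[setU/set0]_(i <- s) A i) g x)%E.
Proof.
move=> mA + mf mg f0 g0; have [n] := ubnP (size s).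
elim: n s => // n IH [|i s] /=; first by rewrite !big_nil !integral_set0.
rewrite ltnS => sn lam fg.
have lam' : laminar s A.
  by move=> j k js ks; apply: lam; rewrite inE ?js ?ks orbT.
have fg' j : j \in s -> (\int[mu]_(x in A j) f x <= \int[mu]_(x in A j) g x)%E.
  by move=> js; apply: fg; rewrite inE js orbT.
have [[j js Aij]|noj] := pselect (exists2 j, j \in s & A i `<=` A j).
  rewrite big_cons (_ : A i `|` _ = \big[setU/set0]_(i <- s) A i).
    exact: IH.
  apply/setUidPr => x Aix; rewrite -bigcup_seq; exists j => //; exact: Aij.
pose s' := [seq j <- s | `[< A j `&` A i = set0 >]].
have s's j : j \in s' -> j \in s by rewrite mem_filter => /andP[].
have UE : \big[setU/set0]_(j <- i :: s) A j =
    A i `|` \big[setU/set0]_(j <- s') A j.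
  rewrite big_cons -!bigcup_seq; apply/seteqP; split=> x [Aix|]; first by left.
  - move=> [j /= js Ajx].
    have [||ij|ji|dij] := lam i j; rewrite ?inE ?js ?eqxx ?orbT//.
    + by exfalso; apply: noj; exists j.
    + by left; exact: ji.
    + by right; exists j => //=; rewrite mem_filter js andbT; apply/asboolP; rewrite setIC.
  - by left.
  - by move=> [j /= js' Ajx]; right; exists j => //=; exact: s's.
have mU : measurable (\big[setU/set0]_(j <- s') A j) by exact: bigsetU_measurable.
have dU : [disjoint A i & \big[setU/set0]_(j <- s') A j].
  apply/disj_setPS => x [Aix]; rewrite -bigcup_seq => -[j /=].
  rewrite mem_filter => /andP[/asboolP dj _] Ajx.
  by have : (@set0 T) x by rewrite -dj; split.
rewrite UE !ge0_integral_setU//; try exact: measurable_funTS.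
apply: leeD; first by apply: fg; rewrite inE eqxx.
apply: IH.
- by rewrite (leq_ltn_trans _ sn)// size_filter count_size.
- by move=> j k /s's js /s's ks; exact: lam'.
- by move=> j /s's; exact: fg'.
Qed.

(** Weak type (1,1) for the maximal function of [h / u] relative to the measure with density [u].
    Cutting [h] where [l u < 2 h] costs the factor 2 and is what lets the bound be integrated over
    [l] to a strong type estimate. *)
Lemma laminar_weak_type (I : choiceType) (s : seq I) (A : I -> set T)
    (u h : T -> R) (l : R) :
  (forall i, measurable (A i)) -> laminar s A ->
  measurable_fun [set: T] u -> measurable_fun [set: T] h ->
  (forall x, 0 <= u x) -> (forall x, 0 <= h x) -> 0 < l ->
  (forall i, i \in s -> \int[mu]_(x in A i) (u x)%:E < +oo)%E ->
  (forall i, i \in s -> l%:E * \int[mu]_(x in A i) (u x)%:E <=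
                        \int[mu]_(x in A i) (h x)%:E)%E ->
  ((l / 2)%:E * \int[mu]_(x in \big[setU/set0]_(i <- s) A i) (u x)%:E <=
   \int[mu]_x (h x * (l * u x < 2 * h x)%R%:R)%:E)%E.
Proof.
move=> mA lam mu_ mh u0 h0 l0 uoo lu.
have mb : measurable_fun [set: T] (fun x => (l * u x < 2 * h x)%R%:R : R).
  rewrite (_ : (fun x => _) = \1_[set x | l * u x < 2 * h x]).
    apply: measurable_indic; rewrite -[X in measurable X]setTI.
    rewrite (_ : [set x | _] = (fun x => l * u x < 2 * h x) @^-1` [set true]);
      last by apply/seteqP; split=> x /=.
    by apply: measurable_fun_ltr => //; exact: measurable_funM.
  by apply/funext => x; rewrite indicE; congr ((nat_of_bool _)%:R); apply/idP/idP; rewrite inE.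
pose g x := h x * (l * u x < 2 * h x)%R%:R.
have mg : measurable_fun [set: T] g by exact: measurable_funM.
have g0 x : 0 <= g x by rewrite mulr_ge0.
have mU : measurable (\big[setU/set0]_(j <- s) A j) by exact: bigsetU_measurable.
rewrite -ge0_integralZl_EFin//; last 3 first.
- by move=> x _; rewrite lee_fin.
- exact/measurable_funTS/measurable_EFinP.
- by rewrite divr_ge0// ltW.
apply: (@le_trans _ _ (\int[mu]_(x in \big[setU/set0]_(i <- s) A i) (g x)%:E)%E);
  last first.
  apply: ge0_subset_integral => //; first exact/measurable_EFinP.
  by move=> x _; rewrite lee_fin.
apply: laminar_integral_le => //.
- exact/measurable_EFinP/measurable_funM.
- exact/measurable_EFinP.
- by move=> x; rewrite -EFinM lee_fin mulr_ge0// divr_ge0// ltW.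
move=> i si; rewrite ge0_integralZl_EFin//; last 3 first.
- by move=> x _; rewrite lee_fin.
- exact/measurable_funTS/measurable_EFinP.
- by rewrite divr_ge0// ltW.
have ufin : (\int[mu]_(x in A i) (u x)%:E)%E \is a fin_num.
  rewrite ge0_fin_numE ?uoo// integral_ge0// => x _; rewrite lee_fin//.
have : (\int[mu]_(x in A i) (h x)%:E <=
    \int[mu]_(x in A i) ((g x)%:E + (l / 2)%:E * (u x)%:E))%E.
  apply: ge0_le_integral => //.
  - by move=> x _; rewrite lee_fin.
  - exact/measurable_funTS/measurable_EFinP.
  - apply: emeasurable_funD; first exact/measurable_funTS/measurable_EFinP.
    exact/measurable_funTS/measurable_EFinP/measurable_funM.
  (* Where the indicator vanishes, [h] is at most [(l / 2) u]. *)
  move=> x _; rewrite -EFinM -EFinD lee_fin /g.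
  case: ltP => /= h'; first by rewrite mulr1 lerDl mulr_ge0// divr_ge0// ltW.
  by rewrite mulr0 add0r mulrAC ler_pdivlMr// mulrC.
rewrite ge0_integralD//; last 4 first.
- by move=> x _; rewrite lee_fin.
- exact/measurable_funTS/measurable_EFinP.
- by move=> x _; rewrite -EFinM lee_fin mulr_ge0// divr_ge0// ltW.
- exact/measurable_funTS/measurable_EFinP/measurable_funM.
rewrite ge0_integralZl_EFin//; last 3 first.
- by move=> x _; rewrite lee_fin.
- exact/measurable_funTS/measurable_EFinP.
- by rewrite divr_ge0// ltW.
move/(le_trans (lu i si)).
(* Half of [l] times the mass of [u] is absorbed on the left; [ufin] allows the cancellation. *)
rewrite [X in (X%:E * _)%E](splitr l) EFinD ge0_muleDl ?lee_fin ?divr_ge0 ?(ltW l0)//.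
by rewrite leeD2rE ?fin_numM.
Qed.

End laminar_families.

(** * Strong type bound for the dyadic maximal function *)

Section maximal_inequality.
Context {d : measure_display} {T : measurableType d} {R : realType}.
Variable mu : {measure set T -> \bar R}.

(** Finitely many values meet only finitely many dyadic levels, so the layer-cake formula becomes a
    finite sum. *)
Lemma exists_level_scale (I : eqType) (s : seq I) (m : I -> R) :
  exists tau n, [/\ 0 < tau, forall i, i \in s -> 0 < m i -> tau < m i &
    forall i, i \in s -> m i <= tau * 2 ^+ n].
Proof.
have [tau [tau0 htau]] : exists tau : R, 0 < tau /\
    forall i, i \in s -> 0 < m i -> tau < m i.
  elim: s => [|i s [tau [tau0 IH]]]; first by exists 1.
  have [mi0|mi0] := ltP 0 (m i); last first.
    exists tau; split=> // j; rewrite inE => /orP[/eqP->|/IH//].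
    by rewrite ltNge mi0.
  exists (Num.min tau (m i / 2)); split; first by rewrite lt_min tau0 divr_gt0.
  move=> j; rewrite inE gt_min => /orP[/eqP-> _|/IH/[apply]->//].
  by rewrite [X in _ || X]ltr_pdivrMr// mulr2n mulrDr mulr1 ltrDl mi0 orbT.
have [n hn] : exists n, forall i, i \in s -> m i <= tau * 2 ^+ n.
  elim: s {htau} => [|i s [n IH]]; first by exists 0%N.
  have [k hk] : exists k, m i <= tau * 2 ^+ k.
    exists (Num.truncn (m i / tau)).+1; rewrite mulrC -ler_pdivrMr//.
    apply: (le_trans (ltW (truncnS_gt _))); rewrite -natrX ler_nat.
    exact/ltnW/ltn_expl.
  exists (maxn n k) => j; rewrite inE => /orP[/eqP->|/IH hj].
    by apply: (le_trans hk); rewrite ler_pM2l// ler_eXn2l ?leq_maxr// ltr1n.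
  by apply: (le_trans hj); rewrite ler_pM2l// ler_eXn2l ?leq_maxl// ltr1n.
by exists tau, n.
Qed.

(** One summand suffices, that of the level with [tau 2^k < m <= tau 2^(k+1)]; the factor 2 moves
    from its lower end to its upper end. *)
Lemma level_decomposition (tau m t : R) n : 0 < tau -> 0 < t -> 0 <= m ->
  (0 < m -> tau < m) -> m <= tau * 2 ^+ n ->
  m `^ t <= \sum_(k < n) (2 * (tau * 2 ^+ k)) `^ t * (tau * 2 ^+ k < m)%R%:R.
Proof.
move=> tau0 t0; rewrite le_eqVlt => /predU1P[<- _ _|m0 /(_ m0) tm mn].
  by rewrite powR0 ?gt_eqF// sumr_ge0// => k _; rewrite mulr_ge0 ?powR_ge0.
have ex : exists k, m <= tau * 2 ^+ k by exists n.
have n0 : m <= tau * 2 ^+ ex_minn ex by case: ex_minnP.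
case: (ex_minnP ex) => -[|k] hk min_k.
  by move: hk; rewrite expr0 mulr1 leNgt tm.
have kn : (k < n)%N by rewrite min_k.
rewrite (bigD1 (Ordinal kn))//= ler_wpDr//.
  by rewrite sumr_ge0// => j _; rewrite mulr_ge0 ?powR_ge0.
have -> : tau * 2 ^+ k < m by rewrite ltNge; apply/negP => /min_k; rewrite ltnn.
rewrite mulr1 mulrCA -exprS ge0_ler_powR ?nnegrE ?(ltW m0) ?(ltW t0)//.
by rewrite mulr_ge0 ?exprn_ge0// ltW.
Qed.

(** The power [2^(2t)] collects [2^t] from rounding to the upper end of a level, 2 from the weak
    type bound and [2^(t-1)] from the cut at [2 h / u]; the other factor is the geometric series
    with exponent [t - 1], which blows up as t tends to 1. *)
Definition maximal_const (t : R) : R :=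
  2 `^ (2 * t) * (1 - 2 `^ (- (t - 1)))^-1.

Lemma maximal_const_gt0 (t : R) : 1 < t -> 0 < maximal_const t.
Proof.
move=> t1; rewrite mulr_gt0 ?powR_gt0// invr_gt0 subr_gt0.
by rewrite powR_expR// expR_lt1 mulNr oppr_lt0 mulr_gt0 ?subr_gt0// ln_gt0// ltr1n.
Qed.

(** The strong type (t,t) bound for the maximal function of [h / u] relative to [u dmu], linearised:
    on the disjoint pieces [E i] that function is at least [m i]. About [u dmu] only finiteness on
    the [A i] enters, so the constant depends on [t] alone. *)
Lemma dyadic_maximal_inequality (I : choiceType) (s : seq I) (A E : I -> set T)
    (m : I -> R) (u h : T -> R) (t : R) :
  1 < t -> uniq s -> laminar s A ->
  (forall i, measurable (A i)) -> (forall i, measurable (E i)) ->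
  trivIset [set` s] E -> (forall i, i \in s -> E i `<=` A i) ->
  measurable_fun [set: T] u -> measurable_fun [set: T] h ->
  (forall x, 0 < u x) -> (forall x, 0 <= h x) ->
  (forall i, i \in s -> \int[mu]_(x in A i) (u x)%:E < +oo)%E ->
  (forall i, i \in s -> 0 <= m i) ->
  (forall i, i \in s -> (m i)%:E * \int[mu]_(x in A i) (u x)%:E <=
                        \int[mu]_(x in A i) (h x)%:E)%E ->
  (\sum_(i <- s) (m i `^ t)%:E * \int[mu]_(x in E i) (u x)%:E <=
   (maximal_const t)%:E * \int[mu]_x (h x `^ t * u x `^ (1 - t))%:E)%E.
Proof.
move=> t1 us lam mA mE tE EA mu_ mh u0 h0 uoo m0 mavg.
have t0 : 0 < t by lra.
have [tau [n [tau0 htau hn]]] := exists_level_scale s m.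
pose l k := tau * 2 ^+ k.
have l0 k : 0 < l k by rewrite mulr_gt0// exprn_gt0.
have uE0 i : (0 <= \int[mu]_(x in E i) (u x)%:E)%E.
  by apply: integral_ge0 => x _; rewrite lee_fin ltW.
have mu' D : measurable_fun D (EFin \o u) by exact/measurable_funTS/measurable_EFinP.
pose b k x : R := (l k * u x < 2 * h x)%R%:R.
have mb k : measurable_fun [set: T] (b k).
  rewrite (_ : b k = \1_[set x | l k * u x < 2 * h x]).
    apply: measurable_indic; rewrite -[X in measurable X]setTI.
    rewrite (_ : [set x | _] = (fun x => l k * u x < 2 * h x) @^-1` [set true]);
      last by apply/seteqP; split=> x /=.
    by apply: measurable_fun_ltr => //; exact: measurable_funM.
  by apply/funext => x; rewrite indicE; congr ((nat_of_bool _)%:R); apply/idP/idP; rewrite inE.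
(* At a fixed level, the disjoint pieces with [m i > l k] lie in the union of their sets [A i], to
   which the weak type bound applies. *)
have level k : (\sum_(i <- s) (l k < m i)%R%:R%:E * \int[mu]_(x in E i) (u x)%:E <=
    (2 / l k)%:E * \int[mu]_x (h x * b k x)%:E)%E.
  pose s' := [seq i <- s | l k < m i].
  have s's i : i \in s' -> i \in s by rewrite mem_filter => /andP[].
  have -> : (\sum_(i <- s) (l k < m i)%R%:R%:E * \int[mu]_(x in E i) (u x)%:E =
      \sum_(i <- s') \int[mu]_(x in E i) (u x)%:E)%E.
    rewrite big_filter [RHS]big_mkcond/=; apply: eq_bigr => i _.
    by case: ifPn => _; rewrite ?mul1e ?mul0e.
  rewrite -ge0_integral_bigsetU//; last 3 first.
  - by rewrite filter_uniq.
  - by apply: sub_trivIset tE => i /= /s's.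
  - by move=> x _; rewrite lee_fin ltW.
  apply: (@le_trans _ _ (\int[mu]_(x in \big[setU/set0]_(i <- s') A i) (u x)%:E)%E).
    apply: ge0_subset_integral => //; try exact: bigsetU_measurable.
      by move=> x _; rewrite lee_fin ltW.
    by rewrite -!bigcup_seq => x [i /= is' Eix]; exists i => //=; exact/EA/Eix/s's.
  have lamk : laminar s' A by move=> i j /s's ? /s's ?; exact: lam.
  have := @laminar_weak_type _ _ _ mu I s' A u h (l k) mA lamk mu_ mh
    (fun x => ltW (u0 x)) h0 (l0 k) (fun i is' => uoo i (s's i is')).
  rewrite -(@lee_pmul2l _ (2 / l k)%:E) ?lte_fin ?divr_gt0// muleA -EFinM.
  have -> : 2 / l k * (l k / 2) = 1 by field; rewrite gt_eqF.
  rewrite mul1e.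
  apply => i is'; apply: le_trans (mavg _ (s's _ is')).
  apply: lee_wpmul2r; first by apply: integral_ge0 => x _; rewrite lee_fin ltW.
  by rewrite lee_fin ltW//; move: is'; rewrite mem_filter => /andP[].
apply: (@le_trans _ _ (\sum_(k < n) ((2 * l k) `^ t)%:E *
    \sum_(i <- s) (l k < m i)%R%:R%:E * \int[mu]_(x in E i) (u x)%:E)%E).
  under [leRHS]eq_bigr => k _.
    rewrite ge0_sume_distrr; last by move=> i _; rewrite mule_ge0.
    over.
  rewrite exchange_big/= big_seq [leRHS]big_seq; apply: lee_sum => i si.
  under eq_bigr do rewrite muleA -EFinM.
  rewrite -ge0_sume_distrl; last by move=> k _; rewrite lee_fin mulr_ge0 ?powR_ge0.
  rewrite sumEFin lee_wpmul2r// lee_fin.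
  by apply: level_decomposition => //; [exact: m0|exact: htau|exact: hn].
apply: (@le_trans _ _ (\sum_(k < n) (2 `^ (t + 1) * l k `^ (t - 1))%:E *
    \int[mu]_x (h x * b k x)%:E)%E).
  apply: lee_sum => k _.
  apply: (@le_trans _ _ (((2 * l k) `^ t)%:E * ((2 / l k)%:E *
    \int[mu]_x (h x * b k x)%:E))%E).
    by apply: lee_wpmul2l (level k); rewrite lee_fin powR_ge0.
  rewrite muleA -EFinM le_eqVlt; apply/orP; left; apply/eqP; congr (_%:E * _)%E.
  have lk0 := l0 k; rewrite powRM ?(ltW lk0)// powRD ?pnatr_eq0 ?implybT//.
  rewrite powRr1// powRB ?gt_eqF ?implybT// powRr1 ?(ltW lk0)//.
  by field; rewrite gt_eqF.
have hb0 k x : 0 <= h x * b k x by rewrite mulr_ge0.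
have mhb k : measurable_fun [set: T] (fun x => h x * b k x) by exact: measurable_funM.
under eq_bigr => k _.
  rewrite -ge0_integralZl_EFin//; last 3 first.
  - by move=> x _; rewrite lee_fin.
  - exact/measurable_EFinP.
  - by rewrite mulr_ge0 ?powR_ge0.
  over.
rewrite /= -ge0_integral_sum//; last 2 first.
- by move=> k; exact/measurable_EFinP/measurable_funM.
- by move=> k x _; rewrite -EFinM lee_fin !mulr_ge0 ?powR_ge0.
have mhu : measurable_fun [set: T] (fun x => h x `^ t * u x `^ (1 - t)).
  by apply: measurable_funM; exact: (measurableT_comp (measurable_powR _)).
have C0 := ltW (maximal_const_gt0 t1); rewrite /maximal_const in C0 *.
rewrite -ge0_integralZl_EFin//; last 2 first.
- by move=> x _; rewrite lee_fin mulr_ge0 ?powR_ge0.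
- exact/measurable_EFinP.
apply: ge0_le_integral => //.
- by move=> x _; apply: sume_ge0 => k _; rewrite -EFinM lee_fin !mulr_ge0 ?powR_ge0.
- by apply: emeasurable_sum => k; exact/measurable_EFinP/measurable_funM.
- exact/measurable_EFinP/measurable_funM.
(* Pointwise, only the levels below [2 h / u] contribute; since [t - 1 > 0] their sum is comparable
   to its largest term, and this turns [h] into [h^t u^(1-t)]. *)
move=> x _; under eq_bigr do rewrite -EFinM.
rewrite sumEFin -EFinM lee_fin.
have := @geometric_cutoff_sum R tau (t - 1) (2 * h x / u x) n tau0.
rewrite subr_gt0 => /(_ t1); rewrite divr_ge0 ?mulr_ge0 ?(ltW (u0 x))// => /(_ isT).
set c := _^-1 in C0 *; move=> geo.
have -> : \sum_(k < n) 2 `^ (t + 1) * l k `^ (t - 1) * (h x * b k x) =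
    2 `^ (t + 1) * h x * \sum_(k < n) (tau * 2 ^+ k) `^ (t - 1) *
       (tau * 2 ^+ k < 2 * h x / u x)%R%:R.
  rewrite mulr_sumr; apply: eq_bigr => k _; rewrite /b ltr_pdivlMr// /l; ring.
apply: (@le_trans _ _ (2 `^ (t + 1) * h x * (c * (2 * h x / u x) `^ (t - 1)))).
  by rewrite ler_wpM2l// mulr_ge0 ?powR_ge0.
rewrite le_eqVlt; apply/orP; left; apply/eqP.
have ux0 := u0 x; have := h0 x; rewrite le_eqVlt => /predU1P[<-|hx0].
  by rewrite mulr0 !mul0r powR0 ?gt_eqF// mul0r mulr0.
have e : 2 `^ (t + 1) * h x * (2 * h x / u x) `^ (t - 1) =
    2 `^ (2 * t) * (h x `^ t * u x `^ (1 - t)).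
  rewrite -[X in _ * X * _]powRr1 ?(ltW hx0)// !powR_expR ?divr_gt0 ?mulr_gt0//.
  rewrite -!expRD lnM ?posrE ?mulr_gt0 ?invr_gt0// lnM ?posrE// lnV ?posrE//.
  by congr expR; ring.
by rewrite mulrCA e; ring.
Qed.

End maximal_inequality.

(** * Hoelder's inequality and integrals of positive functions *)

Section positive_integrals.
Context {d : measure_display} {T : measurableType d} {R : realType}.
Variable mu : {measure set T -> \bar R}.

Lemma integral_gt0 (E : set T) (f : T -> R) :
  measurable E -> measurable_fun [set: T] f -> (forall x, 0 < f x) ->
  (0 < mu E)%E -> (0 < \int[mu]_(x in E) (f x)%:E)%E.
Proof.
move=> mE mf f0 muE; rewrite lt0e integral_ge0 ?andbT; last first.
  by move=> x _; rewrite lee_fin ltW.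
apply/negP => /eqP I0.
have : (\int[mu]_(x in E) `|(f x)%:E| = 0)%E.
  by rewrite -I0; apply: eq_integral => x _; rewrite gee0_abs// lee_fin ltW.
move/ae_eq_integral_abs => /(_ mE (measurable_funTS _)) [|N [mN N0 EN]].
  exact/measurable_EFinP.
move: muE; rewrite lt0e => /andP[/eqP + _]; apply; apply/eqP.
rewrite eq_le measure_ge0 andbT -N0 le_measure ?inE// => x Ex.
by apply: EN => /= /(_ Ex) -[fx0]; have := f0 x; rewrite fx0 ltxx.
Qed.

(** Hoelder's inequality for the product [1 = v^th u^(1-th)], obtained by integrating the weighted
    AM-GM inequality for [v / A] and [u / B]. *)
Lemma mu_le_weights (E : set T) (v u : T -> R) (th A B : R) :
  measurable E -> measurable_fun [set: T] v -> measurable_fun [set: T] u ->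
  (forall x, 0 < v x) -> (forall x, 0 < u x) -> 0 < th < 1 ->
  (forall x, v x `^ th * u x `^ (1 - th) = 1) -> 0 < A -> 0 < B ->
  (\int[mu]_(x in E) (v x)%:E = A%:E)%E -> (\int[mu]_(x in E) (u x)%:E = B%:E)%E ->
  (mu E <= (A `^ th * B `^ (1 - th))%:E)%E.
Proof.
move=> mE mv mu_ v0 u0 th01 vu A0 B0 vA uB.
have /andP[th0 th1] := th01.
set D := A `^ th * B `^ (1 - th).
have D0 : 0 < D by rewrite mulr_gt0 ?powR_gt0.
have c1 : 0 <= D * (th / A) by rewrite mulr_ge0 ?(ltW D0)// divr_ge0 ?ltW.
have c2 : 0 <= D * ((1 - th) / B).
  by rewrite mulr_ge0 ?(ltW D0)// divr_ge0 ?(ltW B0)// subr_ge0 ltW.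
apply: (@le_trans _ _ (\int[mu]_(x in E)
   ((D * (th / A))%:E * (v x)%:E + (D * ((1 - th) / B))%:E * (u x)%:E))%E).
  rewrite -[leLHS]mul1e -integral_cst//.
  apply: ge0_le_integral => //.
  - apply: emeasurable_funD; exact/measurable_funTS/measurable_EFinP/measurable_funM.
  move=> x _; rewrite -!EFinM -EFinD lee_fin /=.
  have := @weighted_AMGM R th (v x / A) (u x / B) th01.
  rewrite !divr_ge0 ?(ltW (v0 _)) ?(ltW (u0 _)) ?(ltW A0) ?(ltW B0)// => /(_ isT isT).
  rewrite !powRM ?invr_ge0 ?(ltW (v0 _)) ?(ltW (u0 _)) ?(ltW A0) ?(ltW B0)//.
  rewrite mulrACA vu mul1r -(powR_inv1 (ltW A0)) -(powR_inv1 (ltW B0)).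
  rewrite !(powRAC _ (-1)) -powRM ?powR_ge0// powR_inv1 ?(ltW D0)//.
  rewrite !powR_inv1 ?(ltW A0) ?(ltW B0)// -/D.
  by rewrite -[leLHS]mulr1 ler_pdivrMl//; congr (_ <= _); ring.
rewrite ge0_integralD//; last 4 first.
- by move=> x _; rewrite -EFinM lee_fin mulr_ge0// ltW.
- exact/measurable_funTS/measurable_EFinP/measurable_funM.
- by move=> x _; rewrite -EFinM lee_fin mulr_ge0// ltW.
- exact/measurable_funTS/measurable_EFinP/measurable_funM.
rewrite !ge0_integralZl_EFin//; first last.
- exact/measurable_funTS/measurable_EFinP.
- by move=> x _; rewrite lee_fin ltW.
- exact/measurable_funTS/measurable_EFinP.
- by move=> x _; rewrite lee_fin ltW.
rewrite vA uB -!EFinM -EFinD lee_fin le_eqVlt; apply/orP; left; apply/eqP.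
by field; rewrite !gt_eqF.
Qed.

(** Pointwise [h <= u + h^t u^(1-t)]: where [h > u], the second summand is [h (h/u)^(t-1) >= h]. *)
Lemma integral_lty_of_power (E : set T) (u h : T -> R) (t : R) :
  1 <= t -> measurable E -> measurable_fun [set: T] u ->
  measurable_fun [set: T] h -> (forall x, 0 < u x) -> (forall x, 0 <= h x) ->
  (\int[mu]_(x in E) (u x)%:E < +oo)%E ->
  (\int[mu]_x (h x `^ t * u x `^ (1 - t))%:E < +oo)%E ->
  (\int[mu]_(x in E) (h x)%:E < +oo)%E.
Proof.
move=> t1 mE mu_ mh u0 h0 uoo huoo.
have mhu : measurable_fun [set: T] (fun x => h x `^ t * u x `^ (1 - t)).
  by apply: measurable_funM; exact: (measurableT_comp (measurable_powR _)).
have hu0 x : 0 <= h x `^ t * u x `^ (1 - t) by rewrite mulr_ge0 ?powR_ge0.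
apply: (@le_lt_trans _ _ (\int[mu]_(x in E)
    ((u x)%:E + (h x `^ t * u x `^ (1 - t))%:E))%E).
  apply: ge0_le_integral => //.
  - by move=> x _; rewrite lee_fin.
  - exact/measurable_funTS/measurable_EFinP.
  - by apply: emeasurable_funD; exact/measurable_funTS/measurable_EFinP.
  move=> x _; rewrite -EFinD lee_fin.
  have [hu|uh] := leP (h x) (u x); first by rewrite ler_wpDr.
  have hx0 := lt_trans (u0 x) uh.
  apply: ler_wpDl; first exact: ltW.
  have -> : h x `^ t * u x `^ (1 - t) = h x * (h x / u x) `^ (t - 1).
    rewrite -[X in _ = X * _]powRr1 ?(ltW hx0)// !powR_expR ?divr_gt0//.
    by rewrite -!expRD lnM ?posrE ?invr_gt0// lnV ?posrE//; congr expR; ring.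
  rewrite ler_peMr// -[leLHS](powRr0 (h x / u x)) ler_powR ?subr_ge0//.
  by rewrite ler_pdivlMr// mul1r ltW.
rewrite ge0_integralD//; last 4 first.
- by move=> x _; rewrite lee_fin ltW.
- exact/measurable_funTS/measurable_EFinP.
- by move=> x _; rewrite lee_fin.
- exact/measurable_funTS/measurable_EFinP.
apply: lte_add_pinfty => //; apply: le_lt_trans huoo.
apply: ge0_subset_integral => //; first exact/measurable_EFinP.
by move=> x _; rewrite lee_fin.
Qed.

(** Serves the degenerate case of a vanishing weighted norm, in which every average of the function
    must vanish too. *)
Lemma integral_eq0_of_power (E : set T) (u h : T -> R) (t : R) :
  0 < t -> measurable E -> measurable_fun [set: T] u ->
  measurable_fun [set: T] h -> (forall x, 0 < u x) -> (forall x, 0 <= h x) ->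
  (\int[mu]_x (h x `^ t * u x `^ (1 - t))%:E = 0)%E ->
  (\int[mu]_(x in E) (h x)%:E = 0)%E.
Proof.
move=> t0 mE mu_ mh u0 h0 hu0.
have mhu : measurable_fun [set: T] (fun x => h x `^ t * u x `^ (1 - t)).
  by apply: measurable_funM; exact: (measurableT_comp (measurable_powR _)).
have : (\int[mu]_(x in [set: T]) `|(h x `^ t * u x `^ (1 - t))%:E| = 0)%E.
  by rewrite -hu0; apply: eq_integral => x _; rewrite gee0_abs// lee_fin mulr_ge0 ?powR_ge0.
move/ae_eq_integral_abs => /(_ measurableT) => /(_ (proj2 (measurable_EFinP _ _) mhu)) ae0.
have : (\int[mu]_(x in E) `|(h x)%:E| = 0)%E.
  apply/ae_eq_integral_abs => //; first exact/measurable_funTS/measurable_EFinP.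
  apply: filterS ae0 => x /(_ I) /= [] /eqP; rewrite mulf_eq0 !powR_eq0.
  by rewrite (gt_eqF (u0 x))/= orbF => /andP[/eqP -> _] _.
by move=> <-; apply: eq_integral => x _; rewrite gee0_abs// lee_fin.
Qed.

End positive_integrals.

(** * Balls, distances to sets and diameters *)

Section metric_geometry.
Context {d : measure_display} {R : realType} {M : measurableMetricType d R}.

Lemma metric_ballP (x y : M) (r : R) : ball x r y <-> mdist x y < r.
Proof. by rewrite ballEmdist. Qed.

Lemma metric_ball_subset (x y : M) (r s : R) :
  mdist x y + r <= s -> ball y r `<=` ball x s.
Proof.
move=> xyrs z /metric_ballP yz; apply/metric_ballP.
by rewrite (le_lt_trans (metric_triangle x y z))// (lt_le_trans _ xyrs)// ltrD2l.
Qed.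

Lemma metric_ball_open (x : M) (r : R) : open (ball x r).
Proof.
rewrite openE => y /metric_ballP xy; apply/nbhs_ballP.
exists (r - mdist x y); first by rewrite /= subr_gt0.
by apply: metric_ball_subset; rewrite addrC subrK.
Qed.

Lemma set_dist_mem (A : set M) (x : M) : A x -> (set_dist x A <= 0)%E.
Proof. by move=> Ax; apply: ereal_inf_lbound; exists x => //; rewrite mdistxx. Qed.

Lemma set_dist_lt (A : set M) (x : M) (r : R) :
  (set_dist x A < r%:E)%E -> exists2 y, A y & mdist x y < r.
Proof.
move=> /ereal_inf_lt[_ [y Ay <-]]; rewrite lte_fin => xy; by exists y.
Qed.

(** The distance to [A] is 1-Lipschitz, hence dilates of cubes are closed and so measurable. The
    distance may be [+oo] when [A] is empty, so a finite [s] is first inserted between [r] and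
    it. *)
Lemma set_dist_le_closed (A : set M) (r : R) :
  closed [set x | (set_dist x A <= r%:E)%E].
Proof.
rewrite -openC openE => x /= /negP; rewrite -ltNge => rA.
have [s rs sA] : exists2 s, r < s & (s%:E <= set_dist x A)%E.
  move: rA; case: (set_dist x A) => [s|_|//].
    by rewrite lte_fin => rs; exists s.
  by exists (r + 1); rewrite ?ltrDl// leey.
apply/nbhs_ballP; exists ((s - r) / 2); first by rewrite /= divr_gt0// subr_gt0.
move=> y /metric_ballP xy; apply/negP; rewrite -ltNge.
apply: (@lt_le_trans _ _ ((r + s) / 2)%:E); first by rewrite lte_fin; lra.
apply: le_ereal_inf_tmp => _ [z Az <-]; rewrite lee_fin.
have : s <= mdist x z.
  by rewrite -lee_fin; apply: (le_trans sA); apply: ereal_inf_lbound; exists z.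
have := metric_triangle x y z; lra.
Qed.

Lemma diam_mdist (A : set M) (x y : M) (r : R) :
  (diam A <= r%:E)%E -> A x -> A y -> mdist x y <= r.
Proof.
move=> Ar Ax Ay; rewrite -lee_fin; apply: le_trans Ar.
by apply: ereal_sup_ubound; exists (x, y).
Qed.

End metric_geometry.

(** * Measures of balls and cubes, and covering of dilates *)

Section doubling_spaces.
Context {d : measure_display} {R : realType} {M : measurableMetricType d R}.
Variable mu : {measure set M -> \bar R}.
Context (spaceM : doubling_metric_measure_space mu).

Lemma space_open_measurable (U : set M) : open U -> measurable U.
Proof.
by case: spaceM => _ [_ [-> _]] oU; apply: sub_sigma_algebra.
Qed.

Lemma space_ball_measurable (x : M) (r : R) : measurable (ball x r).
Proof. exact/space_open_measurable/metric_ball_open. Qed.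

Lemma space_closed_measurable (A : set M) : closed A -> measurable A.
Proof.
by move=> cA; rewrite -(setCK A); apply/measurableC/space_open_measurable/closed_openC.
Qed.

Lemma space_open_gt0 (U : set M) : open U -> U !=set0 -> (0 < mu U)%E.
Proof. by case: spaceM => _ [_ [_ [_ [+ _]]]]; exact. Qed.

Lemma space_doubling : exists2 C : R, 1 <= C &
  forall (x : M) (r : R) n, 0 < r ->
    (mu (ball x (2 ^+ n * r)) <= (C ^+ n)%:E * mu (ball x r))%E.
Proof.
case: spaceM => _ [_ [_ [_ [_ [[C dC] _]]]]].
exists (Num.max C 1); first by rewrite le_max lexx orbT.
move=> x r n r0; elim: n => [|n IH]; first by rewrite !expr0 mul1r mul1e.
rewrite exprS -mulrA; apply: (le_trans (dC _ _ _)).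
  by rewrite mulr_gt0// exprn_gt0.
apply: (@le_trans _ _ ((Num.max C 1)%:E * mu (ball x (2 ^+ n * r)))%E).
  by rewrite lee_wpmul2r// lee_fin le_max lexx.
rewrite exprS EFinM -muleA lee_wpmul2l// lee_fin le_max ler01 orbT//.
Qed.

(** Balls need not be relatively compact: a compact neighbourhood gives one small ball of finite
    measure, and doubling reaches all larger radii. *)
Lemma space_ball_lty (x : M) (r : R) : (mu (ball x r) < +oo)%E.
Proof.
have [C C1 dC] := space_doubling.
have [s s0 sfin] : exists2 s, 0 < s & (mu (ball x s) < +oo)%E.
  case: spaceM => /(_ x I)[U nU [cU clU]] [_ [_ [fin _]]].
  have nU' : nbhs x (fun y => [set: M] y -> U y) := nU.
  have /nbhs_ballP[s /= s0 sU] : nbhs x U by apply: filterS nU' => y; apply.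
  exists s => //; apply: le_lt_trans (fin _ cU); apply: le_measure => //.
    by rewrite inE; exact: space_ball_measurable.
  by rewrite inE; exact: space_closed_measurable.
have [n rn] : exists n, r <= 2 ^+ n * s.
  exists (Num.truncn (r / s)).+1; rewrite -ler_pdivrMr//.
  apply: (le_trans (ltW (truncnS_gt _))); rewrite -natrX ler_nat.
  exact/ltnW/ltn_expl.
apply: (@le_lt_trans _ _ (mu (ball x (2 ^+ n * s)))).
  by apply: le_measure; rewrite ?inE//; [exact: space_ball_measurable
    |exact: space_ball_measurable|exact: le_ball].
apply: (le_lt_trans (dC x s n s0)).
have Cn0 : 0 <= C ^+ n by rewrite exprn_ge0// (le_trans ler01).
by rewrite lte_mul_pinfty// lee_fin.
Qed.

Context {K : nat} (D : 'I_K -> dyadic_system mu).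
Implicit Types P Q : cube D.

Lemma side_length_gt0 P : 0 < side_length P.
Proof.
by rewrite /side_length exprz_gt0//; case/andP: (ratio_ok (D (tag P))).
Qed.

Lemma cube_set_round P : exists z : M,
  ball z (inner_radius (D (tag P)) * side_length P) `<=` cube_set P /\
  cube_set P `<=` ball z (outer_radius (D (tag P)) * side_length P).
Proof. exact: (cube_round (tagged (tagged P))). Qed.

Lemma inner_radius_gt0 b : 0 < inner_radius (D b).
Proof. by case/andP: (radii_ok (D b)). Qed.

Lemma cube_set_measurable P : measurable (cube_set P).
Proof. exact/space_open_measurable/cube_open. Qed.

Lemma cube_set_gt0 P : (0 < mu (cube_set P))%E.
Proof.
have [z [zP _]] := cube_set_round P; apply: space_open_gt0; first exact: cube_open.
exists z; apply/zP/ballxx; by rewrite mulr_gt0 ?inner_radius_gt0 ?side_length_gt0.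
Qed.

Lemma cube_set_lty P : (mu (cube_set P) < +oo)%E.
Proof.
have [z [_ Pz]] := cube_set_round P; apply: le_lt_trans (space_ball_lty z _).
by apply: le_measure Pz; rewrite inE;
  [exact: cube_set_measurable|exact: space_ball_measurable].
Qed.

Lemma dilate_measurable P : measurable (dilate 5 P).
Proof. exact/space_closed_measurable/set_dist_le_closed. Qed.

Lemma cube_set_sub_dilate P : cube_set P `<=` dilate 5 P.
Proof.
move=> x Px; rewrite /dilate /=; apply: (le_trans (set_dist_mem Px)).
by rewrite lee_fin mulr_ge0 ?ltW ?side_length_gt0//; lra.
Qed.

Lemma dilate_sub_ball P z :
  cube_set P `<=` ball z (outer_radius (D (tag P)) * side_length P) ->
  dilate 5 P `<=` ball z ((outer_radius (D (tag P)) + 5) * side_length P).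
Proof.
move=> Pz x; rewrite /dilate/= => xP; have l0 := side_length_gt0 P.
(* The infimum need not be attained, so [4 l] is relaxed to [5 l] to get an actual point of the
   cube. *)
have /set_dist_lt[y Py xy] : (set_dist x (cube_set P) < (5 * side_length P)%:E)%E.
  by apply: (le_lt_trans xP); rewrite lte_fin ltr_pM2r//; lra.
have /metric_ballP zy := Pz _ Py; apply/metric_ballP.
have := metric_triangle z y x; rewrite (metric_sym y x); lra.
Qed.

(** The dilate lies in a ball whose radius is a multiple of the side length. The cube covering that
    ball has comparable diameter, so finitely many doublings of the inner ball of [P] contain it. *)
Lemma dilate_in_cube : covers_balls D ->
  exists2 k : R, 1 <= k & forall P, exists Q, dilate 5 P `<=` cube_set Q /\
    (mu (cube_set Q) <= k%:E * mu (cube_set P))%E.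
Proof.
case=> Cc hCc; have [C C1 dC] := space_doubling.
(* [n b] is the number of doublings needed in system [b]; there are finitely many systems, so the
   largest one serves for all. The term [|Cc| + 1] gives a positive constant and the strict
   inequality needed for an open ball. *)
have /choice[n hn] : forall b : 'I_K, exists n,
    (`|Cc| + 1) * (outer_radius (D b) + 5) <= 2 ^+ n * inner_radius (D b).
  move=> b; set y := (`|Cc| + 1) * _.
  exists (Num.truncn (y / inner_radius (D b))).+1.
  rewrite -ler_pdivrMr ?inner_radius_gt0//.
  apply: (le_trans (ltW (truncnS_gt _))); rewrite -natrX ler_nat.
  exact/ltnW/ltn_expl.
exists (C ^+ (\max_b n b)); first by rewrite exprn_ege1.
move=> P; have [z [zP Pz]] := cube_set_round P; set b := tag P in zP Pz.
have l0 := side_length_gt0 P; set l := side_length P in zP Pz l0.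
have c0 := inner_radius_gt0 b.
have r0 : 0 < (outer_radius (D b) + 5) * l.
  rewrite mulr_gt0// (lt_le_trans c0)//; case/andP: (radii_ok (D b)) => _; lra.
have [Q [zQ dQ]] := hCc z _ r0; exists Q; split.
  exact: subset_trans (dilate_sub_ball Pz) zQ.
have Qz : cube_set Q `<=` ball z (2 ^+ n b * (inner_radius (D b) * l)).
  move=> x Qx; apply/metric_ballP.
  have zx := diam_mdist dQ (zQ _ (ballxx z r0)) Qx.
  apply: (le_lt_trans zx).
  apply: (@lt_le_trans _ _ ((`|Cc| + 1) * (outer_radius (D b) + 5) * l)).
    by rewrite -mulrA (ltr_pM2r r0) (le_lt_trans (ler_norm _))// ltrDl.
  by rewrite mulrA (ler_pM2r l0); exact: hn.
apply: (@le_trans _ _ (mu (ball z (2 ^+ n b * (inner_radius (D b) * l))))).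
  by apply: le_measure Qz; rewrite inE;
    [exact: cube_set_measurable|exact: space_ball_measurable].
have cl0 : 0 < inner_radius (D b) * l by rewrite mulr_gt0.
apply: (le_trans (dC z _ (n b) cl0)).
apply: lee_pmul => //.
- by rewrite lee_fin exprn_ge0// (le_trans ler01).
- by rewrite lee_fin ler_weXn2l// leq_bigmax.
apply: le_measure zP; rewrite inE;
    [exact: space_ball_measurable|exact: cube_set_measurable].
Qed.

Lemma same_system_laminar P Q : tag P = tag Q ->
  [\/ cube_set P `<=` cube_set Q, cube_set Q `<=` cube_set P |
      cube_set P `&` cube_set Q = set0].
Proof.
move: P Q => [b [l a]] [b' [l' a']] /= bb; subst b'; rewrite /cube_set/=.
have [ll'|/ltW l'l] := leP l l'.
  have [|e] := cube_nested ll' a a'; first by constructor 2.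
  by constructor 3; rewrite setIC.
by have [|] := cube_nested l'l a' a; [constructor 1|constructor 3].
Qed.

End doubling_spaces.

(** * Conjugate exponents in terms of the reciprocal of q0 *)

Section exponents.
Context {R : realType}.
Implicit Types p x : R.

Lemma hconj_EFin x : 1 < x -> hconj x%:E = x / (x - 1).
Proof.
move=> x1; rewrite /hconj /hoelder_conjugate /= gt_eqF; last by rewrite lte_fin; lra.
by rewrite inver subr_eq0 gt_eqF.
Qed.

Lemma star_EFin p : 2 < p -> star p%:E = p / (p - 2).
Proof.
move=> p2; rewrite /star inver pnatr_eq0/= -EFinM hconj_EFin; last by lra.
by field; rewrite !gt_eqF//; lra.
Qed.

(* [z] stands for [1 / q0], which is 0 for [q0 = +oo]. *)
Lemma exponent_reciprocal p (q0 : \bar R) : 2 < p -> (p%:E < q0)%E ->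
  exists z, [/\ 0 <= z, p * z < 1, star q0 = (1 - 2 * z)^-1 &
    hconj (q0 / p%:E) = (1 - p * z)^-1].
Proof.
move=> p2; have p0 : 0 < p by lra.
case: q0 => [q||//]; last first.
  move=> _; exists 0; rewrite !mulr0 subr0 invr1 ltr01 lexx; split=> //.
    by rewrite /star inver pnatr_eq0/= gt0_mulye// lte_fin invr_gt0.
  by rewrite inver gt_eqF//= gt0_mulye// lte_fin invr_gt0.
rewrite lte_fin => pq; have q_gt0 : 0 < q by lra.
exists q^-1; split; first by rewrite invr_ge0 ltW.
- by rewrite ltr_pdivrMr// mul1r.
- rewrite star_EFin; last by lra.
  by field; rewrite !gt_eqF//; lra.
rewrite inver (gt_eqF p0) -EFinM hconj_EFin; last by rewrite ltr_pdivlMr ?mul1r.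
by field; rewrite !gt_eqF//; lra.
Qed.

End exponents.

(** * Averages as real numbers *)

Section averages.
Context {d : measure_display} {R : realType} {M : measurableMetricType d R}.
Variable mu : {measure set M -> \bar R}.

Lemma avgE (A : set M) (h : M -> R) q : 0 < q -> mu A = q%:E ->
  avg mu A h = (q^-1%:E * \int[mu]_(x in A) (h x)%:E)%E.
Proof. by move=> q0 Aq; rewrite /avg Aq inver gt_eqF. Qed.

Lemma avg_ge0 (A : set M) (h : M -> R) : (forall x, 0 <= h x) ->
  (0 <= avg mu A h)%E.
Proof.
move=> h0; rewrite mule_ge0 ?inve_ge0// integral_ge0// => x _.
by rewrite lee_fin.
Qed.

Lemma avg_le_of_subset (A B : set M) (h : M -> R) (a i : R) :
  measurable A -> measurable B -> measurable_fun [set: M] h ->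
  (forall x, 0 <= h x) -> A `<=` B -> 0 < a ->
  (a%:E <= mu A)%E -> (mu A < +oo)%E ->
  (\int[mu]_(x in B) (h x)%:E = i%:E)%E ->
  (avg mu A h <= (i / a)%:E)%E.
Proof.
move=> mA mB mh h0 AB a0 aA Aoo Bi.
have Afin : mu A \is a fin_num by rewrite ge0_fin_numE.
have [qE q_gt0] : mu A = (fine (mu A))%:E /\ a <= fine (mu A).
  by rewrite fineK//; split=> //; rewrite -lee_fin fineK.
have q0 := lt_le_trans a0 q_gt0.
have hBA : (\int[mu]_(x in A) (h x)%:E <= i%:E)%E.
  rewrite -Bi; apply: ge0_subset_integral => //.
    exact/measurable_funTS/measurable_EFinP.
  by move=> x _; rewrite lee_fin.
rewrite (avgE _ q0 qE) muleC EFinM; apply: lee_pmul => //.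
- by apply: integral_ge0 => x _; rewrite lee_fin.
- by rewrite lee_fin lef_pV2.
Qed.

End averages.

(** * The dual weights and the characteristic *)

Section weights.
Context {d : measure_display} {R : realType} {M : measurableMetricType d R}.
Variable mu : {measure set M -> \bar R}.
Context (spaceM : doubling_metric_measure_space mu).
Context {K : nat} (D : 'I_K -> dyadic_system mu).

(** The average of [w] is a factor in the [A_p] quotient and a divisor in the reverse Hoelder
    quotient, so it cancels in their product. What remains involves only the masses [U] and [V] of
    the two dual weights. *)
Lemma weight_averages (r t : R) (w : M -> R) (Q : cube D) :
  1 <= r -> 1 < t ->
  weight mu w -> (Ap_const D t w < +oo)%E -> (RH_const D r w < +oo)%E ->
  let u := fun x => w x `^ (1 - hconj t%:E) in
  let v := fun x => w x `^ r in
  exists W q U V : R,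
  [/\ [/\ 0 < W, 0 < q, 0 < U & 0 < V],
      (Ap_const D t w * RH_const D r w = W%:E)%E,
      [/\ mu (cube_set Q) = q%:E,
      (\int[mu]_(x in cube_set Q) (u x)%:E = U%:E)%E &
      (\int[mu]_(x in cube_set Q) (v x)%:E = V%:E)%E] &
      (V / q) `^ r^-1 * (U / q) `^ (t - 1) <= W].
Proof.
move=> r1 t1 [w0 [mw _]] Aoo Boo u v.
have r0 : 0 < r by lra.
have [mQ Q0 Qoo] : [/\ measurable (cube_set Q), (0 < mu (cube_set Q))%E &
    (mu (cube_set Q) < +oo)%E].
  by split; [exact: cube_set_measurable|exact: cube_set_gt0|exact: cube_set_lty].
have Qfin : mu (cube_set Q) \is a fin_num by rewrite ge0_fin_numE.
set q := fine (mu (cube_set Q)).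
have qE : mu (cube_set Q) = q%:E by rewrite fineK.
have q0 : 0 < q by rewrite -lte_fin -qE.
have u0 x : 0 < u x by exact: powR_gt0.
have v0 x : 0 < v x by exact: powR_gt0.
have mu_ : measurable_fun [set: M] u by exact: (measurableT_comp (measurable_powR _)).
have mv : measurable_fun [set: M] v by exact: (measurableT_comp (measurable_powR _)).
have Iw0 := integral_gt0 mQ mw w0 Q0.
have Iu0 := integral_gt0 mQ mu_ u0 Q0.
have Iv0 := integral_gt0 mQ mv v0 Q0.
set Iw := (\int[mu]_(x in cube_set Q) (w x)%:E)%E in Iw0.
set Iu := (\int[mu]_(x in cube_set Q) (u x)%:E)%E in Iu0 *.
set Iv := (\int[mu]_(x in cube_set Q) (v x)%:E)%E in Iv0 *.
have qi0 : (0 < q^-1%:E)%E by rewrite lte_fin invr_gt0.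
have hA : (q^-1%:E * Iw * (q^-1%:E * Iu) `^ (t - 1) <= Ap_const D t w)%E.
  by apply: ereal_sup_ubound; exists Q => //; rewrite !(avgE _ q0 qE).
have hB : ((q^-1%:E * Iv) `^ r^-1 / (q^-1%:E * Iw) <= RH_const D r w)%E.
  by apply: ereal_sup_ubound; exists Q => //; rewrite !(avgE _ q0 qE).
have P0 : 0 < t - 1 by rewrite subr_gt0.
(* A cube need not be relatively compact, so local integrability of [w] does not bound its mass
   there. Finiteness is read off the characteristics: an infinite integral times a positive factor
   would make one of them infinite. *)
have Iwfin : Iw \is a fin_num.
  rewrite ge0_fin_numE ?(ltW Iw0)// ltNge leye_eq; apply/negP => /eqP Iwy.
  move: (le_lt_trans hA Aoo); rewrite Iwy gt0_muley// gt0_mulye ?ltxx//.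
  by rewrite poweR_gt0// mule_gt0.
have Iufin : Iu \is a fin_num.
  rewrite ge0_fin_numE ?(ltW Iu0)// ltNge leye_eq; apply/negP => /eqP Iuy.
  move: (le_lt_trans hA Aoo); rewrite Iuy (gt0_muley qi0) poweRyr ?gt_eqF//.
  by rewrite gt0_muley ?ltxx// mule_gt0.
pose wq := fine Iw; have Ew : Iw = wq%:E by rewrite fineK.
pose U := fine Iu; have Eu : Iu = U%:E by rewrite fineK.
have wq0 : 0 < wq by rewrite -lte_fin -Ew.
have U0 : 0 < U by rewrite -lte_fin -Eu.
have wqq0 : 0 < q^-1 * wq by rewrite mulr_gt0 ?invr_gt0.
rewrite Ew Eu -!EFinM in hA.
rewrite Ew -EFinM inver gt_eqF// in hB; have hB' := le_lt_trans hB Boo.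
have Ivfin : Iv \is a fin_num.
  rewrite ge0_fin_numE ?(ltW Iv0)// ltNge leye_eq; apply/negP => /eqP Ivy.
  move: hB'; rewrite Ivy gt0_muley// poweRyr ?gt_eqF ?invr_gt0//.
  by rewrite gt0_mulye ?ltxx// lte_fin invr_gt0.
pose V := fine Iv; have Ev : Iv = V%:E by rewrite fineK.
have V0 : 0 < V by rewrite -lte_fin -Ev.
rewrite Ev -!EFinM in hB.
have Afin : Ap_const D t w \is a fin_num.
  by rewrite ge0_fin_numE// (le_trans _ hA)// lee_fin mulr_ge0 ?powR_ge0 ?ltW.
have Bfin : RH_const D r w \is a fin_num.
  by rewrite ge0_fin_numE// (le_trans _ hB)// lee_fin mulr_ge0 ?powR_ge0 ?invr_ge0 ?ltW.
pose a := fine (Ap_const D t w); have Ea : Ap_const D t w = a%:E by rewrite fineK.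
pose b := fine (RH_const D r w); have Eb : RH_const D r w = b%:E by rewrite fineK.
rewrite Ea lee_fin in hA; rewrite Eb lee_fin in hB.
have Vq0 : 0 < q^-1 * V by rewrite mulr_gt0 ?invr_gt0.
have Uq0 : 0 < q^-1 * U by rewrite mulr_gt0 ?invr_gt0.
have key : (V / q) `^ r^-1 * (U / q) `^ (t - 1) <= a * b.
  have := ler_pM _ _ hA hB.
  rewrite !mulr_ge0 ?powR_ge0 ?invr_ge0 ?(ltW wqq0) ?(ltW q0) ?(ltW wq0)//.
  move=> /(_ isT isT); apply: le_trans; rewrite ![_ / q]mulrC.
  set X := _ `^ _; set Y := _ `^ _; set Z := q^-1 * wq in wqq0 *.
  by rewrite (_ : Z * Y * (X / Z) = X * Y)//; field; rewrite gt_eqF.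
have ab0 : 0 < a * b.
  by apply: (lt_le_trans _ key); rewrite mulr_gt0 ?powR_gt0 ?divr_gt0.
by exists (a * b), q, U, V; rewrite Ea Eb -EFinM.
Qed.

End weights.

(** * The upper bound *)

Section upper_bound.
Context {d : measure_display} {R : realType} {M : measurableMetricType d R}.
Variable mu : {measure set M -> \bar R}.
Context (spaceM : doubling_metric_measure_space mu).
Context {K : nat} (D : 'I_K -> dyadic_system mu).

(** Only cubes of the same system form a laminar family, so the sum is grouped by the system of the
    covering cube [Q P]. The factor [K.+1] in place of [K] keeps the constant positive. *)
Lemma sparse_maximal_inequality (s : seq (cube D)) (Q : cube D -> cube D)
    (F : cube D -> set M) (m : cube D -> R) (u h : M -> R) (t : R) :
  1 < t -> uniq s -> (forall P, measurable (F P)) -> trivIset [set` s] F ->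
  (forall P, P \in s -> F P `<=` cube_set (Q P)) ->
  measurable_fun [set: M] u -> measurable_fun [set: M] h ->
  (forall x, 0 < u x) -> (forall x, 0 <= h x) ->
  (forall P, P \in s -> \int[mu]_(x in cube_set (Q P)) (u x)%:E < +oo)%E ->
  (forall P, P \in s -> 0 <= m P) ->
  (forall P, P \in s -> (m P)%:E * \int[mu]_(x in cube_set (Q P)) (u x)%:E <=
                        \int[mu]_(x in cube_set (Q P)) (h x)%:E)%E ->
  (\sum_(P <- s) (m P `^ t)%:E * \int[mu]_(x in F P) (u x)%:E <=
   (K.+1%:R * maximal_const t)%:E *
     \int[mu]_x (h x `^ t * u x `^ (1 - t))%:E)%E.
Proof.
move=> t1 us mF tF FQ mu_ mh u0 h0 uoo m0 mavg.
have I0 : (0 <= \int[mu]_x (h x `^ t * u x `^ (1 - t))%:E)%E.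
  by apply: integral_ge0 => x _; rewrite lee_fin mulr_ge0 ?powR_ge0.
have c0 := ltW (maximal_const_gt0 t1).
rewrite (partition_big (fun P => tag (Q P)) xpredT)//=.
apply: (@le_trans _ _ (\sum_(b < K) (maximal_const t)%:E *
    \int[mu]_x (h x `^ t * u x `^ (1 - t))%:E)%E).
  apply: lee_sum => b _; rewrite -big_filter.
  set s' := [seq P <- s | _].
  have s's P : P \in s' -> P \in s by rewrite mem_filter => /andP[].
  apply: (@dyadic_maximal_inequality _ _ _ _ _ _ (fun P => cube_set (Q P))) => //.
  - by rewrite filter_uniq.
  - move=> P P'; rewrite !mem_filter => /andP[/eqP Pb _] /andP[/eqP P'b _].
    by apply: same_system_laminar; rewrite Pb.
  - by move=> P; exact: cube_set_measurable.
  - by apply: sub_trivIset tF => P /= /s's.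
  - by move=> P /s's; exact: FQ.
  - by move=> P /s's; exact: uoo.
  - by move=> P /s's; exact: m0.
  - by move=> P /s's; exact: mavg.
rewrite -ge0_sume_distrl; last by move=> b _; rewrite lee_fin.
rewrite sumEFin sumr_const card_ord lee_wpmul2r// lee_fin mulr_natl.
by rewrite mulrSr lerDl.
Qed.

Lemma poweR_le_fin (x : \bar R) (y e : R) : 0 <= e -> (0 <= x)%E ->
  (x <= y%:E)%E -> (x `^ e <= (y `^ e)%:E)%E.
Proof.
move=> e0 x0 xy; rewrite -poweR_EFin gt0_ler_poweR ?in_itv/= ?x0 ?leey//.
by rewrite (le_trans x0 xy).
Qed.

Lemma ge0_lty_EFin (x : \bar R) : (0 <= x)%E -> (x < +oo)%E ->
  exists2 y, 0 <= y & x = y%:E.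
Proof. by case: x => // y y0 _; exists y. Qed.

Context (a p z G : R) (a1 : 1 <= a) (a2 : a < 2) (p2 : 2 < p) (z0 : 0 <= z)
  (pz : p * z < 1) (G1 : 2 / (p - a) <= G) (G2 : (1 - 2 * z) / (1 - p * z) <= G).
Let r := (1 - p * z)^-1.
Let s := (1 - 2 * z)^-1.
Let ps := p / (p - 2).

(** Reduces a term to quantities that can be summed: [mf] and [mg] are lower bounds for the two dual
    maximal functions on [Q], and [UE], [VE] are the dual masses of the sparse part [E]. The powers
    of [k] pay for replacing the averages on the dilate by averages on [Q]. *)
Lemma sparse_term_le (k : R) (P Q : cube D) (E : set M) (f g w : M -> R) (W : R) :
  let u := fun x => w x `^ (1 - hconj (p / a)%:E) in
  let v := fun x => w x `^ r in
  let fa := fun x => `|f x| `^ a in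
  let gs := fun x => `|g x| `^ s in
  1 <= k -> dilate 5 P `<=` cube_set Q ->
  (mu (cube_set Q) <= k%:E * mu (cube_set P))%E ->
  measurable E -> E `<=` cube_set P ->
  ((2^-1)%:E * mu (cube_set P) < mu E)%E ->
  weight mu w -> (Ap_const D (p / a) w < +oo)%E -> (RH_const D r w < +oo)%E ->
  (Ap_const D (p / a) w * RH_const D r w = W%:E)%E ->
  measurable_fun [set: M] f -> measurable_fun [set: M] g ->
  (\int[mu]_(x in cube_set Q) (fa x)%:E < +oo)%E ->
  (\int[mu]_(x in cube_set Q) (gs x)%:E < +oo)%E ->
  exists mf mg UE VE : R,
  [/\ [/\ 0 <= mf, 0 <= mg, 0 <= UE & 0 <= VE],
     (mf%:E * \int[mu]_(x in cube_set Q) (u x)%:E <=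
       \int[mu]_(x in cube_set Q) (fa x)%:E)%E /\
     (mg%:E * \int[mu]_(x in cube_set Q) (v x)%:E <=
       \int[mu]_(x in cube_set Q) (gs x)%:E)%E,
     (\int[mu]_(x in cube_set Q) (u x)%:E < +oo)%E /\
       (\int[mu]_(x in cube_set Q) (v x)%:E < +oo)%E,
     (\int[mu]_(x in E) (u x)%:E = UE%:E)%E /\
       (\int[mu]_(x in E) (v x)%:E = VE%:E)%E &
     ((avg mu (dilate 5 P) fa) `^ (2 / a) *
      (avg mu (dilate 5 P) gs) `^ s^-1 * mu (cube_set P) <=
      (k `^ (2 / a) * k `^ s^-1 * (2 * k) `^ ((G - 2 / p) * (p / a - p * z)) *
       W `^ G * ((mf `^ (p / a) * UE) `^ (2 / p) *
                 (mg `^ (ps / s) * VE) `^ (1 - 2 / p)))%:E)%E].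
Proof.
move=> u v fa gs k1 PQ QP mE EP PE hw Aoo Boo AB mf_ mg_ foo goo.
have [a1' a2' p2' z0' pz'] := And5 a1 a2 p2 z0 pz.
have a0 : 0 < a by lra.
have p0 : 0 < p by lra.
have k0 : 0 < k by lra.
have ap : a < p by lra.
have R0 : 0 < 1 - p * z by lra.
have pz0 : 0 <= (p - 2) * z by rewrite mulr_ge0 ?subr_ge0 ?(ltW p2).
have z2 : 2 * z < 1 by lra.
have t1 : 1 < p / a by rewrite ltr_pdivlMr ?mul1r.
have r1 : 1 <= r by rewrite /r -[leLHS]invr1 lef_pV2 ?posrE//; lra.
have [W' [q [U [V [[W0 q0 U0 V0] AB' [Qq QU QV] key]]]]] :=
  weight_averages spaceM Q r1 t1 hw Aoo Boo.
have WW : W' = W by apply: EFin_inj; rewrite -AB' -AB.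
rewrite WW in W0 key.
have [w0 [mw _]] := hw.
have u0 x : 0 < u x by exact: powR_gt0.
have v0 x : 0 < v x by exact: powR_gt0.
have mu_ : measurable_fun [set: M] u by exact: (measurableT_comp (measurable_powR _)).
have mv : measurable_fun [set: M] v by exact: (measurableT_comp (measurable_powR _)).
have fa0 x : 0 <= fa x by exact: powR_ge0.
have gs0 x : 0 <= gs x by exact: powR_ge0.
have mfa : measurable_fun [set: M] fa.
  by apply: (measurableT_comp (measurable_powR _)); exact: measurableT_comp.
have mgs : measurable_fun [set: M] gs.
  by apply: (measurableT_comp (measurable_powR _)); exact: measurableT_comp.
have mP := cube_set_measurable spaceM P.
have mQ := cube_set_measurable spaceM Q.
have mdP := dilate_measurable spaceM P.
have PdP := @cube_set_sub_dilate _ _ _ _ _ D P.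
have EQ : E `<=` cube_set Q by apply: (subset_trans EP); exact: subset_trans PQ.
have Pq : (k^-1%:E * q%:E <= mu (cube_set P))%E.
  have : (k^-1%:E * q%:E <= k^-1%:E * (k%:E * mu (cube_set P)))%E.
    by rewrite -Qq lee_wpmul2l// lee_fin invr_ge0 ltW.
  by rewrite [leRHS]muleA -[X in (X * mu _)%E]EFinM mulVf ?gt_eqF// mul1e.
have PqE : (mu (cube_set P) <= q%:E)%E.
  by rewrite -Qq; apply: le_measure; rewrite ?inE//; exact: subset_trans PQ.
(* [P] has at least [1/k] of the measure of [Q], and [E] more than half of that of [P]: this is
   where [2 k] comes from. *)
have Eq : ((2 * k)^-1%:E * q%:E <= mu E)%E.
  by apply: le_trans (ltW PE); rewrite invfM EFinM -muleA lee_wpmul2l//.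
have Efin : mu E \is a fin_num.
  rewrite ge0_fin_numE//; apply: (@le_lt_trans _ _ q%:E); last exact: ltry.
  by rewrite -Qq; apply: le_measure; rewrite ?inE.
have kq0 : 0 < (2 * k)^-1 * q by rewrite mulr_gt0 ?invr_gt0 ?mulr_gt0.
have E0 : (0 < mu E)%E by apply: lt_le_trans Eq; rewrite -EFinM lte_fin.
have EU : (\int[mu]_(x in E) (u x)%:E <= U%:E)%E.
  rewrite -QU; apply: ge0_subset_integral => //.
    exact/measurable_funTS/measurable_EFinP.
  by move=> x _; rewrite lee_fin ltW.
have EV : (\int[mu]_(x in E) (v x)%:E <= V%:E)%E.
  rewrite -QV; apply: ge0_subset_integral => //.
    exact/measurable_funTS/measurable_EFinP.
  by move=> x _; rewrite lee_fin ltW.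
have EU0 := integral_gt0 mE mu_ u0 E0.
have EV0 := integral_gt0 mE mv v0 E0.
have [UE _ UEE] := ge0_lty_EFin (ltW EU0) (le_lt_trans EU (ltry U)).
have [VE _ VEE] := ge0_lty_EFin (ltW EV0) (le_lt_trans EV (ltry V)).
have UE0 : 0 < UE by move: EU0; rewrite UEE lte_fin.
have VE0 : 0 < VE by move: EV0; rewrite VEE lte_fin.
rewrite UEE lee_fin in EU; rewrite VEE lee_fin in EV.
have ff0 : (0 <= \int[mu]_(x in cube_set Q) (fa x)%:E)%E.
  by apply: integral_ge0 => x _; rewrite lee_fin.
have gg0 : (0 <= \int[mu]_(x in cube_set Q) (gs x)%:E)%E.
  by apply: integral_ge0 => x _; rewrite lee_fin.
have [If If0 IfE] := ge0_lty_EFin ff0 foo.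
have [Ig Ig0 IgE] := ge0_lty_EFin gg0 goo.
have P1 : 0 < p / a - 1 by rewrite subr_gt0.
have D0 : 0 < p / a - p * z by lra.
(* With Z = 1 - p z and P = p/a - 1 one has v = w^(1/Z) and u = w^(-1/P), so th = Z/(Z+P) is the
   exponent for which v^th u^(1-th) = 1. *)
pose th := (1 - p * z) / (p / a - p * z).
have th01 : 0 < th < 1.
  by rewrite divr_gt0//= ltr_pdivrMr// mul1r; lra.
have th'E : 1 - th = (p / a - 1) / (p / a - p * z).
  by rewrite /th; move: D0; set X := p / a => D0; field; rewrite gt_eqF.
have tE : 1 - hconj (p / a)%:E = - (p / a - 1)^-1.
  rewrite hconj_EFin//; move: P1; set X := p / a => P1; field; rewrite gt_eqF//.
have vu x : v x `^ th * u x `^ (1 - th) = 1.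
  rewrite /v /u -!powRrM -powRD; last by rewrite (gt_eqF (w0 x)) implybT.
  rewrite th'E tE /th /r (_ : _ + _ = 0) ?powRr0//.
  move: P1 D0; set X := p / a => P1 D0; field; rewrite !gt_eqF//.
have hE := mu_le_weights mE mv mu_ v0 u0 th01 vu VE0 UE0 VEE UEE.
have qE : q <= 2 * k * (VE `^ th * UE `^ (1 - th)).
  rewrite -ler_pdivrMl ?mulr_gt0// -lee_fin EFinM; exact: le_trans hE.
have k20 : 0 < 2 * k by rewrite mulr_gt0.
have hF : q `^ (p / a - p * z) <=
    (2 * k) `^ (p / a - p * z) * VE `^ (1 - p * z) * UE `^ (p / a - 1).
  have VEth0 := powR_ge0 VE th; have UEth0 := powR_ge0 UE (1 - th).
  have := @ge0_ler_powR R _ (ltW D0) q _ _ _ qE.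
  rewrite !nnegrE (ltW q0) !mulr_ge0 ?(ltW k0)// => /(_ isT isT).
  rewrite (powRM _ (ltW k20) (mulr_ge0 VEth0 UEth0)) (powRM _ VEth0 UEth0).
  by rewrite -!powRrM th'E /th !divfK ?gt_eqF// mulrA.
rewrite invrK in key.
have main := two_weight_inequality a0 ap p2 pz G1 G2 W0 k20 q0 UE0 VE0 key hF EU EV.
have QU' : (\int[mu]_(x in cube_set Q) (u x)%:E = U%:E)%E := QU.
have QV' : (\int[mu]_(x in cube_set Q) (v x)%:E = V%:E)%E := QV.
have IU0 : 0 <= If / U by exact: divr_ge0 If0 (ltW U0).
have IV0 : 0 <= Ig / V by exact: divr_ge0 Ig0 (ltW V0).
(* The averages on [Q] of [fa / u] for [u dmu] and of [gs / v] for [v dmu]. *)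
exists (If / U), (Ig / V), UE, VE; split.
- by split; [exact: IU0|exact: IV0|exact: ltW UE0|exact: ltW VE0].
- rewrite QU' QV' IfE IgE -!EFinM (divfK (lt0r_neq0 U0)).
  by rewrite (divfK (lt0r_neq0 V0)); split; exact: lexx.
- by rewrite QU' QV'; split; exact: ltry.
- by split; [exact: UEE|exact: VEE].
have dPq : ((k^-1 * q)%:E <= mu (dilate 5 P))%E.
  rewrite EFinM; apply: (le_trans Pq); apply: le_measure; rewrite ?inE//.
have dPoo : (mu (dilate 5 P) < +oo)%E.
  apply: (@le_lt_trans _ _ q%:E); last exact: ltry.
  by rewrite -Qq; apply: le_measure; rewrite ?inE.
have kiq0 : 0 < k^-1 * q by rewrite mulr_gt0 ?invr_gt0.
have avf := avg_le_of_subset mdP mQ mfa fa0 PQ kiq0 dPq dPoo IfE.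
have avg_ := avg_le_of_subset mdP mQ mgs gs0 PQ kiq0 dPq dPoo IgE.
have s0 : 0 <= s^-1 by rewrite invrK; lra.
have a20 : 0 <= 2 / a by rewrite divr_ge0 ?ltW.
apply: (@le_trans _ _ ((If / (k^-1 * q)) `^ (2 / a) *
    (Ig / (k^-1 * q)) `^ s^-1 * q)%:E).
  rewrite EFinM EFinM; apply: lee_pmul => //.
  - by rewrite mule_ge0 ?poweR_ge0.
  - apply: lee_pmul; rewrite ?poweR_ge0//.
      exact: (poweR_le_fin a20 (avg_ge0 _ _ fa0)).
    exact: (poweR_le_fin s0 (avg_ge0 _ _ gs0)).
rewrite lee_fin.
have EfE : If / (k^-1 * q) = k * (If / U * (U / q)) by field; rewrite !gt_eqF.
have EgE : Ig / (k^-1 * q) = k * (Ig / V * (V / q)) by field; rewrite !gt_eqF.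
have Uq0 : 0 <= U / q by rewrite divr_ge0 ?ltW.
have Vq0 : 0 <= V / q by rewrite divr_ge0 ?ltW.
rewrite EfE EgE (powRM _ (ltW k0) (mulr_ge0 IU0 Uq0)).
rewrite (powRM _ (ltW k0) (mulr_ge0 IV0 Vq0)) (powRM _ IU0 Uq0) (powRM _ IV0 Vq0).
rewrite (powRM _ (powR_ge0 _ _) (ltW UE0)) (powRM _ (powR_ge0 _ _) (ltW VE0)).
rewrite -!powRrM.
(* The powers [p / a] and [ps / s] of the maximal bounds, under the Hoelder exponents [2 / p] and
   [1 - 2 / p], give back the exponents of the sparse form. *)
have -> : p / a * (2 / p) = 2 / a by field; rewrite !gt_eqF.
have -> : ps / s * (1 - 2 / p) = s^-1.
  by rewrite /ps invrK; field; rewrite !gt_eqF//; lra.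
set kf := k `^ (2 / a); set kg := k `^ s^-1; set x := (If / U) `^ _; set y := (Ig / V) `^ _.
set kk := (2 * k) `^ _ in main *.
have c0 : 0 <= kf * kg * (x * y) by rewrite !mulr_ge0 ?powR_ge0.
have := ler_wpM2l c0 main; rewrite /kg /y invrK; congr (_ <= _); ring.
Qed.

End upper_bound.

(** * Summation over finite sparse families *)

Section upper_bound_theorem.
Context {d : measure_display} {R : realType} {M : measurableMetricType d R}.
Variable mu : {measure set M -> \bar R}.
Context (spaceM : doubling_metric_measure_space mu).
Context {K : nat} (D : 'I_K -> dyadic_system mu).
Context (a p z G : R) (a1 : 1 <= a) (a2 : a < 2) (p2 : 2 < p) (z0 : 0 <= z)
  (pz : p * z < 1) (G1 : 2 / (p - a) <= G) (G2 : (1 - 2 * z) / (1 - p * z) <= G).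
Let r := (1 - p * z)^-1.
Let s := (1 - 2 * z)^-1.
Let ps := p / (p - 2).

(** Recognises the weighted norm of f in the right side of the maximal inequality: with t = p/a, the
    identity (1 - t)(1 - t') = 1 returns the weight itself. *)
Lemma dual_power_f (w y : R) : 0 < w -> 0 <= y ->
  (y `^ a) `^ (p / a) * (w `^ (1 - hconj (p / a)%:E)) `^ (1 - p / a) = y `^ p * w.
Proof.
have [a1' a2' p2'] := And3 a1 a2 p2.
have a0 : 0 < a by lra.
have t1 : 1 < p / a by rewrite ltr_pdivlMr//; lra.
move=> w0 y0; rewrite -!powRrM hconj_EFin//; congr (_ `^ _ * _).
  by field; rewrite gt_eqF.
rewrite -[RHS]powRr1 ?(ltW w0)//; congr (_ `^ _).
by move: t1; set X := p / a => t1; field; rewrite gt_eqF// subr_gt0.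
Qed.

(** The counterpart for g: [r (1 - ps / s) = 1 - ps], so the dual of [v] is the weight sigma. *)
Lemma dual_power_g (w y : R) : 0 < w -> 0 <= y ->
  (y `^ s) `^ (ps / s) * (w `^ r) `^ (1 - ps / s) = y `^ ps * w `^ (1 - ps).
Proof.
have [p2' z0' pz'] := And3 p2 z0 pz.
have pz0 : 0 <= (p - 2) * z by rewrite mulr_ge0// subr_ge0 ltW.
have z2 : 0 < 1 - 2 * z by lra.
have z3 : 0 < 1 - p * z by lra.
have p3 : 0 < p - 2 by lra.
move=> w0 y0; rewrite -!powRrM; congr (_ `^ _ * _ `^ _).
  by rewrite /ps /s; field; rewrite !gt_eqF.
by rewrite /ps /s /r; field; rewrite !gt_eqF.
Qed.

(** Each term is a product of powers [2 / p] and [1 - 2 / p], one factor for f and one for g.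
    Hoelder's inequality for sums separates them into two sums over the disjoint sets [F P], each
    controlled by a maximal function. *)
Lemma finite_sparse_sum_le (k : R) (Q : cube D -> cube D) (F : cube D -> set M)
    (X : seq (cube D)) (f g w : M -> R) (W nf ng : R) :
  1 <= k -> uniq X ->
  (forall P, dilate 5 P `<=` cube_set (Q P) /\
    (mu (cube_set (Q P)) <= k%:E * mu (cube_set P))%E) ->
  (forall P, measurable (F P)) -> trivIset [set` X] F ->
  (forall P, P \in X -> F P `<=` cube_set P) ->
  (forall P, P \in X -> (2^-1)%:E * mu (cube_set P) < mu (F P))%E ->
  weight mu w -> (Ap_const D (p / a) w < +oo)%E -> (RH_const D r w < +oo)%E ->
  (Ap_const D (p / a) w * RH_const D r w = W%:E)%E ->
  measurable_fun [set: M] f -> measurable_fun [set: M] g ->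
  (\int[mu]_x (`|f x| `^ p * w x)%:E = nf%:E)%E ->
  (\int[mu]_x (`|g x| `^ ps * w x `^ (1 - ps))%:E = ng%:E)%E ->
  (\sum_(P <- X)
     ((avg mu (dilate 5 P) (fun x => `|f x| `^ a)%R) `^ (2 / a) *
      (avg mu (dilate 5 P) (fun x => `|g x| `^ s)%R) `^ s^-1 * mu (cube_set P)) <=
    (k `^ (2 / a) * k `^ s^-1 * (2 * k) `^ ((G - 2 / p) * (p / a - p * z)) *
     (K.+1%:R * maximal_const (p / a)) `^ (2 / p) *
     (K.+1%:R * maximal_const (ps / s)) `^ (1 - 2 / p) *
     W `^ G * (nf `^ (2 / p) * ng `^ (1 - 2 / p)))%:E)%E.
Proof.
have [a1' a2' p2' z0' pz'] := And5 a1 a2 p2 z0 pz.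
move=> k1 uX hQ mF tF FP PF hw Aoo Boo AB mf mg nfE ngE.
have a0 : 0 < a by lra.
have p0 : 0 < p by lra.
have pz0 : 0 <= (p - 2) * z by rewrite mulr_ge0// subr_ge0 ltW.
have z2 : 0 < 1 - 2 * z by lra.
have z3 : 0 < 1 - p * z by lra.
have p3 : 0 < p - 2 by lra.
have t1 : 1 < p / a by rewrite ltr_pdivlMr//; lra.
have t2 : 1 < ps / s.
  by rewrite /ps /s invrK mulrAC ltr_pdivlMr// mul1r; lra.
have r1 : 1 <= r by rewrite /r -[leLHS]invr1 lef_pV2 ?posrE//; nra.
have p20 : 0 < 2 / p by rewrite divr_gt0.
have p21 : 2 / p < 1 by rewrite ltr_pdivrMr// mul1r.
have [w0 [mw _]] := hw.
pose u x := w x `^ (1 - hconj (p / a)%:E).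
pose v x := w x `^ r.
pose fa x := `|f x| `^ a.
pose gs x := `|g x| `^ s.
have u0 x : 0 < u x by exact: powR_gt0.
have v0 x : 0 < v x by exact: powR_gt0.
have mu_ : measurable_fun [set: M] u by exact: (measurableT_comp (measurable_powR _)).
have mv : measurable_fun [set: M] v by exact: (measurableT_comp (measurable_powR _)).
have fa0 x : 0 <= fa x by exact: powR_ge0.
have gs0 x : 0 <= gs x by exact: powR_ge0.
have mfa : measurable_fun [set: M] fa.
  by apply: (measurableT_comp (measurable_powR _)); exact: measurableT_comp.
have mgs : measurable_fun [set: M] gs.
  by apply: (measurableT_comp (measurable_powR _)); exact: measurableT_comp.
have faE : (\int[mu]_x (fa x `^ (p / a) * u x `^ (1 - p / a))%:E = nf%:E)%E.
  rewrite -nfE; apply: eq_integral => x _; congr (_%:E).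
  exact: dual_power_f (w0 x) (normr_ge0 _).
have gsE : (\int[mu]_x (gs x `^ (ps / s) * v x `^ (1 - ps / s))%:E = ng%:E)%E.
  rewrite -ngE; apply: eq_integral => x _; congr (_%:E).
  exact: dual_power_g (w0 x) (normr_ge0 _).
have W0 P : P \in X -> 0 < W.
  move=> PX; have [W' [q [U [V [[W0 _ _ _] AB' _ _]]]]] :=
    weight_averages spaceM P r1 t1 hw Aoo Boo.
  by have -> : W = W' by apply: EFin_inj; rewrite -AB -AB'.
(* The data of a term are packed into one tuple so that choice yields functions on cubes; outside
   [X] the tuple is a dummy. *)
pose good P (m : R * R * R * R) := let: (mf, mg, UE, VE) := m in
  [/\ [/\ 0 <= mf, 0 <= mg, 0 <= UE & 0 <= VE],
     (mf%:E * \int[mu]_(x in cube_set (Q P)) (u x)%:E <=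
       \int[mu]_(x in cube_set (Q P)) (fa x)%:E)%E /\
     (mg%:E * \int[mu]_(x in cube_set (Q P)) (v x)%:E <=
       \int[mu]_(x in cube_set (Q P)) (gs x)%:E)%E,
     (\int[mu]_(x in cube_set (Q P)) (u x)%:E < +oo)%E /\
       (\int[mu]_(x in cube_set (Q P)) (v x)%:E < +oo)%E,
     (\int[mu]_(x in F P) (u x)%:E = UE%:E)%E /\
       (\int[mu]_(x in F P) (v x)%:E = VE%:E)%E &
     ((avg mu (dilate 5 P) fa) `^ (2 / a) *
      (avg mu (dilate 5 P) gs) `^ s^-1 * mu (cube_set P) <=
      (k `^ (2 / a) * k `^ s^-1 * (2 * k) `^ ((G - 2 / p) * (p / a - p * z)) *
       W `^ G * ((mf `^ (p / a) * UE) `^ (2 / p) *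
                 (mg `^ (ps / s) * VE) `^ (1 - 2 / p)))%:E)%E].
have /choice[m hm] : forall P, exists m, P \in X -> good P m.
  move=> P; have [PX|_] := boolP (P \in X); last by exists (0, 0, 0, 0).
  have [PQ QP] := hQ P.
  have [W' [q [U [V [_ _ [_ QU QV] _]]]]] :=
    weight_averages spaceM (Q P) r1 t1 hw Aoo Boo.
  have mQ := cube_set_measurable spaceM (Q P).
  have foo : (\int[mu]_(x in cube_set (Q P)) (fa x)%:E < +oo)%E.
    apply: (integral_lty_of_power (ltW t1) mQ mu_ mfa u0 fa0).
      by rewrite QU ltry.
    by rewrite faE ltry.
  have goo : (\int[mu]_(x in cube_set (Q P)) (gs x)%:E < +oo)%E.
    apply: (integral_lty_of_power (ltW t2) mQ mv mgs v0 gs0).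
      by rewrite QV ltry.
    by rewrite gsE ltry.
  have [mf' [mg' [UE [VE h]]]] := sparse_term_le spaceM a1 a2 p2 z0 pz G1 G2
    k1 PQ QP (mF P) (FP P PX) (PF P PX) hw Aoo Boo AB mf mg foo goo.
  by exists (mf', mg', UE, VE) => _.
pose al P := (m P).1.1.1 `^ (p / a) * (m P).1.2.
pose be P := (m P).1.1.2 `^ (ps / s) * (m P).2.
have al0 P : P \in X -> 0 <= al P.
  move=> /hm; rewrite /al; case: (m P) => [[[mf' mg'] UE] VE] [[? ? ? ?] _ _ _ _].
  by rewrite mulr_ge0 ?powR_ge0.
have be0 P : P \in X -> 0 <= be P.
  move=> /hm; rewrite /be; case: (m P) => [[[mf' mg'] UE] VE] [[? ? ? ?] _ _ _ _].
  by rewrite mulr_ge0 ?powR_ge0.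
have FQ P : P \in X -> F P `<=` cube_set (Q P).
  move=> PX; have [PQ _] := hQ P; apply: (subset_trans (FP P PX)).
  exact: subset_trans (@cube_set_sub_dilate _ _ _ _ _ D P) PQ.
have sal : \sum_(P <- X) al P <= K.+1%:R * maximal_const (p / a) * nf.
  have := @sparse_maximal_inequality _ _ _ mu spaceM _ D X Q F
    (fun P => (m P).1.1.1) u fa (p / a) t1 uX mF tF FQ mu_ mfa u0 fa0.
  rewrite faE -EFinM => h; rewrite -lee_fin -sumEFin.
  rewrite [leLHS](_ : _ = \sum_(P <- X) ((m P).1.1.1 `^ (p / a))%:E *
      \int[mu]_(x in F P) (u x)%:E)%E; last first.
    rewrite big_seq [RHS]big_seq; apply: eq_bigr => P /hm; rewrite /al.
    by case: (m P) => [[[mf' mg'] UE] VE] [_ _ _ [-> _] _]; rewrite EFinM.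
  apply: h => P /hm; case: (m P) => [[[mf' mg'] UE] VE] [[mf0 _ _ _] [mfu _] [uoo _] _ _].
  - exact: uoo.
  - exact: mf0.
  - exact: mfu.
have sbe : \sum_(P <- X) be P <= K.+1%:R * maximal_const (ps / s) * ng.
  have := @sparse_maximal_inequality _ _ _ mu spaceM _ D X Q F
    (fun P => (m P).1.1.2) v gs (ps / s) t2 uX mF tF FQ mv mgs v0 gs0.
  rewrite gsE -EFinM => h; rewrite -lee_fin -sumEFin.
  rewrite [leLHS](_ : _ = \sum_(P <- X) ((m P).1.1.2 `^ (ps / s))%:E *
      \int[mu]_(x in F P) (v x)%:E)%E; last first.
    rewrite big_seq [RHS]big_seq; apply: eq_bigr => P /hm; rewrite /be.
    by case: (m P) => [[[mf' mg'] UE] VE] [_ _ _ [_ ->] _]; rewrite EFinM.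
  apply: h => P /hm; case: (m P) => [[[mf' mg'] UE] VE] [[_ mg0 _ _] [_ mgv] [_ voo] _ _].
  - exact: voo.
  - exact: mg0.
  - exact: mgv.
set c := k `^ (2 / a) * k `^ s^-1 * (2 * k) `^ _.
have nf0 : 0 <= nf.
  by rewrite -lee_fin -faE integral_ge0// => x _; rewrite lee_fin mulr_ge0 ?powR_ge0.
have ng0 : 0 <= ng.
  by rewrite -lee_fin -gsE integral_ge0// => x _; rewrite lee_fin mulr_ge0 ?powR_ge0.
have c1 : 0 <= K.+1%:R * maximal_const (p / a).
  by apply: mulr_ge0 => //; exact: ltW (maximal_const_gt0 t1).
have c2 : 0 <= K.+1%:R * maximal_const (ps / s).
  by apply: mulr_ge0 => //; exact: ltW (maximal_const_gt0 t2).
apply: (@le_trans _ _ (\sum_(P <- X)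
    (c * W `^ G * (al P `^ (2 / p) * be P `^ (1 - 2 / p)))%:E)%E).
  rewrite big_seq [leRHS]big_seq; apply: lee_sum => P /hm; rewrite /al /be.
  by case: (m P) => [[[mf' mg'] UE] VE] [_ _ _ _ h]; exact: h.
rewrite sumEFin lee_fin -mulr_sumr.
have p201 : 0 < 2 / p < 1 by rewrite p20 p21.
have hh := sum_hoelder p201 al0 be0.
have c0 : 0 <= c * W `^ G by rewrite !mulr_ge0 ?powR_ge0.
apply: (le_trans (ler_wpM2l c0 hh)).
have sal0 : 0 <= \sum_(P <- X) al P by rewrite big_seq sumr_ge0.
have sbe0 : 0 <= \sum_(P <- X) be P by rewrite big_seq sumr_ge0.
have h1 : (\sum_(P <- X) al P) `^ (2 / p) <=
    (K.+1%:R * maximal_const (p / a)) `^ (2 / p) * nf `^ (2 / p).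
  rewrite -(powRM _ c1 nf0); apply: ge0_ler_powR sal; rewrite ?nnegrE ?(ltW p20)//.
  exact: mulr_ge0.
have h2 : (\sum_(P <- X) be P) `^ (1 - 2 / p) <=
    (K.+1%:R * maximal_const (ps / s)) `^ (1 - 2 / p) * ng `^ (1 - 2 / p).
  rewrite -(powRM _ c2 ng0); apply: ge0_ler_powR sbe; rewrite ?nnegrE ?subr_ge0 ?(ltW p21)//.
  exact: mulr_ge0.
have h12 := ler_pM (powR_ge0 _ _) (powR_ge0 _ _) h1 h2.
have := ler_wpM2l c0 h12; move/le_trans; apply.
rewrite le_eqVlt; apply/orP; left; apply/eqP.
move: (_ `^ G) (_ `^ (2 / p)) (nf `^ _) (_ `^ (1 - 2 / p)) (ng `^ _) => ? ? ? ? ?.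
ring.
Qed.

End upper_bound_theorem.

(** * Arbitrary sparse families and degenerate norms *)

Section sparse_upper_bound.
Context {d : measure_display} {R : realType} {M : measurableMetricType d R}.
Variable mu : {measure set M -> \bar R}.
Context (spaceM : doubling_metric_measure_space mu).
Context {K : nat} (D : 'I_K -> dyadic_system mu) (coverD : covers_balls D).

Lemma two_gamma_ge (p0 p z : R) (q0 : \bar R) : p0 < p ->
  star q0 = (1 - 2 * z)^-1 -> hconj (q0 / p%:E) = (1 - p * z)^-1 ->
  2 / (p - p0) <= 2 * gamma p0 q0 p /\
  (1 - 2 * z) / (1 - p * z) <= 2 * gamma p0 q0 p.
Proof.
move=> pp sq hq; rewrite /gamma hq sq; split.
  by rewrite ler_pM2l// le_max lexx.
apply: (@le_trans _ _ (2 * ((1 - p * z)^-1 / (2 * (1 - 2 * z)^-1)))).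
  rewrite invfM invrK; set y := (1 - p * z)^-1.
  by rewrite le_eqVlt; apply/orP; left; apply/eqP; field.
by rewrite ler_pM2l// le_max lexx orbT.
Qed.

Lemma sparse_estimate_upper (p0 p : R) (q0 : \bar R) :
  1 <= p0 -> p0 < 2 -> 2 < p -> (p%:E < q0)%E ->
  exists2 C0 : R, 0 < C0 & sparse_estimate D p0 q0 p (2 * gamma p0 q0 p) C0.
Proof.
move=> a1 a2 p2 pq.
have [z [z0 pz sq hq]] := exponent_reciprocal p2 pq.
have ap : p0 < p by lra.
have [G1 G2] := two_gamma_ge ap sq hq.
set G := 2 * gamma p0 q0 p in G1 G2 *.
pose ps := p / (p - 2).
have psE : star p%:E = ps by rewrite star_EFin.
have a0 : 0 < p0 by lra.
have p_gt0 : 0 < p by lra.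
have pz0 : 0 <= (p - 2) * z by rewrite mulr_ge0// subr_ge0 ltW.
have z2 : 0 < 1 - 2 * z by lra.
have z3 : 0 < 1 - p * z by lra.
have p3 : 0 < p - 2 by lra.
have t1 : 1 < p / p0 by rewrite ltr_pdivlMr//; lra.
have s0 : 0 < (1 - 2 * z)^-1 by rewrite invr_gt0.
have t2 : 1 < ps / (1 - 2 * z)^-1.
  by rewrite /ps invrK mulrAC ltr_pdivlMr// mul1r; lra.
have r1 : 1 <= (1 - p * z)^-1.
  have pz1 : 0 <= p * z by rewrite mulr_ge0// ltW.
  by rewrite -[leLHS]invr1 lef_pV2 ?posrE//; lra.
have ps0 : 0 < ps by rewrite divr_gt0.
have [k k1 hQ] := dilate_in_cube spaceM coverD.
have /choice[Q {}hQ] := hQ.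
have k0 : 0 < k by lra.
set C0 := k `^ (2 / p0) * k `^ (1 - 2 * z)^-1^-1 *
  (2 * k) `^ ((G - 2 / p) * (p / p0 - p * z)) *
  (K.+1%:R * maximal_const (p / p0)) `^ (2 / p) *
  (K.+1%:R * maximal_const (ps / (1 - 2 * z)^-1)) `^ (1 - 2 / p).
have C00 : 0 < C0.
  have c1 := mulr_gt0 (ltr0Sn R K) (maximal_const_gt0 t1).
  have c2 := mulr_gt0 (ltr0Sn R K) (maximal_const_gt0 t2).
  have k2 : 0 < 2 * k by rewrite mulr_gt0.
  by rewrite !mulr_gt0// powR_gt0.
exists C0 => //.
rewrite /sparse_estimate hq sq psE.
move=> S [F [tF mF FP PF]] f g [mf _] [mg _] w hw Aoo Boo /=.
have [w0 [mw _]] := hw.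
set A := Ap_const _ _ _ in Aoo *; set B := RH_const _ _ _ in Boo *.
rewrite /weighted_norm; set Nf := (\int[mu]_x _)%E; set Ng := (\int[mu]_x _)%E.
have Nf0 : (0 <= Nf)%E.
  by apply: integral_ge0 => x _; rewrite lee_fin mulr_ge0 ?powR_ge0// ltW.
have Ng0 : (0 <= Ng)%E.
  by apply: integral_ge0 => x _; rewrite lee_fin mulr_ge0 ?powR_ge0.
have rhs0 : (0 <= C0%:E * (A * B) `^ G * (Nf `^ p^-1) ^+ 2 * Ng `^ ps^-1)%E.
  have C0' : (0 <= C0%:E)%E by rewrite lee_fin ltW.
  by rewrite !mule_ge0 ?poweR_ge0.
(* The sum over [S] is a supremum over finite subfamilies, so a bound uniform in these is enough. *)
apply: ge_ereal_sup => _ [X [finX XS] <-].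
rewrite fsbig_finite//=.
have inX P : P \in finmap.enum_fset (fset_set X) -> X P.
  by move=> PX; apply: set_mem; rewrite -in_fset_set.
have uX : uniq (finmap.enum_fset (fset_set X)) by exact: finmap.fset_uniq.
move: (finmap.enum_fset (fset_set X)) uX inX => s us inX.
(* Some cube is needed to know that the characteristic is positive and finite. *)
have [s_nil|[P0 P0s]] : s = [::] \/ exists P, P \in s.
  by case: (s) => [|P s']; [left|right; exists P; rewrite inE eqxx].
  by rewrite s_nil big_nil.
have [W [q [U [V [[W0 _ _ _] AB _ _]]]]] := weight_averages spaceM P0 r1 t1 hw Aoo Boo.
pose fa x := `|f x| `^ p0; pose gs x := `|g x| `^ (1 - 2 * z)^-1.
have mfa : measurable_fun [set: M] fa.
  by apply: (measurableT_comp (measurable_powR _)); exact: measurableT_comp.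
have mgs : measurable_fun [set: M] gs.
  by apply: (measurableT_comp (measurable_powR _)); exact: measurableT_comp.
have mu_ : measurable_fun [set: M] (fun x => w x `^ (1 - hconj (p / p0)%:E)).
  exact: (measurableT_comp (measurable_powR _)).
have mv : measurable_fun [set: M] (fun x => w x `^ (1 - p * z)^-1).
  exact: (measurableT_comp (measurable_powR _)).
(* Vanishing norms come before infinite ones: since [0 * +oo = 0], the right side is 0 even if the
   other norm is infinite, and every term has to be shown to vanish. *)
have [Nf_eq0|Nf_neq0] := eqVneq Nf 0%E.
  rewrite big1// => P _.
  rewrite (_ : avg mu (dilate 5 P) _ = 0%E) ?poweR0r ?mul0e//.
    by rewrite gt_eqF// divr_gt0.
  rewrite /avg; apply/eqP; rewrite mule_eq0; apply/orP; right; apply/eqP.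
  apply: (integral_eq0_of_power (lt_trans ltr01 t1) (dilate_measurable spaceM P) mu_ mfa).
  - by move=> x; exact: powR_gt0.
  - by move=> x; exact: powR_ge0.
  rewrite -Nf_eq0; apply: eq_integral => x _; congr (_%:E).
  exact: (dual_power_f a1 a2 p2 (w0 x) (normr_ge0 _)).
have [Ng_eq0|Ng_neq0] := eqVneq Ng 0%E.
  rewrite big1// => P _.
  rewrite (_ : avg mu (dilate 5 P) (fun x => `|g x| `^ _) = 0%E).
    by rewrite poweR0r ?mule0 ?mul0e// invrK gt_eqF.
  rewrite /avg; apply/eqP; rewrite mule_eq0; apply/orP; right; apply/eqP.
  apply: (integral_eq0_of_power (lt_trans ltr01 t2) (dilate_measurable spaceM P) mv mgs).
  - by move=> x; exact: powR_gt0.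
  - by move=> x; exact: powR_ge0.
  rewrite -Ng_eq0; apply: eq_integral => x _; congr (_%:E).
  exact: (dual_power_g p2 z0 pz (w0 x) (normr_ge0 _)).
have Nf_gt0 : (0 < Nf)%E by rewrite lt0e Nf_neq0 Nf0.
have Ng_gt0 : (0 < Ng)%E by rewrite lt0e Ng_neq0 Ng0.
have CW0 : (0 < C0%:E * W%:E `^ G)%E.
  by rewrite mule_gt0 ?poweR_gt0 ?lte_fin.
have pi0 : p^-1 != 0 by rewrite invr_neq0// gt_eqF.
have psi0 : ps^-1 != 0 by rewrite invr_neq0// gt_eqF.
rewrite AB.
(* All other factors being positive, an infinite norm makes the right side [+oo]. *)
have [Nf_fin|] := boolP (Nf < +oo)%E; last first.
  rewrite -leNgt leye_eq => /eqP ->.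
  rewrite poweRyr// mulyy gt0_muley// gt0_mulye ?leey//.
  exact: poweR_gt0.
have [Ng_fin|] := boolP (Ng < +oo)%E; last first.
  rewrite -leNgt leye_eq => /eqP ->.
  rewrite poweRyr// gt0_muley ?leey// mule_gt0// mule_gt0//.
    exact: poweR_gt0.
  exact: poweR_gt0.
have [nf nf0 nfE] := ge0_lty_EFin Nf0 Nf_fin.
have [ng ng0 ngE] := ge0_lty_EFin Ng0 Ng_fin.
have SP P : P \in s -> S P by move=> Ps; exact: (XS _ (inX _ Ps)).
(* The sparse parts are known to be measurable only on [S]; the empty set elsewhere makes them
   measurable for every cube. *)
pose F' P := if P \in s then F P else set0.
have mF' P : measurable (F' P).
  by rewrite /F'; case: ifPn => // Ps; apply: mF; exact: SP.
have tF' : trivIset [set` s] F'.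
  move=> P P' /= Ps P's; rewrite /F' Ps P's.
  by apply: tF; exact: SP.
have F'P P : P \in s -> F' P `<=` cube_set P.
  by move=> Ps; rewrite /F' Ps; apply: FP; exact: SP.
have PF' P : P \in s -> ((2^-1)%:E * mu (cube_set P) < mu (F' P))%E.
  by move=> Ps; rewrite /F' Ps; apply: PF; exact: SP.
apply: (le_trans (finite_sparse_sum_le spaceM a1 a2 p2 z0 pz G1 G2
  k1 us hQ mF' tF' F'P PF' hw Aoo Boo AB mf mg nfE ngE)).
rewrite nfE ngE [leRHS](_ : _ =
  (C0 * W `^ G * (nf `^ p^-1 * nf `^ p^-1) * ng `^ ps^-1)%:E)//.
rewrite lee_fin.
have -> : nf `^ p^-1 * nf `^ p^-1 = nf `^ (2 / p).
  by rewrite -expr2 -powR_mulrn ?powR_ge0// -powRrM; congr (_ `^ _); rewrite mulrC.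
have -> : ps^-1 = 1 - 2 / p.
  by rewrite /ps invf_div mulrBl divff ?gt_eqF.
by rewrite -[leRHS]mulrA; exact: lexx.
Qed.

End sparse_upper_bound.

(** * Sharpness on the real line *)

Section real_line.
Context {R : realType}.
Notation T := (measurableTypeR R).
Notation mu := (@lebesgue_measure R).

Lemma real_ball_measure (x : T) (r : R) : 0 <= r -> mu (ball x r) = (2 * r)%:E.
Proof.
by move=> r0; rewrite mulr_natl; exact: (lebesgue_measure_ball (x : R) r0).
Qed.

Lemma real_line_space :
  doubling_metric_measure_space (mu : {measure set T -> \bar R}).
Proof.
split; first exact: locally_compactR.
split.
  exists (@ratr R @` setT); last exact: dense_rat.
  by apply: (@sub_countable _ _ _ [set: rat]); [exact: card_image_le|exact: countableP].
split.
  apply/seteqP; split=> [A|]; last first.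
    apply: smallest_sub; first exact: sigma_algebra_measurable.
    by move=> U; exact: open_measurable.
  change (measurable A) with ((@ocitv R).-sigma.-measurable A).
  rewrite RGenOpens.measurableE; apply: smallest_sub.
    exact: smallest_sigma_algebra.
  by move=> _ [x [y ->]]; apply: sub_sigma_algebra; exact: interval_open.
split; first exact: compact_finite_measure.
split.
  move=> U oU [x Ux]; have /nbhs_ballP[e /= e0 eU] : nbhs (x : T) U by exact: open_nbhs_nbhs.
  apply: (@lt_le_trans _ _ (mu (ball (x : T) e))).
    by rewrite real_ball_measure ?(ltW e0)// lte_fin mulr_gt0.
  by apply: le_measure; rewrite ?inE//; [exact: measurable_ball|exact: open_measurable].
split.
  exists 2 => x r r0.
  have h1 : mu (@ball _ T x (2 * r)) = (2 * (2 * r))%:E.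
    by apply: real_ball_measure; rewrite mulr_ge0 ?ltW.
  have h2 := real_ball_measure x (ltW r0).
  by rewrite [leLHS]h1 [X in (_ <= _ * X)%E]h2 -EFinM.
exists id; split=> //; exists 1, 1; split=> // x r s r0 s0.
have h1 := real_ball_measure x (ltW r0); have h2 := real_ball_measure x (ltW s0).
rewrite [X in (_ * X <= _)%E]h2 [X in (_ <= X)%E /\ _]h1.
rewrite [X in _ /\ (X <= _)%E]h1 [X in _ /\ (_ <= _ * X)%E]h2.
rewrite -!EFinM !lee_fin !mul1r.
have -> : r / s * (2 * s) = 2 * r by field; rewrite gt_eqF.
by rewrite lexx.
Qed.

Lemma FTC_positive (F f : R -> R) (a b : R) : 0 < a -> a < b ->
  (forall x : R, 0 < x -> is_derive x 1 F (f x)) ->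
  (forall x : R, 0 < x -> {for x, continuous f}) ->
  (\int[mu]_(x in `[a, b]) (f x)%:E = (F b - F a)%:E)%E.
Proof.
move=> a0 ab dF cf; have b0 : 0 < b by exact: lt_trans ab.
have cF x : 0 < x -> {for x, continuous F}.
  move=> x0; apply: differentiable_continuous; apply/derivable1_diffP.
  by have [] := dF x x0.
rewrite (@continuous_FTC2 _ f F)//.
- apply: continuous_in_subspaceT => x; rewrite inE/= in_itv/= => /andP[ax _].
  by apply: cf; exact: lt_le_trans ax.
- split.
  + move=> x; rewrite in_itv/= => /andP[ax _].
    by have [] := dF x (lt_trans a0 ax).
  + by apply: cvg_at_right_filter; exact: cF.
  + by apply: cvg_at_left_filter; exact: cF.
- move=> x; rewrite in_itv/= => /andP[ax _].
  by rewrite derive1E; have [_ ->] := dF x (lt_trans a0 ax).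
Qed.

Lemma continuous_powR_pos (e x : R) : 0 < x ->
  {for x, continuous (fun y : R => y `^ e)}.
Proof.
move=> x0; apply: differentiable_continuous; apply/derivable1_diffP.
by apply: derivable_powR; rewrite in_itv/= x0.
Qed.

Lemma integral_inv_itv (a b : R) : 0 < a -> a < b ->
  (\int[mu]_(x in `[a, b]) (x `^ (-1))%:E = (ln b - ln a)%:E)%E.
Proof.
move=> a0 ab; apply: FTC_positive => // x x0; last exact: continuous_powR_pos.
by rewrite powR_inv1 ?(ltW x0)//; exact: is_derive1_ln.
Qed.

Lemma integral_powR_itv (a b e : R) : 0 < a -> a < b -> 0 < e ->
  (\int[mu]_(x in `[a, b]) (x `^ (e - 1))%:E = ((b `^ e - a `^ e) / e)%:E)%E.
Proof.
move=> a0 ab e0.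
have dF (x : R) : 0 < x ->
    is_derive x 1 (fun y : R => e^-1 * y `^ e) (x `^ (e - 1)).
  move=> x0; have d := @is_derive1_powR R e x x0.
  have -> : x `^ (e - 1) = e^-1 *: (e * x `^ (e - 1)).
    by rewrite /GRing.scale/= mulrA mulVf ?gt_eqF ?mul1r.
  exact: is_deriveZ.
have cf (x : R) : 0 < x -> {for x, continuous (fun y : R => y `^ (e - 1))}.
  exact: continuous_powR_pos.
by rewrite (FTC_positive a0 ab dF cf) -mulrBr mulrC.
Qed.

End real_line.

(** * The truncated distance to the origin *)

Section truncated_distance.
Context {R : realType}.
Notation T := (measurableTypeR R).
Notation mu := (@lebesgue_measure R).
Implicit Types x y z t rho e : R.

Lemma powR_comparable (b y e : R) : 0 < b -> b / 2 <= y -> y <= 2 * b ->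
  2 `^ (- `|e|) * b `^ e <= y `^ e <= 2 `^ `|e| * b `^ e.
Proof.
move=> b0 by1 yb; have y0 : 0 < y by apply: lt_le_trans by1; rewrite divr_gt0.
have l1 : ln b - ln 2 <= ln y.
  by rewrite -ln_div ?posrE// ler_ln ?posrE// divr_gt0.
have l2 : ln y <= ln 2 + ln b.
  by rewrite -lnM ?posrE// ler_ln ?posrE// mulr_gt0.
rewrite !powR_expR// -!expRD !ler_expR.
have : `|e * (ln y - ln b)| <= `|e| * ln 2.
  rewrite normrM ler_wpM2l// ler_norml; lra.
rewrite ler_norml => /andP[]; lra.
Qed.

(** The lower truncation bounds every power, so that weights and test functions are locally
    integrable; the upper one makes the weight equal to 1 away from the unit ball, whence large
    cubes do no harm. *)
Definition trunc t x := Num.min (Num.max `|x| t) 1.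

Lemma trunc_le1 t x : trunc t x <= 1.
Proof. by rewrite ge_min lexx orbT. Qed.

Lemma trunc_ge t x : t <= 1 -> t <= trunc t x.
Proof. by move=> t1; rewrite le_min t1 le_max lexx orbT. Qed.

Lemma trunc_gt0 t x : 0 < t -> 0 < trunc t x.
Proof. by move=> t0; rewrite lt_min ltr01 lt_max t0 orbT. Qed.

Lemma trunc_ge_norm t x : Num.min `|x| 1 <= trunc t x.
Proof. by rewrite le_min !ge_min lexx le_max lexx/= orbT. Qed.

Lemma trunc_le_norm t x rho : t <= rho -> `|x| <= rho -> trunc t x <= rho.
Proof. by move=> t1 xr; rewrite ge_min ge_max xr t1. Qed.

Lemma trunc_lipschitz t x y : trunc t x <= trunc t y + `|x - y|.
Proof.
rewrite -lerBlDr le_min !lerBlDr; apply/andP; split; last first.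
  by rewrite (le_trans (trunc_le1 _ _))// lerDl.
rewrite ge_min ge_max; apply/orP; left; apply/andP; split; last first.
  by rewrite ler_wpDr// le_max lexx orbT.
apply: (@le_trans _ _ (`|y| + `|x - y|)); last by rewrite lerD2r le_max lexx.
by rewrite addrC -{1}(subrK y x) ler_normD.
Qed.

Lemma measurable_trunc t : measurable_fun [set: R] (trunc t).
Proof. by apply: measurable_minr => //; apply: measurable_maxr. Qed.

Lemma measurable_trunc_pow t e :
  measurable_fun [set: T] (fun x => trunc t x `^ e).
Proof. exact: (measurableT_comp (measurable_powR e) (measurable_trunc t)). Qed.

Lemma integral_setU_le (A B : set T) (f : T -> R) :
  measurable A -> measurable B -> measurable_fun [set: T] f ->
  (forall x, 0 <= f x) ->
  (\int[mu]_(x in A `|` B) (f x)%:E <=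
   \int[mu]_(x in A) (f x)%:E + \int[mu]_(x in B) (f x)%:E)%E.
Proof.
move=> mA mB mf f0.
have mfE D : measurable_fun D (EFin \o f) by exact/measurable_funTS/measurable_EFinP.
have f0E D x : D x -> (0 <= (f x)%:E)%E by rewrite lee_fin.
rewrite -[A `|` B](@setDUK _ A); last by move=> x; left.
have mBA : measurable ((A `|` B) `\` A) by apply: measurableD => //; exact: measurableU.
have dAB : [disjoint A & (A `|` B) `\` A].
  by apply/disj_setPS => x [Ax [_ /(_ Ax)]].
have -> := ge0_integral_setU mu mA mBA (mfE _) (f0E _) dAB.
apply: leeD => //; apply: (ge0_subset_integral mu mBA mB (mfE _) (f0E _)).
by move=> x [[]].
Qed.

(** On [-t, t] the truncated distance is [t], which yields the first summand; the two remaining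
    intervals are mirror images on which it is |x|. The bound [I] is asked only for [t < rho], since
    otherwise these intervals are points. *)
Lemma trunc_integral_le (t rho e I : R) : 0 < t -> t <= rho -> rho <= 1 ->
  0 <= I ->
  ((t < rho)%R -> \int[mu]_(x in `[t, rho]) (x `^ e)%:E <= I%:E)%E ->
  (\int[mu]_(x in ball (0%R : T) rho) (trunc t x `^ e)%:E <=
    (2 * t `^ (1 + e) + 2 * I)%:E)%E.
Proof.
move=> t0 t_rho rho1 I0 hI.
pose f x := trunc t x `^ e.
have t1 := le_trans t_rho rho1.
have mf : measurable_fun [set: T] f := measurable_trunc_pow t e.
have f0 x : 0 <= f x by exact: powR_ge0.
have mfE D : measurable_fun D (EFin \o f) by exact/measurable_funTS/measurable_EFinP.
have f0E D (x : T) : D x -> (0 <= (f x)%:E)%E by rewrite lee_fin.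
have c1 : (\int[mu]_(x in `[(- t)%R, t]) (f x)%:E = (2 * t `^ (1 + e))%:E)%E.
  rewrite (eq_integral (fun=> (t `^ e)%:E)); last first.
    move=> x; rewrite inE/= in_itv/= -ler_norml => xt; congr (_ `^ _)%:E.
    by rewrite /trunc (max_r xt) min_l.
  rewrite integral_cst//= lebesgue_measure_itv/= lte_fin gtrN// -EFinD -EFinM.
  have -> : t `^ (1 + e) = t * t `^ e.
    by rewrite powRD ?powRr1 ?(ltW t0)// (gt_eqF t0) implybT.
  by congr (_%:E); ring.
have c2 : (\int[mu]_(x in `[t, rho]) (f x)%:E <= I%:E)%E.
  have [lt_rho|rho_le] := ltP t rho; last first.
    have -> : rho = t by apply/eqP; rewrite eq_le rho_le.
    by rewrite set_itv1 integral_set1 lee_fin.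
  apply: le_trans (hI lt_rho); rewrite le_eqVlt; apply/orP; left; apply/eqP.
  apply: eq_integral => x; rewrite inE/= in_itv/= => /andP[tx xr]; congr (_ `^ _)%:E.
  rewrite /trunc ger0_norm ?(le_trans (ltW t0))// (max_l tx) min_l//.
  exact: le_trans xr _.
have c3 : (\int[mu]_(x in `[(- rho)%R, (- t)%R]) (f x)%:E <= I%:E)%E.
  have [lt_rho|rho_le] := ltP t rho; last first.
    have -> : rho = t by apply/eqP; rewrite eq_le rho_le.
    by rewrite set_itv1 integral_set1 lee_fin.
  apply: le_trans (hI lt_rho); rewrite le_eqVlt; apply/orP; left; apply/eqP.
  pose G (x : R) := (- x) `^ e.
  have -> : (\int[mu]_(x in `[(- rho)%R, (- t)%R]) (f x)%:E =
      \int[mu]_(x in `[(- rho)%R, (- t)%R]) (G x)%:E)%E.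
    apply: eq_integral => x; rewrite inE/= in_itv/= => /andP[rx xt]; congr (_ `^ _)%:E.
    have tx : t <= - x by rewrite lerNr.
    have xr : - x <= rho by rewrite lerNl.
    rewrite /trunc -normrN ger0_norm ?(le_trans (ltW t0))// (max_l tx) min_l//.
    exact: le_trans xr _.
  rewrite integration_by_substitution_oppr; [|exact: ltW|].
    by apply: eq_integral => x _; rewrite /G/= opprK.
  apply: continuous_in_subspaceT => x; rewrite inE/= in_itv/= => /andP[_ xt].
  have x0 : 0 < - x by rewrite (lt_le_trans t0)// lerNr.
  apply: (@continuous_comp _ _ _ (fun x : R => - x) (fun y : R => y `^ e)).
    exact: opp_continuous.
  by apply: continuous_powR_pos; exact: x0.
apply: (@le_trans _ _
    (\int[mu]_(x in `[(- t)%R, t] `|` (`[t, rho] `|` `[(- rho)%R, (- t)%R])) (f x)%:E)%E).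
  have mU : measurable (`[(- t)%R, t] `|` (`[t, rho] `|` `[(- rho)%R, (- t)%R]) : set T).
    by apply: measurableU => //; apply: measurableU.
  apply: (ge0_subset_integral mu (measurable_ball _ _) mU (mfE _) (f0E _)).
  move=> x xb; have : `|0 - x| < rho := xb; rewrite sub0r normrN ltr_norml => /andP[rx xr].
  have [xt|tx] := leP `|x| t.
    by left; rewrite /= in_itv/= -ler_norml.
  right; move: tx; rewrite lter_normr => /orP[tx|tx]; [left|right].
    by rewrite /= in_itv/= (ltW tx) (ltW xr).
  by rewrite /= in_itv/= (ltW rx)/= lerNr ltW.
apply: (le_trans (integral_setU_le _ _ mf f0)) => //; first exact: measurableU.
have -> : (2 * t `^ (1 + e) + 2 * I)%:E = ((2 * t `^ (1 + e))%:E + (I%:E + I%:E))%E.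
  by rewrite -!EFinD; congr (_%:E); ring.
rewrite c1 leeD2l//.
by apply: (le_trans (integral_setU_le _ _ mf f0)) => //; exact: leeD.
Qed.

End truncated_distance.

(** * Integrals of its powers over balls around the origin *)

Section truncated_integrals.
Context {R : realType}.
Notation T := (measurableTypeR R).
Notation mu := (@lebesgue_measure R).
Implicit Types x y t rho e : R.

Lemma trunc_integral_inv t : 0 < t -> t <= 1 ->
  (\int[mu]_(x in ball (0%R : T) 1%R) (trunc t x `^ (-1))%:E <=
    (2 + 2 * - ln t)%:E)%E.
Proof.
move=> t0 t1; have l0 : 0 <= - ln t by rewrite oppr_ge0 ln_le0.
have := @trunc_integral_le R t 1 (-1) (- ln t) t0 t1 (lexx _) l0.
rewrite subrr powRr0 mulr1; apply => lt1.
by rewrite integral_inv_itv// ln1 sub0r.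
Qed.

Lemma trunc_integral_pow t rho (th : R) : 0 < th < 1 -> 0 < t -> t <= rho -> rho <= 1 ->
  (\int[mu]_(x in ball (0%R : T) rho) (trunc t x `^ (- th))%:E <=
    (2 * (1 + (1 - th)^-1) * rho `^ (1 - th))%:E)%E.
Proof.
move=> /andP[th0 th1] t0 tr r1; have e0 : 0 < 1 - th by rewrite subr_gt0.
have rho0 := lt_le_trans t0 tr.
have I0 : 0 <= rho `^ (1 - th) / (1 - th) by rewrite divr_ge0 ?powR_ge0 ?ltW.
have hI : t < rho -> (\int[mu]_(x in `[t, rho]) (x `^ (- th))%:E <=
    (rho `^ (1 - th) / (1 - th))%:E)%E.
  move=> tr'; have := integral_powR_itv t0 tr' e0.
  have -> : 1 - th - 1 = - th by ring.
  move=> ->; rewrite lee_fin ler_pM2r ?invr_gt0// gerBl powR_ge0//.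
apply: (le_trans (trunc_integral_le t0 tr r1 I0 hI)); rewrite lee_fin.
have h : t `^ (1 - th) <= rho `^ (1 - th).
  by apply: ge0_ler_powR; rewrite ?nnegrE ?(ltW e0) ?(ltW t0) ?(ltW rho0).
move: h; set y := t `^ _; set w := rho `^ _ => h.
rewrite -mulrA -mulrDr ler_pM2l// mulrDl mul1r (mulrC _^-1) lerD2r//.
Qed.

Lemma trunc_integral_inv_ge t rho : 0 < t -> t <= rho -> rho <= 1 ->
  ((ln rho - ln t)%:E <=
    \int[mu]_(x in ball (0%R : T) rho) (trunc t x `^ (-1))%:E)%E.
Proof.
move=> t0; rewrite le_eqVlt => /predU1P[<- _|tr r1].
  by rewrite subrr integral_ge0// => x _; rewrite lee_fin powR_ge0.
have mf := measurable_trunc_pow t (-1).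
have mfE D : measurable_fun D (fun x : T => (trunc t x `^ (-1))%:E).
  by apply/measurable_funTS/measurable_EFinP.
rewrite -(integral_inv_itv t0 tr) -integral_itv_bndo_bndc; last first.
  by apply/measurable_funTS/measurable_EFinP; exact: measurable_powR.
apply: (@le_trans _ _ (\int[mu]_(x in `[t, rho[) (trunc t x `^ (-1))%:E)%E).
  rewrite le_eqVlt; apply/orP; left; apply/eqP; apply: eq_integral => x.
  rewrite inE/= in_itv/= => /andP[tx xr]; congr (_ `^ _)%:E.
  rewrite /trunc ger0_norm ?(le_trans (ltW t0))// (max_l tx) min_l//.
  exact: le_trans (ltW xr) _.
apply: (ge0_subset_integral mu _ (measurable_ball _ _) (mfE _)) => //.
  by move=> x _; rewrite lee_fin powR_ge0.
move=> x; rewrite /= in_itv/= => /andP[tx xr].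
suff : `|0 - x| < rho by [].
by rewrite sub0r normrN ger0_norm ?(le_trans (ltW t0)).
Qed.

(** Only the points between [rho / 2] and [rho] are kept: there the truncated distance is comparable
    to [rho] whatever [t] is, and so is its power for either sign of [e]. *)
Lemma trunc_integral_ge t rho e : 0 < t -> t <= rho -> rho <= 1 ->
  ((2 `^ (- `|e|) / 2 * rho `^ e * rho)%:E <=
    \int[mu]_(x in ball (0%R : T) rho) (trunc t x `^ e)%:E)%E.
Proof.
move=> t0 tr r1; have rho0 := lt_le_trans t0 tr.
have mf := measurable_trunc_pow t e.
have mfE D : measurable_fun D (fun x : T => (trunc t x `^ e)%:E).
  by apply/measurable_funTS/measurable_EFinP.
apply: (@le_trans _ _ (\int[mu]_(x in `](rho / 2)%R, rho[) (trunc t x `^ e)%:E)%E);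
    last first.
  apply: (ge0_subset_integral mu _ (measurable_ball _ _) (mfE _)) => //.
    by move=> x _; rewrite lee_fin powR_ge0.
  move=> x; rewrite /= in_itv/= => /andP[tx xr].
  suff : `|0 - x| < rho by [].
  by rewrite sub0r normrN ger0_norm//; lra.
apply: (@le_trans _ _ (\int[mu]_(x in `](rho / 2)%R, rho[) (2 `^ (- `|e|) * rho `^ e)%:E)%E).
  rewrite integral_cst//= lebesgue_measure_itv/= lte_fin ltr_pdivrMr// ltr_pMr// ltr1n.
  by rewrite -EFinD -EFinM lee_fin le_eqVlt; apply/orP; left; apply/eqP; field.
apply: ge0_le_integral => //.
- by move=> x _; rewrite lee_fin mulr_ge0 ?powR_ge0.
move=> x; rewrite /= in_itv/= => /andP[xl xr]; rewrite lee_fin.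
have x0 : 0 <= x by lra.
have [] := andP (@powR_comparable R rho (trunc t x) e rho0 _ _) => //.
- apply: le_trans (trunc_ge_norm t x); rewrite le_min ger0_norm//; apply/andP; split; lra.
- apply: (@le_trans _ _ rho); last lra.
  by apply: trunc_le_norm => //; rewrite ger0_norm// ltW.
Qed.

End truncated_integrals.

(** * Averages of its powers over sets squeezed between two balls *)

Section truncated_averages.
Context {R : realType}.
Notation T := (measurableTypeR R).
Notation mu := (@lebesgue_measure R : {measure set T -> \bar R}).
Context (Q : set T) (z rho kap t : R).
Context (mQ : measurable Q) (rho0 : 0 < rho) (kap1 : 1 <= kap)
  (Qz : Q `<=` ball (z : T) rho) (zQ : ball (z : T) (rho / kap) `<=` Q)
  (t0 : 0 < t) (t1 : t <= 1).
Implicit Types (x y e : R).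

Lemma round_set_measure : exists2 q, mu Q = q%:E & 2 * rho / kap <= q <= 2 * rho.
Proof.
have kap0 : 0 < kap := lt_le_trans ltr01 kap1.
have h1 : (mu Q <= (2 * rho)%:E)%E.
  rewrite -(real_ball_measure z (ltW rho0)); apply: le_measure => //; rewrite inE//.
  exact: measurable_ball.
have h2 : ((2 * rho / kap)%:E <= mu Q)%E.
  rewrite -mulrA -(@real_ball_measure _ z); last by rewrite divr_ge0 ?ltW.
  by apply: le_measure => //; rewrite inE//; exact: measurable_ball.
have [q q0 qE] := ge0_lty_EFin (measure_ge0 mu Q) (le_lt_trans h1 (ltry _)).
by exists q => //; rewrite qE !lee_fin in h1 h2; rewrite h1 h2.
Qed.

Lemma round_set_avg_le (h : T -> R) (C : R) : measurable_fun [set: T] h ->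
  (forall x, 0 <= h x) -> (forall x, Q x -> h x <= C) -> (avg mu Q h <= C%:E)%E.
Proof.
move=> mh h0 hC; have [q qE /andP[ql qr]] := round_set_measure.
have kap0 : 0 < kap := lt_le_trans ltr01 kap1.
have q0 : 0 < q by apply: lt_le_trans ql; rewrite !mulr_gt0// invr_gt0.
rewrite (avgE _ q0 qE) lee_pdivrMl// muleC.
rewrite (@le_trans _ _ (\int[mu]_(x in Q) C%:E)%E)//.
  apply: ge0_le_integral => //.
  - by move=> x _; rewrite lee_fin.
  - exact/measurable_funTS/measurable_EFinP.
by rewrite (integral_cst mu mQ) qE.
Qed.

Lemma round_set_avg_ge (h : T -> R) (C : R) : measurable_fun [set: T] h ->
  0 <= C -> (forall x, Q x -> C <= h x) -> (C%:E <= avg mu Q h)%E.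
Proof.
move=> mh C0 hC; have [q qE /andP[ql qr]] := round_set_measure.
have kap0 : 0 < kap := lt_le_trans ltr01 kap1.
have q0 : 0 < q by apply: lt_le_trans ql; rewrite !mulr_gt0// invr_gt0.
rewrite (avgE _ q0 qE) lee_pdivlMl// muleC.
rewrite (@le_trans _ _ (\int[mu]_(x in Q) C%:E)%E)//.
  by rewrite (integral_cst mu mQ) qE.
apply: ge0_le_integral => //.
- exact/measurable_funTS/measurable_EFinP.
Qed.

Lemma round_set_avg_int (h : T -> R) (I : R) : 0 <= I ->
  (\int[mu]_(x in Q) (h x)%:E <= I%:E)%E ->
  (avg mu Q h <= (kap / (2 * rho) * I)%:E)%E.
Proof.
move=> I0 hI; have [q qE /andP[ql qr]] := round_set_measure.
have kap0 : 0 < kap := lt_le_trans ltr01 kap1.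
have q0 : 0 < q by apply: lt_le_trans ql; rewrite !mulr_gt0// invr_gt0.
rewrite (avgE _ q0 qE) EFinM.
apply: (@le_trans _ _ (q^-1%:E * I%:E)%E).
  by rewrite lee_wpmul2l// lee_fin invr_ge0 ltW.
rewrite lee_wpmul2r ?lee_fin// -[leRHS]invrK invf_div lef_pV2 ?posrE//.
by rewrite divr_gt0// mulr_gt0.
Qed.

(** First of two regimes: the radius is small compared with the truncated distance at the centre,
    and by the Lipschitz bound the weight is essentially constant on [Q]. *)
Lemma trunc_oscillation : 2 * rho <= trunc t z ->
  forall x, Q x -> trunc t z / 2 <= trunc t x <= 2 * trunc t z.
Proof.
move=> hz x Qx; have zx : `|z - x| < rho := Qz Qx.
have := trunc_lipschitz t z x; have := trunc_lipschitz t x z.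
rewrite (distrC x z); have := rho0; lra.
Qed.

(** Second regime: the radius dominates, and [Num.min 1 (3 * rho)] takes over the role of the value
    at the centre. *)
Lemma trunc_small : trunc t z < 2 * rho ->
  forall x, Q x -> trunc t x <= Num.min 1 (3 * rho).
Proof.
move=> hz x Qx; have zx : `|z - x| < rho := Qz Qx.
rewrite le_min trunc_le1/=; have := trunc_lipschitz t x z.
rewrite (distrC x z); lra.
Qed.

Let b0 x : 0 < trunc t x := trunc_gt0 x t0.

Lemma trunc_avg_osc e : 2 * rho <= trunc t z ->
  ((2 `^ (- `|e|) * trunc t z `^ e)%:E <= avg mu Q (fun x => (trunc t x `^ e)%R))%E /\
  (avg mu Q (fun x => (trunc t x `^ e)%R) <= (2 `^ `|e| * trunc t z `^ e)%:E)%E.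
Proof.
move=> hz; have cmp x (Qx : Q x) := trunc_oscillation hz Qx.
split.
  apply: round_set_avg_ge; first exact: measurable_trunc_pow.
    by rewrite mulr_ge0 ?powR_ge0.
  move=> x /cmp/andP[c1 c2].
  by have /andP[] := powR_comparable e (b0 z) c1 c2.
apply: round_set_avg_le; first exact: measurable_trunc_pow.
  by move=> x; exact: powR_ge0.
move=> x /cmp/andP[c1 c2].
by have /andP[] := powR_comparable e (b0 z) c1 c2.
Qed.

(** Off the unit ball the truncated distance is 1, so that part of [Q] contributes at most its
    measure. *)
Lemma trunc_integral_split e (I : R) :
  (\int[mu]_(x in ball (0%R : T) 1%R) (trunc t x `^ e)%:E <= I%:E)%E ->
  (\int[mu]_(x in Q) (trunc t x `^ e)%:E <= (2 * rho + I)%:E)%E.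
Proof.
move=> hI; have mf := measurable_trunc_pow t e.
have f0 x : 0 <= trunc t x `^ e by exact: powR_ge0.
have mfE (D : set T) : measurable_fun D (fun x : T => (trunc t x `^ e)%:E).
  by apply/measurable_funTS/measurable_EFinP.
have f0E (D : set T) x : D x -> (0 <= (trunc t x `^ e)%:E)%E by rewrite lee_fin.
have mB : measurable (ball (0%R : T) 1) := measurable_ball _ _.
have mQB : measurable (Q `\` ball (0%R : T) 1) by exact: measurableD.
have mQIB : measurable (Q `&` ball (0%R : T) 1) by exact: measurableI.
have -> : Q = (Q `\` ball (0%R : T) 1) `|` (Q `&` ball (0%R : T) 1).
  by rewrite setUC setUIDK.
apply: (le_trans (integral_setU_le mQB mQIB mf f0)).
rewrite EFinD; apply: leeD; last first.
  apply: le_trans hI.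
  exact: (ge0_subset_integral mu mQIB mB (mfE _) (f0E _) (@subIsetr _ _ _)).
apply: (@le_trans _ _ (\int[mu]_(x in Q `\` ball (0%R : T) 1) 1%:E)%E).
  apply: (ge0_le_integral mu mQB (f0E _) (mfE _)) => //.
  move=> x [_ xB]; rewrite lee_fin; have : ~ `|0 - x| < 1 by [].
  rewrite sub0r normrN => /negP; rewrite -leNgt => x1.
  by rewrite /trunc min_r ?powR1// le_max x1.
rewrite (integral_cst mu mQB) mul1e -(real_ball_measure z (ltW rho0)).
apply: le_measure; rewrite ?inE//; first exact: measurable_ball.
by move=> x [Qx _]; exact: Qz.
Qed.

(** The logarithm enters the characteristic here. Dividing [2 rho + 2 + 2 N] by [2 rho] gives
    [1 + (1 + N) / rho], and both cases of the minimum fit under [4 + 3 N]. *)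
Lemma trunc_avg_inv : trunc t z < 2 * rho ->
  (avg mu Q (fun x => (trunc t x `^ (-1))%R) <=
    (kap * (4 + 3 * - ln t) / Num.min 1 (3 * rho))%:E)%E.
Proof.
move=> hz; set N := - ln t; have N0 : 0 <= N by rewrite oppr_ge0 ln_le0.
have hI := trunc_integral_split (trunc_integral_inv t0 t1).
have r0 := rho0.
have I0 : 0 <= 2 * rho + (2 + 2 * N) by lra.
apply: (le_trans (round_set_avg_int I0 hI)); rewrite lee_fin -!mulrA.
have kap0 : 0 < kap := lt_le_trans ltr01 kap1.
rewrite ler_pM2l// mulrC ler_pdivrMr ?mulr_gt0// mulrAC.
have [h|h] := leP 1 (3 * rho); first by rewrite divr1; nra.
by rewrite ler_pdivlMr ?mulr_gt0//; nra.
Qed.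

(** For [th < 1] the power stays integrable at 0 uniformly in [t], so no logarithm appears. *)
Lemma trunc_avg_pow (th : R) : 0 < th < 1 -> trunc t z < 2 * rho ->
  (avg mu Q (fun x => (trunc t x `^ (- th))%R) <=
    (kap * (4 + 6 * (1 - th)^-1) * (Num.min 1 (3 * rho)) `^ (- th))%:E)%E.
Proof.
move=> th01 hz; have /andP[th0 th1] := th01; have r0 := rho0.
have kap0 : 0 < kap := lt_le_trans ltr01 kap1.
have d0 : 0 < (1 - th)^-1 by rewrite invr_gt0 subr_gt0.
have hpow r := @trunc_integral_pow R t r th th01 t0.
set d := (1 - th)^-1 in hpow d0 *.
have [h|h] := leP 1 (3 * rho).
  have := hpow 1 t1 (lexx _); rewrite powR1 !mulr1 => /trunc_integral_split hI.
  have I0 : 0 <= 2 * rho + 2 * (1 + d) by lra.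
  apply: (le_trans (round_set_avg_int I0 hI)); rewrite lee_fin -!mulrA.
  rewrite ler_pM2l// mulrC ler_pdivrMr ?mulr_gt0//; nra.
(* For small radii the second regime places the centre within [2 rho] of the origin, so [Q] lies in
   the ball of radius [3 rho] around 0, which also contains the truncation scale. *)
have t3 : t <= 3 * rho by have := trunc_ge z t1; lra.
have r3 : 3 * rho <= 1 by exact: ltW.
have Q3 : Q `<=` ball (0%R : T) (3 * rho).
  move=> x Qx; have zx : `|z - x| < rho := Qz Qx.
  suff : `|0 - x| < 3 * rho by [].
  have := trunc_ge_norm t z; have := ler_distD z x 0.
  rewrite sub0r normrN !subr0 (distrC x z).
  have [z1|z1] := leP `|z| 1; lra.
have hI : (\int[mu]_(x in Q) (trunc t x `^ (- th))%:E <=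
    (2 * (1 + d) * (3 * rho) `^ (1 - th))%:E)%E.
  have mfE (D : set T) : measurable_fun D (fun x : T => (trunc t x `^ (- th))%:E).
    by apply/measurable_funTS/measurable_EFinP; exact: measurable_trunc_pow.
  have f0E (D : set T) x : D x -> (0 <= (trunc t x `^ (- th))%:E)%E.
    by rewrite lee_fin powR_ge0.
  apply: le_trans (hpow _ t3 r3).
  exact: (ge0_subset_integral mu mQ (measurable_ball _ _) (mfE _) (f0E _) Q3).
have I0 : 0 <= 2 * (1 + d) * (3 * rho) `^ (1 - th).
  by rewrite mulr_ge0 ?powR_ge0//; lra.
apply: (le_trans (round_set_avg_int I0 hI)); rewrite lee_fin.
have r30 : 0 < 3 * rho by rewrite mulr_gt0.
have -> : (3 * rho) `^ (1 - th) = 3 * rho * (3 * rho) `^ (- th).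
  by rewrite powRD ?powRr1 ?(ltW r30)// (gt_eqF r30) implybT.
have y0 : 0 <= (3 * rho) `^ (- th) by exact: powR_ge0.
set y := _ `^ _ in y0 *.
have -> : kap / (2 * rho) * (2 * (1 + d) * (3 * rho * y)) = kap * (3 + 3 * d) * y.
  by field; rewrite gt_eqF.
by rewrite ler_wpM2r// ler_pM2l//; lra.
Qed.

(** Removing from the inner ball of [Q] the ball around 0 of half its radius leaves at least half of
    its measure, and there |x| is at least [rho / (2 * kap)]. *)
Lemma trunc_avg_ge (e : R) : 0 <= e ->
  (((2 * kap)^-1 * Num.min 1 (rho / (2 * kap)) `^ e)%:E <=
   avg mu Q (fun x => (trunc t x `^ e)%R))%E.
Proof.
move=> e0; have r0 := rho0.
have kap0 : 0 < kap := lt_le_trans ltr01 kap1.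
have rk0 : 0 < rho / kap by rewrite divr_gt0.
have rk20 : 0 < rho / (2 * kap) by rewrite divr_gt0// mulr_gt0.
set m := Num.min _ _; have m0 : 0 < m by rewrite lt_min ltr01.
pose B0 := ball (0%R : T) (rho / (2 * kap)).
pose B1 := ball (z : T) (rho / kap).
have mB0 : measurable B0 := measurable_ball _ _.
have mB1 : measurable B1 := measurable_ball _ _.
have mE : measurable (B1 `\` B0) by exact: measurableD.
have [q qE /andP[ql qr]] := round_set_measure.
have q0 : 0 < q by apply: lt_le_trans ql; rewrite !mulr_gt0// invr_gt0.
have mfE (D : set T) : measurable_fun D (fun x : T => (trunc t x `^ e)%:E).
  by apply/measurable_funTS/measurable_EFinP; exact: measurable_trunc_pow.
have f0E (D : set T) x : D x -> (0 <= (trunc t x `^ e)%:E)%E by rewrite lee_fin powR_ge0.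
have muE : ((rho / kap)%:E <= mu (B1 `\` B0))%E.
  have : (mu B1 <= mu (B1 `\` B0) + mu B0)%E.
    apply: (@le_trans _ _ (mu ((B1 `\` B0) `|` B0))).
      apply: le_measure; rewrite ?inE//; first exact: measurableU.
      by move=> x B1x; have [?|?] := pselect (B0 x); [right|left].
    exact: measureU2.
  have b1 : mu B1 = (2 * (rho / kap))%:E := real_ball_measure z (ltW rk0).
  have b0' : mu B0 = (2 * (rho / (2 * kap)))%:E := real_ball_measure 0 (ltW rk20).
  rewrite b1 b0' -leeBlDr// -EFinB; congr (_%:E <= _)%E.
  by field; rewrite gt_eqF.
have hI : ((m `^ e * (rho / kap))%:E <= \int[mu]_(x in Q) (trunc t x `^ e)%:E)%E.
  have EQ : B1 `\` B0 `<=` Q by move=> x [B1x _]; exact: zQ.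
  apply: le_trans (ge0_subset_integral mu mE mQ (mfE _) (f0E _) EQ).
  apply: (@le_trans _ _ (\int[mu]_(x in B1 `\` B0) (m `^ e)%:E)%E).
    rewrite (integral_cst mu mE) EFinM.
    by apply: lee_wpmul2l muE; rewrite lee_fin powR_ge0.
  apply: (ge0_le_integral mu mE _ _ (mfE _)) => //.
    by move=> x _; rewrite lee_fin powR_ge0.
  move=> x [_ xB]; rewrite lee_fin; have : ~ `|0 - x| < rho / (2 * kap) by [].
  rewrite sub0r normrN => /negP; rewrite -leNgt => x1.
  apply: ge0_ler_powR; rewrite ?nnegrE ?(ltW m0) ?(ltW (b0 x))//.
  apply: le_trans (trunc_ge_norm t x).
  by rewrite le_min !ge_min x1 lexx/= orbT.
rewrite (avgE _ q0 qE).
apply: (@le_trans _ _ (q^-1%:E * (m `^ e * (rho / kap))%:E)%E); last first.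
  by apply: lee_wpmul2l hI; rewrite lee_fin invr_ge0 ltW.
rewrite -EFinM lee_fin ler_pdivlMl// [leLHS]mulrA [leRHS]mulrC.
have y0 : 0 <= m `^ e by exact: powR_ge0.
apply: (ler_wpM2r y0); rewrite ler_pdivrMr ?mulr_gt0//.
by rewrite (_ : rho / kap * (2 * kap) = 2 * rho)//; field; rewrite gt_eqF.
Qed.

End truncated_averages.

(** * Bounding the characteristics cube by cube *)

Section characteristic_bounds.
Context {d : measure_display} {R : realType} {M : measurableMetricType d R}.
Variable mu : {measure set M -> \bar R}.
Context {K : nat} (D : 'I_K -> dyadic_system mu).

Lemma Ap_const_le (tt B : R) (w : M -> R) : 1 < tt -> (forall x, 0 <= w x) ->
  (forall Q : cube D, exists a b, [/\ 0 <= a, (avg mu (cube_set Q) w <= a%:E)%E,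
    (avg mu (cube_set Q) (fun x => (w x `^ (1 - hconj tt%:E))%R) <= b%:E)%E &
    a * b `^ (tt - 1) <= B]) ->
  (Ap_const D tt w <= B%:E)%E.
Proof.
move=> t1 w0 h; apply: ge_ereal_sup => _ [Q _ <-].
have [a [b [a0 wa ub ab]]] := h Q.
apply: (@le_trans _ _ (a * b `^ (tt - 1))%:E); last by rewrite lee_fin.
rewrite EFinM; apply: lee_pmul => //; first exact: avg_ge0.
  exact: poweR_ge0.
apply: poweR_le_fin => //; first by rewrite subr_ge0 ltW.
by apply: avg_ge0 => x; exact: powR_ge0.
Qed.

Lemma inve_le_fin (x : \bar R) (b : R) : 0 < b -> (b%:E <= x)%E ->
  (x^-1 <= (b^-1)%:E)%E.
Proof.
move=> b0; case: x => [x| |//]; last by move=> _; rewrite invey lee_fin invr_ge0 ltW.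
rewrite lee_fin => bx; have x0 := lt_le_trans b0 bx.
by rewrite inver gt_eqF// lee_fin lef_pV2.
Qed.

Lemma RH_const_le (r B : R) (w : M -> R) : 0 < r -> (forall x, 0 <= w x) ->
  (forall Q : cube D, exists a b, [/\ 0 < b, (b%:E <= avg mu (cube_set Q) w)%E,
    (avg mu (cube_set Q) (fun x => (w x `^ r)%R) <= a%:E)%E &
    a `^ r^-1 / b <= B]) ->
  (RH_const D r w <= B%:E)%E.
Proof.
move=> r0 w0 h; apply: ge_ereal_sup => _ [Q _ <-].
have [a [b [b0 wb va ab]]] := h Q.
apply: (@le_trans _ _ (a `^ r^-1 / b)%:E); last by rewrite lee_fin.
rewrite EFinM; apply: lee_pmul; first exact: poweR_ge0.
- by rewrite inve_ge0; exact: avg_ge0.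
- apply: poweR_le_fin => //; first by rewrite invr_ge0 ltW.
  by apply: avg_ge0 => x; exact: powR_ge0.
- exact: inve_le_fin.
Qed.

(** There are finitely many systems; the sum of the ratios of their radii serves as an upper bound
    for each of them. *)
Lemma cubes_uniformly_round : exists2 kap : R, 1 <= kap &
  forall Q : cube D, exists z rho, [/\ 0 < rho, cube_set Q `<=` ball z rho &
    ball z (rho / kap) `<=` cube_set Q].
Proof.
pose c b := outer_radius (D b) / inner_radius (D b).
have c0 b : 0 <= c b.
  rewrite divr_ge0 ?ltW ?inner_radius_gt0//.
  by case/andP: (radii_ok (D b)) => h1; exact: lt_le_trans.
exists (1 + \sum_b c b); first by rewrite lerDl sumr_ge0.
move=> Q; have [z [zQ Qz]] := cube_set_round Q.
have i0 := inner_radius_gt0 D (tag Q).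
have o0 : 0 < outer_radius (D (tag Q)).
  by case/andP: (radii_ok (D (tag Q))) => h1; exact: lt_le_trans.
have l0 := side_length_gt0 Q.
exists z, (outer_radius (D (tag Q)) * side_length Q); split=> //.
  by rewrite mulr_gt0.
apply: subset_trans zQ; apply: le_ball.
have k0 : 0 < 1 + \sum_b c b by rewrite ltr_wpDr// sumr_ge0.
rewrite ler_pdivrMr// mulrAC ler_pM2r// -ler_pdivrMl// mulrC.
rewrite -/(c (tag Q)) (bigD1 (tag Q))//= addrCA lerDl addr_ge0// sumr_ge0//.
Qed.

End characteristic_bounds.

(** * Characteristics of powers of the truncated distance *)

Section truncated_weights.
Context {R : realType}.
Notation T := (measurableTypeR R).
Notation mu := (@lebesgue_measure R : {measure set T -> \bar R}).
Context {K : nat} (D : 'I_K -> dyadic_system mu).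
Context (kap : R) (kap1 : 1 <= kap)
  (hkap : forall Q : cube D, exists z rho, [/\ 0 < rho, cube_set Q `<=` ball z rho &
    ball z (rho / kap) `<=` cube_set Q]).
Context (t : R) (t0 : 0 < t) (t1 : t <= 1).
Let N := - ln t.
Let N0 : 0 <= N. Proof. by rewrite oppr_ge0 ln_le0. Qed.
Let kap0 : 0 < kap. Proof. exact: lt_le_trans kap1. Qed.
Let b0 x : 0 < trunc t x. Proof. exact: trunc_gt0. Qed.
Let w0 (e : R) x : 0 <= trunc t x `^ e. Proof. exact: powR_ge0. Qed.
Let kN : 4 <= kap * (4 + 3 * N).
Proof. by rewrite -[leLHS]mul1r ler_pM//; have := N0; lra. Qed.
Let mcube (Q : cube D) : measurable (cube_set Q).
Proof. exact: (cube_set_measurable real_line_space). Qed.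

(** The dual weight of this power is the inverse truncated distance for every [tt], so the logarithm
    enters with the power [tt - 1]. *)
Lemma Ap_trunc_pos (tt : R) : 1 < tt ->
  (Ap_const D tt (fun x => (trunc t x `^ (tt - 1))%R) <=
    ((kap * (4 + 3 * N)) `^ (tt - 1))%:E)%E.
Proof.
move=> tt1; have P0 : 0 < tt - 1 by rewrite subr_gt0.
apply: Ap_const_le => // Q; have [z [rho [rho0 Qz zQ]]] := hkap Q.
have uE : (fun x : T => (trunc t x `^ (tt - 1)) `^ (1 - hconj tt%:E)) =
    (fun x : T => trunc t x `^ (-1)).
  apply/funext => x; rewrite -powRrM hconj_EFin//; congr (_ `^ _).
  by field; rewrite gt_eqF.
rewrite uE; have [zr|zr] := leP (2 * rho) (trunc t z).
  have [_ h1] := trunc_avg_osc (mcube Q) rho0 kap1 Qz zQ t0 (tt - 1) zr.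
  have [_ h2] := trunc_avg_osc (mcube Q) rho0 kap1 Qz zQ t0 (-1) zr.
  exists (2 `^ `|tt - 1| * trunc t z `^ (tt - 1)), (2 `^ `|-1| * trunc t z `^ (-1)).
  split=> //; first by rewrite mulr_ge0 ?powR_ge0.
  rewrite normrN1 powRr1// (gtr0_norm P0) powR_inv1 ?(ltW (b0 z))//.
  rewrite -!powRM ?mulr_ge0 ?invr_ge0 ?(ltW (b0 z))//.
  apply: ge0_ler_powR; rewrite ?nnegrE ?(ltW P0)//.
  - by rewrite !mulr_ge0 ?invr_ge0 ?(ltW (b0 z)).
  - by apply: le_trans kN.
  rewrite (_ : _ * _ = 4)//; field; rewrite gt_eqF//; exact: b0.
set y := Num.min 1 (3 * rho).
have y0 : 0 < y by rewrite lt_min ltr01 mulr_gt0.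
exists (y `^ (tt - 1)), (kap * (4 + 3 * N) / y); split.
- exact: powR_ge0.
- apply: (round_set_avg_le (mcube Q) rho0 kap1 Qz zQ).
  + exact: measurable_trunc_pow.
  + by move=> x; exact: powR_ge0.
  move=> x Qx; apply: ge0_ler_powR; rewrite ?nnegrE ?(ltW P0) ?(ltW y0) ?(ltW (b0 x))//.
  exact: (trunc_small Qz zr Qx).
- exact: (trunc_avg_inv (mcube Q) rho0 kap1 Qz zQ t0 t1 zr).
have kN0 : 0 <= kap * (4 + 3 * N) by exact: le_trans kN.
rewrite -powRM ?(ltW y0) ?divr_ge0 ?(ltW y0)// mulrCA divff ?gt_eqF// mulr1//.
Qed.

(** A positive power has no singularity, hence a bound without [t]. The factor [6 * kap] is the
    ratio of the upper scale [3 * rho] to the lower scale [rho / (2 * kap)]. *)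
Lemma RH_trunc_pos (P r : R) : 0 < P -> 1 <= r ->
  (RH_const D r (fun x => (trunc t x `^ P)%R) <= (2 * kap * (6 * kap) `^ P)%:E)%E.
Proof.
move=> P0 r1; have r0 : 0 < r by exact: lt_le_trans r1.
apply: RH_const_le => // Q; have [z [rho [rho0 Qz zQ]]] := hkap Q.
have vE : (fun x : T => (trunc t x `^ P) `^ r) = (fun x : T => trunc t x `^ (P * r)).
  by apply/funext => x; rewrite powRrM.
have Pr0 : 0 < P * r by rewrite mulr_gt0.
have PrV : P * r * r^-1 = P by rewrite mulfK// gt_eqF.
rewrite vE; have [zr|zr] := leP (2 * rho) (trunc t z).
  have [h1 _] := trunc_avg_osc (mcube Q) rho0 kap1 Qz zQ t0 P zr.
  have [_ h2] := trunc_avg_osc (mcube Q) rho0 kap1 Qz zQ t0 (P * r) zr.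
  exists (2 `^ `|P * r| * trunc t z `^ (P * r)), (2 `^ (- `|P|) * trunc t z `^ P).
  split=> //; first by rewrite mulr_gt0 ?powR_gt0.
  rewrite (gtr0_norm P0) (gtr0_norm Pr0) powRM ?powR_ge0// -!powRrM PrV powRN.
  have x0 := powR_gt0 P (b0 z); have y0 : 0 < 2 `^ P :> R by rewrite powR_gt0.
  rewrite (_ : _ / _ = 2 `^ P * 2 `^ P); last by field; rewrite !gt_eqF.
  rewrite -powRM// -[leLHS]mul1r; apply: ler_pM; rewrite ?powR_ge0//.
    by have := kap1; lra.
  by apply: ge0_ler_powR; rewrite ?nnegrE ?(ltW P0)//; have := kap1; lra.
set y := Num.min 1 (3 * rho).
have y0 : 0 < y by rewrite lt_min ltr01 mulr_gt0.
set y' := Num.min 1 (rho / (2 * kap)).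
have y'0 : 0 < y' by rewrite lt_min ltr01 divr_gt0// mulr_gt0.
have k20 : 0 < 2 * kap by rewrite mulr_gt0.
exists (y `^ (P * r)), ((2 * kap)^-1 * y' `^ P); split.
- by rewrite mulr_gt0 ?invr_gt0 ?powR_gt0.
- exact: (trunc_avg_ge (mcube Q) rho0 kap1 Qz zQ t0 (ltW P0)).
- apply: (round_set_avg_le (mcube Q) rho0 kap1 Qz zQ).
  + exact: measurable_trunc_pow.
  + by move=> x; exact: powR_ge0.
  move=> x Qx; apply: ge0_ler_powR; rewrite ?nnegrE ?(ltW Pr0) ?(ltW y0) ?(ltW (b0 x))//.
  exact: (trunc_small Qz zr Qx).
rewrite -powRrM PrV invfM invrK mulrCA ler_pM2l// ler_pdivrMr ?powR_gt0//.
have k60 : 0 <= 6 * kap by rewrite mulr_ge0// ltW.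
rewrite -powRM ?(ltW y'0)//.
apply: ge0_ler_powR; rewrite ?nnegrE ?(ltW P0) ?(ltW y0) ?mulr_ge0 ?(ltW y'0) ?(ltW kap0)//.
rewrite /y'; have [h|h] := leP 1 (rho / (2 * kap)).
  by rewrite mulr1 ge_min; have := kap1; move=> ?; apply/orP; left; lra.
rewrite (_ : 6 * kap * _ = 3 * rho); last by field; rewrite gt_eqF.
by rewrite ge_min lexx orbT.
Qed.

(** Mirror case of the positive power: raising the weight to [th^-1] gives the inverse truncated
    distance, and the logarithm enters with the power [th]. *)
Lemma RH_trunc_neg (th : R) : 0 < th ->
  (RH_const D th^-1 (fun x => (trunc t x `^ (- th))%R) <=
    ((kap * (4 + 3 * N)) `^ th)%:E)%E.
Proof.
move=> th0; have r0 : 0 < th^-1 by rewrite invr_gt0.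
have kN0 : 0 <= kap * (4 + 3 * N) by exact: le_trans kN.
apply: RH_const_le => // Q; have [z [rho [rho0 Qz zQ]]] := hkap Q.
have vE : (fun x : T => (trunc t x `^ (- th)) `^ th^-1) = (fun x : T => trunc t x `^ (-1)).
  by apply/funext => x; rewrite -powRrM mulNr mulfV// gt_eqF.
rewrite vE invrK; have [zr|zr] := leP (2 * rho) (trunc t z).
  have [h1 _] := trunc_avg_osc (mcube Q) rho0 kap1 Qz zQ t0 (- th) zr.
  have [_ h2] := trunc_avg_osc (mcube Q) rho0 kap1 Qz zQ t0 (-1) zr.
  exists (2 `^ `|-1| * trunc t z `^ (-1)), (2 `^ (- `|- th|) * trunc t z `^ (- th)).
  split=> //; first by rewrite mulr_gt0 ?powR_gt0.
  rewrite normrN1 powRr1// normrN (gtr0_norm th0) powRM ?powR_ge0// -!powRrM mulN1r !powRN.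
  have x0 := powR_gt0 th (b0 z); have y0 : 0 < 2 `^ th :> R by rewrite powR_gt0.
  rewrite (_ : _ / _ = 2 `^ th * 2 `^ th); last by field; rewrite !gt_eqF.
  rewrite -powRM//; apply: ge0_ler_powR; rewrite ?nnegrE ?(ltW th0)//.
  by apply: le_trans kN; lra.
set y := Num.min 1 (3 * rho).
have y0 : 0 < y by rewrite lt_min ltr01 mulr_gt0.
exists (kap * (4 + 3 * N) / y), (y `^ (- th)); split.
- exact: powR_gt0.
- apply: (round_set_avg_ge (mcube Q) rho0 kap1 Qz zQ).
  + exact: measurable_trunc_pow.
  + exact: powR_ge0.
  move=> x Qx; rewrite !powRN lef_pV2 ?posrE ?powR_gt0//.
  apply: ge0_ler_powR; rewrite ?nnegrE ?(ltW th0) ?(ltW y0) ?(ltW (b0 x))//.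
  exact: (trunc_small Qz zr Qx).
- exact: (trunc_avg_inv (mcube Q) rho0 kap1 Qz zQ t0 t1 zr).
rewrite powRN invrK -powRM ?divr_ge0 ?(ltW y0)// divfK// gt_eqF//.
Qed.

(** For [th < 1] the weight and its dual are both harmless at the origin, so the whole logarithm of
    the characteristic sits in the reverse Hoelder constant. *)
Lemma Ap_trunc_neg (tt th : R) : 1 < tt -> 0 < th < 1 ->
  (Ap_const D tt (fun x => (trunc t x `^ (- th))%R) <= (kap * (4 + 6 * (1 - th)^-1))%:E)%E.
Proof.
move=> tt1 th01; have /andP[th0 th1] := th01; have P0 : 0 < tt - 1 by rewrite subr_gt0.
have d0 : 0 < (1 - th)^-1 by rewrite invr_gt0 subr_gt0.
have e0 : 0 < th / (tt - 1) by rewrite divr_gt0.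
have eP : th / (tt - 1) * (tt - 1) = th by rewrite divfK// gt_eqF.
apply: Ap_const_le => // Q; have [z [rho [rho0 Qz zQ]]] := hkap Q.
have uE : (fun x : T => (trunc t x `^ (- th)) `^ (1 - hconj tt%:E)) =
    (fun x : T => trunc t x `^ (th / (tt - 1))).
  apply/funext => x; rewrite -powRrM hconj_EFin//; congr (_ `^ _).
  by field; rewrite gt_eqF.
rewrite uE; have [zr|zr] := leP (2 * rho) (trunc t z).
  have [_ h1] := trunc_avg_osc (mcube Q) rho0 kap1 Qz zQ t0 (- th) zr.
  have [_ h2] := trunc_avg_osc (mcube Q) rho0 kap1 Qz zQ t0 (th / (tt - 1)) zr.
  exists (2 `^ `|- th| * trunc t z `^ (- th)),
    (2 `^ `|th / (tt - 1)| * trunc t z `^ (th / (tt - 1))).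
  split=> //; first by rewrite mulr_ge0 ?powR_ge0.
  rewrite normrN (gtr0_norm th0) (gtr0_norm e0) powRM ?powR_ge0// -!powRrM eP powRN.
  have x0 := powR_gt0 th (b0 z); have y0 : 0 < 2 `^ th :> R by rewrite powR_gt0.
  rewrite [leLHS](_ : _ = 2 `^ th * 2 `^ th); last by field; rewrite !gt_eqF.
  rewrite -powRM//; apply: (@le_trans _ _ (2 * 2)).
    by rewrite ler1_powR ?(ltW th1)//; lra.
  by have := kap1; nra.
set y := Num.min 1 (3 * rho).
have y0 : 0 < y by rewrite lt_min ltr01 mulr_gt0.
exists (kap * (4 + 6 * (1 - th)^-1) * y `^ (- th)), (y `^ (th / (tt - 1))); split.
- by rewrite !mulr_ge0 ?powR_ge0 ?(ltW kap0)//; lra.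
- exact: (trunc_avg_pow (mcube Q) rho0 kap1 Qz zQ t0 t1 th01 zr).
- apply: (round_set_avg_le (mcube Q) rho0 kap1 Qz zQ).
  + exact: measurable_trunc_pow.
  + by move=> x; exact: powR_ge0.
  move=> x Qx; apply: ge0_ler_powR; rewrite ?nnegrE ?(ltW e0) ?(ltW y0) ?(ltW (b0 x))//.
  exact: (trunc_small Qz zr Qx).
rewrite -powRrM eP powRN divfK// gt_eqF// powR_gt0//.
Qed.

(** The endpoint [th = 1], which occurs for q0 = +oo: the reverse Hoelder constant is then at most 1
    and the logarithm moves to the [A_p] constant. *)
Lemma Ap_trunc_inv (tt : R) : 1 < tt ->
  (Ap_const D tt (fun x => (trunc t x `^ (-1))%R) <= (kap * (4 + 3 * N))%:E)%E.
Proof.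
move=> tt1; have P0 : 0 < tt - 1 by rewrite subr_gt0.
have e0 : 0 < (tt - 1)^-1 by rewrite invr_gt0.
have eP : (tt - 1)^-1 * (tt - 1) = 1 by rewrite mulVf// gt_eqF.
apply: Ap_const_le => // Q; have [z [rho [rho0 Qz zQ]]] := hkap Q.
have uE : (fun x : T => (trunc t x `^ (-1)) `^ (1 - hconj tt%:E)) =
    (fun x : T => trunc t x `^ (tt - 1)^-1).
  apply/funext => x; rewrite -powRrM hconj_EFin//; congr (_ `^ _).
  by field; rewrite gt_eqF.
rewrite uE; have [zr|zr] := leP (2 * rho) (trunc t z).
  have [_ h1] := trunc_avg_osc (mcube Q) rho0 kap1 Qz zQ t0 (-1) zr.
  have [_ h2] := trunc_avg_osc (mcube Q) rho0 kap1 Qz zQ t0 (tt - 1)^-1 zr.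
  exists (2 `^ `|-1| * trunc t z `^ (-1)),
    (2 `^ `|(tt - 1)^-1| * trunc t z `^ (tt - 1)^-1).
  split=> //; first by rewrite mulr_ge0 ?powR_ge0.
  rewrite normrN1 (gtr0_norm e0) powRM ?powR_ge0// -!powRrM eP.
  rewrite !powRr1 ?(ltW (b0 z))// powR_inv1 ?(ltW (b0 z))//.
  apply: le_trans kN; rewrite (_ : _ * _ = 4)//; field; rewrite gt_eqF//; exact: b0.
set y := Num.min 1 (3 * rho).
have y0 : 0 < y by rewrite lt_min ltr01 mulr_gt0.
have kN0 : 0 <= kap * (4 + 3 * N) by exact: le_trans kN.
exists (kap * (4 + 3 * N) / y), (y `^ (tt - 1)^-1); split.
- by rewrite divr_ge0 ?(ltW y0).
- exact: (trunc_avg_inv (mcube Q) rho0 kap1 Qz zQ t0 t1 zr).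
- apply: (round_set_avg_le (mcube Q) rho0 kap1 Qz zQ).
  + exact: measurable_trunc_pow.
  + by move=> x; exact: powR_ge0.
  move=> x Qx; apply: ge0_ler_powR; rewrite ?nnegrE ?(ltW e0) ?(ltW y0) ?(ltW (b0 x))//.
  exact: (trunc_small Qz zr Qx).
by rewrite -powRrM eP powRr1 ?(ltW y0)// divfK// gt_eqF.
Qed.

Lemma RH_trunc_one (w : T -> R) : (forall x, 0 <= w x) ->
  (forall Q : cube D, (0 < avg mu (cube_set Q) w < +oo)%E) ->
  (RH_const D 1 w <= 1)%E.
Proof.
move=> w0_ h; apply: ge_ereal_sup => _ [Q _ <-].
have -> : (fun x : T => w x `^ 1) = w by apply/funext => x; rewrite powRr1.
have /andP[h1 h2] := h Q.
rewrite invr1 poweRe1 ?(ltW h1)// divee ?gt_eqF//.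
by rewrite ge0_fin_numE ?(ltW h1).
Qed.

End truncated_weights.

(** * A sparse sequence of cubes shrinking to the origin *)

Section shrinking_cubes.
Context {R : realType}.
Notation T := (measurableTypeR R).
Notation mu := (@lebesgue_measure R : {measure set T -> \bar R}).
Context {K : nat} (D : 'I_K -> dyadic_system mu).

Lemma real_ball_in (x r : R) (A : set T) : ball (0 : T) r `<=` A -> `|x| < r -> A x.
Proof. by move=> rA xr; apply: rA; suff : `|0 - x| < r by []; rewrite sub0r normrN. Qed.

(** The next cube fits in one third of a ball inside the present one, so removing it leaves at least
    two thirds of the measure, more than the required half. *)
Lemma half_sparse_of_shrinking (P : nat -> cube D) (rho : nat -> R) :
  (forall j, 0 < rho j) -> (forall j, ball (0 : T) (rho j) `<=` cube_set (P j)) ->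
  (forall j, cube_set (P j.+1) `<=` ball (0 : T) (rho j / 3)) ->
  injective P /\ half_sparse (range P).
Proof.
move=> rho0 rP Pr; have space := @real_line_space R.
have PS j : cube_set (P j.+1) `<=` cube_set (P j).
  apply: subset_trans (rP j); apply: subset_trans (Pr j) _; apply: le_ball.
  by have := rho0 j; lra.
have nest i j : (i < j)%N -> cube_set (P j) `<=` cube_set (P i.+1).
  elim: j => // j IH; rewrite ltnS leq_eqVlt => /predU1P[->//|/IH].
  by apply: subset_trans; exact: PS.
(* The point [rho i / 2] lies in [P i] but not in the ball around the next cube. The inclusions are
   thus strict, and [P] is injective. *)
have not_nest i : ~ cube_set (P i) `<=` cube_set (P i.+1).
  move=> /(subset_trans (rP i))/subset_trans/(_ (Pr i)) h.
  have r0 := rho0 i.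
  have : ball (0 : T) (rho i / 3) (rho i / 2).
    apply: (real_ball_in h); rewrite ger0_norm; lra.
  suff : ~ `|0 - rho i / 2| < rho i / 3 by [].
  by rewrite sub0r normrN ger0_norm; lra.
have injP : injective P.
  move=> i j PP; have [ij|ji|//] := ltngtP i j.
    by have := not_nest i; rewrite {1}PP => /(_ (nest _ _ ij)).
  by have := not_nest j; rewrite -{1}PP => /(_ (nest _ _ ji)).
split=> //.
(* A sparse part must be given for every cube, not for every index; injectivity turns this
   description into a difference of consecutive cubes. *)
pose F (Q : cube D) : set T :=
  [set x | cube_set Q x /\ forall j, Q = P j -> ~ cube_set (P j.+1) x].
have FE j : F (P j) = cube_set (P j) `\` cube_set (P j.+1).
  apply/seteqP; split=> x; first by move=> [Px h]; split=> //; exact: h.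
  by move=> [Px h]; split=> // i /injP <-.
have mP j : measurable (cube_set (P j)) by exact: (cube_set_measurable space).
have disjF i j x : (i < j)%N -> F (P i) x -> F (P j) x -> False.
  by move=> ij; rewrite !FE => -[_ h] [Px _]; apply: h; exact: nest ij _ Px.
exists F; split.
- move=> _ _ [i _ <-] [j _ <-] [x [Fi Fj]].
  have [ij|ji|->//] := ltngtP i j.
    by have := disjF i j x ij Fi Fj.
  by have := disjF j i x ji Fj Fi.
- by move=> _ [j _ <-]; rewrite FE; exact: measurableD.
- by move=> _ [j _ <-] x [].
move=> _ [j _ <-]; rewrite FE.
have r0 := rho0 j.
have mF : measurable (cube_set (P j) `\` cube_set (P j.+1)) by exact: measurableD.
have h1 : ((2 * rho j)%:E <= mu (cube_set (P j)))%E.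
  rewrite -(real_ball_measure 0 (ltW r0)); apply: le_measure; rewrite ?inE//.
  exact: measurable_ball.
have h2 : (mu (cube_set (P j.+1)) <= (2 * (rho j / 3))%:E)%E.
  rewrite -(real_ball_measure 0); last by rewrite divr_ge0// ltW.
  by apply: le_measure; rewrite ?inE//; exact: measurable_ball.
have h3 : (mu (cube_set (P j)) <=
    mu (cube_set (P j) `\` cube_set (P j.+1)) + mu (cube_set (P j.+1)))%E.
  apply: (@le_trans _ _ (mu ((cube_set (P j) `\` cube_set (P j.+1)) `|` cube_set (P j.+1)))).
    apply: le_measure; rewrite ?inE//; first exact: measurableU.
    by move=> x Px; have [?|?] := pselect (cube_set (P j.+1) x); [right|left].
  exact: measureU2.
have [m m0 mE] := ge0_lty_EFin (measure_ge0 _ _) (cube_set_lty space (P j)).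
have mFle : (mu (cube_set (P j) `\` cube_set (P j.+1)) <= m%:E)%E.
  by rewrite -mE; apply: le_measure; rewrite ?inE//; exact: subDsetl.
have [f f0 fE] := ge0_lty_EFin (measure_ge0 _ _) (le_lt_trans mFle (ltry m)).
have [n n0 nE] := ge0_lty_EFin (measure_ge0 _ _) (le_lt_trans h2 (ltry _)).
rewrite mE nE fE -EFinD !lee_fin in h1 h2 h3.
by rewrite mE fE -EFinM lte_fin; lra.
Qed.

Lemma shrinking_cubes : covers_balls D -> exists q L (P : nat -> cube D),
  [/\ 0 < q < 1, 0 < L, injective P /\ half_sparse (range P),
    forall j, ball (0 : T) (q ^+ j) `<=` cube_set (P j) &
    forall j, (mu (dilate 5 (P j)) <= (L * q ^+ j)%:E)%E].
Proof.
case=> C hC; have space := @real_line_space R.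
pose C1 := `|C| + 1; have C10 : 0 < C1 by rewrite ltr_wpDl.
have CC1 : C <= C1 by rewrite (le_trans (ler_norm _))// lerDl.
have C11 : 1 <= C1 by rewrite lerDr.
(* [P j.+1] has diameter at most [C1 * q ^+ j.+1 = q ^+ j / 4] and contains 0, so it lies in the
   ball of radius [q ^+ j / 3]. *)
pose q := (4 * C1)^-1.
have q0 : 0 < q by rewrite invr_gt0 mulr_gt0.
have qC : q * C1 = 1 / 4 by rewrite /q; field; rewrite gt_eqF.
have q1 : q < 1 by rewrite invf_lt1 ?mulr_gt0//; lra.
have qj0 j : 0 < q ^+ j by rewrite exprn_gt0.
have /choice[P hP] : forall j, exists Q : cube D, ball (0 : T) (q ^+ j) `<=` cube_set Q /\
    (diam (cube_set Q) <= (C * q ^+ j)%:E)%E by move=> j; exact: hC.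
have rP j : ball (0 : T) (q ^+ j) `<=` cube_set (P j) by have [] := hP j.
have dP j x y : cube_set (P j) x -> cube_set (P j) y -> `|y - x| <= C1 * q ^+ j.
  move=> Px Py; have [_ dPj] := hP j; have := diam_mdist dPj Px Py.
  have -> : mdist x y = `|y - x| by [].
  by move/le_trans; apply; rewrite ler_pM2r.
have P0 j : cube_set (P j) (0 : R).
  by apply: (real_ball_in (rP j)); rewrite normr0.
have Pr j : cube_set (P j.+1) `<=` ball (0 : T) (q ^+ j / 3).
  move=> x Px; suff : `|0 - x| < q ^+ j / 3 by [].
  have := dP j.+1 _ _ Px (P0 j.+1); rewrite exprS mulrA (mulrC C1) qC.
  by have := qj0 j; lra.
pose I := \sum_b (inner_radius (D b))^-1.
have Ib b : (inner_radius (D b))^-1 <= I.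
  rewrite /I (bigD1 b)//= lerDl sumr_ge0// => b' _.
  by rewrite invr_ge0 ltW// inner_radius_gt0.
have I0 : 0 <= I by rewrite sumr_ge0// => b' _; rewrite invr_ge0 ltW// inner_radius_gt0.
(* The diameter bound [C1] plus five times the side length bound [2 * C1 * I]. *)
pose L' := C1 * (1 + 10 * I).
have L'0 : 0 < L' by rewrite mulr_gt0//; lra.
exists q, (2 * L'), P; split=> //.
- by rewrite q0 q1.
- by rewrite mulr_gt0.
- exact: half_sparse_of_shrinking qj0 rP Pr.
move=> j; set l := side_length (P j).
have l0 : 0 < l := side_length_gt0 (P j).
have c0 := inner_radius_gt0 D (tag (P j)).
(* A set may be a cube of several generations, so the side length is bounded through the diameter:
   on the line the inner ball, of radius [c * l], contains two points at distance [c * l / 2]. *)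
have lI : l <= 2 * C1 * I * q ^+ j.
  have [z [zP _]] := cube_set_round (P j).
  set c := inner_radius (D (tag (P j))) in c0 zP.
  have cl0 : 0 < c * l by rewrite mulr_gt0.
  have Pz : cube_set (P j) z.
    by apply: zP; suff : `|(z : R) - z| < c * l by []; rewrite subrr normr0.
  have Pz' : cube_set (P j) ((z : R) + c * l / 2).
    apply: zP; suff : `|(z : R) - (z + c * l / 2)| < c * l by [].
    rewrite opprD addrA subrr sub0r normrN ger0_norm; first lra.
    by rewrite divr_ge0// ltW.
  have := dP j _ _ Pz Pz'; rewrite addrC addKr ger0_norm; last by rewrite divr_ge0// ltW.
  rewrite ler_pdivrMr// -ler_pdivlMl// => h; apply: (le_trans h).
  have -> : 2 * C1 * I * q ^+ j = I * (C1 * q ^+ j * 2) by ring.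
  by rewrite ler_wpM2r ?Ib// !mulr_ge0 ?(ltW (qj0 j))// ltW.
have dB : dilate 5 (P j) `<=` ball (0 : T) (L' * q ^+ j).
  move=> x; rewrite /dilate/= => xP.
  have /set_dist_lt[y Py xy] : (set_dist x (cube_set (P j)) < (5 * l)%:E)%E.
    by apply: (le_lt_trans xP); rewrite lte_fin -/l; lra.
  have {}xy : `|(y : R) - x| < 5 * l := xy.
  suff : `|0 - (x : R)| < L' * q ^+ j by [].
  rewrite sub0r normrN; have := dP j _ _ (P0 j) Py; rewrite subr0 => y0.
  have xE : `|(x : R)| <= `|(y : R)| + `|(y : R) - x|.
    by rewrite -{1}(subKr (y : R) x) (le_trans (ler_normB _ _)).
  have -> : L' * q ^+ j = C1 * q ^+ j + 5 * (2 * C1 * I * q ^+ j) by rewrite /L'; ring.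
  lra.
rewrite -mulrA -(real_ball_measure 0); last by rewrite mulr_ge0 ?(ltW (qj0 j))// ltW.
apply: le_measure; rewrite ?inE//; first exact: (dilate_measurable space).
exact: measurable_ball.
Qed.

End shrinking_cubes.

(** * The characteristic is at least 1 *)

Section characteristic_lower_bound.
Context {d : measure_display} {R : realType} {M : measurableMetricType d R}.
Variable mu : {measure set M -> \bar R}.
Context (spaceM : doubling_metric_measure_space mu).
Context {K : nat} (D : 'I_K -> dyadic_system mu).

(** Hoelder's inequality on one cube for the dual weights, a power of whose product is 1. It makes
    powers of the characteristic monotone in the exponent, which covers negative exponents in the
    sharpness proof. *)
Lemma characteristic_ge1 (r tt W : R) (w : M -> R) (Q : cube D) :
  1 <= r -> 1 < tt -> weight mu w ->
  (Ap_const D tt w < +oo)%E -> (RH_const D r w < +oo)%E ->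
  (Ap_const D tt w * RH_const D r w = W%:E)%E -> 1 <= W.
Proof.
move=> r1 t1 hw Aoo Boo AB.
have [W' [q [U [V [[W0 q0 U0 V0] AB' [Qq QU QV] key]]]]] :=
  weight_averages spaceM Q r1 t1 hw Aoo Boo.
have WW : W' = W by apply: EFin_inj; rewrite -AB' -AB.
rewrite WW in key; apply: le_trans key.
have [w0 [mw _]] := hw.
have r0 : 0 < r by exact: lt_le_trans r1.
have ri0 : 0 < r^-1 by rewrite invr_gt0.
have P0 : 0 < tt - 1 by rewrite subr_gt0.
pose S := r^-1 + (tt - 1); have S0 : 0 < S by rewrite addr_gt0.
pose th := r^-1 / S.
have th01 : 0 < th < 1.
  by rewrite divr_gt0//= ltr_pdivrMr// mul1r /S ltrDl.
have th'E : 1 - th = (tt - 1) / S.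
  by rewrite /th -[X in X - _](divff (lt0r_neq0 S0)) -mulrBl /S addrAC subrr add0r.
have e1 : r * th = S^-1 by rewrite /th mulrA divff ?mul1r// gt_eqF.
have e2 : (1 - hconj tt%:E) * (1 - th) = - S^-1.
  rewrite th'E hconj_EFin//; move: (lt0r_neq0 S0) (lt0r_neq0 P0).
  by move: S {S0 th th01 th'E e1} => S Sn Pn; field; rewrite Sn Pn.
have vu x : (w x `^ r) `^ th * (w x `^ (1 - hconj tt%:E)) `^ (1 - th) = 1.
  rewrite -!powRrM -powRD; last by rewrite (gt_eqF (w0 x)) implybT.
  by rewrite e1 e2 subrr powRr0.
have mQ := cube_set_measurable spaceM Q.
have mv : measurable_fun [set: M] (fun x => w x `^ r).
  exact: (measurableT_comp (measurable_powR _)).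
have mu_ : measurable_fun [set: M] (fun x => w x `^ (1 - hconj tt%:E)).
  exact: (measurableT_comp (measurable_powR _)).
have v0 x : 0 < w x `^ r by exact: powR_gt0.
have u0 x : 0 < w x `^ (1 - hconj tt%:E) by exact: powR_gt0.
have := mu_le_weights mQ mv mu_ v0 u0 th01 vu V0 U0 QV QU.
rewrite Qq lee_fin => h.
have h1 : 1 <= (V / q) `^ th * (U / q) `^ (1 - th).
  have -> : (V / q) `^ th * (U / q) `^ (1 - th) = V `^ th * U `^ (1 - th) / q.
    rewrite !powRM ?invr_ge0 ?(ltW V0) ?(ltW U0) ?(ltW q0)// mulrACA; congr (_ * _).
    rewrite -powRD; last by rewrite addrC subrK oner_eq0.
    by rewrite addrC subrK powRr1// invr_ge0 ltW.
  by rewrite ler_pdivlMr// mul1r.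
have Vq : 0 <= (V / q) `^ th by exact: powR_ge0.
have Uq : 0 <= (U / q) `^ (1 - th) by exact: powR_ge0.
have := @ge0_ler_powR R S (ltW S0) 1 _ _ _ h1.
rewrite !nnegrE ler01 mulr_ge0// => /(_ isT isT).
by rewrite powR1 powRM// -!powRrM th'E /th !divfK ?gt_eqF.
Qed.

End characteristic_lower_bound.

(** * Test functions *)

Section test_functions.
Context {R : realType}.
Notation T := (measurableTypeR R).
Notation mu := (@lebesgue_measure R : {measure set T -> \bar R}).
Implicit Types t e b k x : R.

Lemma bounded_L1loc (h : T -> R) (B : R) : measurable_fun [set: T] h ->
  (forall x, `|h x| <= B) -> L1loc mu h.
Proof.
move=> mh hB; split=> // A cA.
apply: measurable_bounded_integrable.
- exact: compact_measurable.
- exact: compact_finite_measure.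
- exact: measurable_funTS.
exists B; split; first exact: num_real.
by move=> y By x Ax /=; apply: (le_trans (hB x)); exact: ltW.
Qed.

Definition test_fun t k : T -> R := fun x => trunc t x `^ k * (`|x : R| < 1)%R%:R.

Lemma measurable_test_fun t k : measurable_fun [set: T] (test_fun t k).
Proof.
apply: measurable_funM; first exact: measurable_trunc_pow.
rewrite (_ : (fun x => _) = \1_(ball (0 : T) 1)).
  by apply: measurable_indic; exact: measurable_ball.
apply/funext => x; rewrite indicE; congr ((nat_of_bool _)%:R).
apply/idP/idP; rewrite inE => h.
  by suff : `|0 - (x : R)| < 1 by []; rewrite sub0r normrN.
by have : `|0 - (x : R)| < 1 by []; rewrite sub0r normrN.
Qed.

Lemma trunc_pow_bounded t e : 0 < t -> t <= 1 -> exists B : R, forall x,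
  trunc t x `^ e <= B.
Proof.
move=> t0 t1; exists (1 + t `^ e) => x; have x0 := trunc_gt0 x t0.
have [e0|e0] := leP 0 e.
  rewrite ler_wpDr ?powR_ge0// [leRHS](_ : _ = 1 `^ e); last by rewrite powR1.
  by apply: ge0_ler_powR; rewrite ?nnegrE ?(ltW x0)// trunc_le1.
rewrite ler_wpDl// -(opprK e) !(powRN _ (- e)) lef_pV2 ?posrE ?powR_gt0//.
by apply: ge0_ler_powR; rewrite ?nnegrE ?oppr_ge0 ?(ltW x0) ?(ltW t0) ?(ltW e0)// trunc_ge.
Qed.

Lemma test_fun_L1loc t k : 0 < t -> t <= 1 -> L1loc mu (test_fun t k).
Proof.
move=> t0 t1; have [B hB] := trunc_pow_bounded k t0 t1.
apply: (@bounded_L1loc _ B); first exact: measurable_test_fun.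
move=> x; rewrite /test_fun normrM (ger0_norm (powR_ge0 _ _)).
apply: le_trans (hB x); rewrite ler_piMr ?powR_ge0//.
by case: (_ < _); rewrite ?normr1 ?normr0.
Qed.

Lemma trunc_weight t e : 0 < t -> t <= 1 -> weight mu (fun x => trunc t x `^ e).
Proof.
move=> t0 t1; split=> [x|]; first by rewrite powR_gt0// trunc_gt0.
have [B hB] := trunc_pow_bounded e t0 t1.
apply: (@bounded_L1loc _ B); first exact: measurable_trunc_pow.
by move=> x; rewrite (ger0_norm (powR_ge0 _ _)).
Qed.

Lemma test_fun_pow t k b x : 0 < t -> b != 0 ->
  `|test_fun t k x| `^ b = trunc t x `^ (k * b) * (`|x| < 1)%R%:R.
Proof.
move=> t0 b0; rewrite /test_fun; case: (_ < _) => /=.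
  by rewrite !mulr1 (ger0_norm (powR_ge0 _ _)) powRrM.
by rewrite !mulr0 normr0 powR0.
Qed.

Lemma test_fun_weighted_integral t k b e : 0 < t -> b != 0 ->
  (\int[mu]_x (`|test_fun t k x| `^ b * trunc t x `^ e)%:E =
   \int[mu]_(x in ball (0%R : T) 1%R) (trunc t x `^ (k * b + e))%:E)%E.
Proof.
move=> t0 b0; rewrite [RHS]integral_mkcond; apply: eq_integral => x _.
rewrite test_fun_pow// patchE; case: ifPn => [/set_mem hx|/negP hx].
  have -> : `|x : R| < 1.
    by have : `|0 - (x : R)| < 1 := hx; rewrite sub0r normrN.
  by rewrite mulr1 powRD// (gt_eqF (trunc_gt0 _ t0)) implybT.
have -> : (`|x : R| < 1) = false.
  apply/negP => h; apply: hx; apply: mem_set.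
  by suff : `|0 - (x : R)| < 1 by []; rewrite sub0r normrN.
by rewrite mulr0 mul0r.
Qed.

Lemma test_fun_avg_ge t k b rho L A (S : set T) : 0 < t -> b != 0 -> 0 < rho ->
  rho <= 1 -> 0 <= A -> measurable S -> (0 < mu S)%E ->
  ball (0 : T) rho `<=` S -> (mu S <= (L * rho)%:E)%E ->
  ((A * (L * rho))%:E <=
     \int[mu]_(x in ball (0%R : T) rho) (trunc t x `^ (k * b))%:E)%E ->
  (A%:E <= avg mu S (fun x => (`|test_fun t k x| `^ b)%R))%E.
Proof.
move=> t0 b0 rho0 rho1 A0 mS S0 rS Sle hA.
have [q q0' qE] := ge0_lty_EFin (ltW S0) (le_lt_trans Sle (ltry _)).
have q0 : 0 < q by move: S0; rewrite qE lte_fin.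
rewrite qE lee_fin in Sle.
have mh : measurable_fun [set: T] (fun x => `|test_fun t k x| `^ b).
  apply: (measurableT_comp (measurable_powR _)).
  by apply: measurableT_comp => //; exact: measurable_test_fun.
have mB : measurable (ball (0 : T) rho) := measurable_ball _ _.
have hI : (\int[mu]_(x in ball (0%R : T) rho) (trunc t x `^ (k * b))%:E <=
    \int[mu]_(x in S) (`|test_fun t k x| `^ b)%:E)%E.
  have mhE (E : set T) : measurable_fun E (fun x : T => (`|test_fun t k x| `^ b)%:E).
    by apply/measurable_funTS/measurable_EFinP.
  have h0E (E : set T) x : E x -> (0 <= (`|test_fun t k x| `^ b)%:E)%E.
    by rewrite lee_fin powR_ge0.
  apply: le_trans (ge0_subset_integral mu mB mS (mhE _) (h0E _) rS).
  rewrite le_eqVlt; apply/orP; left; apply/eqP; apply: eq_integral => x.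
  rewrite inE => hx; rewrite test_fun_pow//.
  have -> : `|x : R| < 1.
    have : `|0 - (x : R)| < rho := hx; rewrite sub0r normrN => h.
    exact: lt_le_trans h _.
  by rewrite mulr1.
rewrite (avgE _ q0 qE) lee_pdivlMl//; apply: le_trans (le_trans hA hI).
by rewrite lee_fin mulrC ler_wpM2l.
Qed.

End test_functions.

Lemma esum_range_ge {R : realType} (I : choiceType) (P : nat -> I)
    (u : I -> \bar R) (c : R) (J : nat) :
  injective P -> (forall j, (j < J)%N -> (c%:E <= u (P j))%E) ->
  ((J%:R * c)%:E <= \esum_(i in range P) u i)%E.
Proof.
move=> injP hc; rewrite esum_image; last by move=> i j _ _; exact: injP.
apply: esum_ge; exists `I_J; first by split; [exact: finite_II|].
rewrite -fsbig_ord; have -> : (J%:R * c)%:E = (\sum_(i < J) c%:E)%E.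
  by rewrite sumEFin sumr_const card_ord mulr_natl.
by apply: lee_sum => i _; exact: hc.
Qed.

Lemma poweR_ge_fin {R : realType} (x : \bar R) (y e : R) : 0 <= e -> 0 <= y ->
  (y%:E <= x)%E -> ((y `^ e)%:E <= x `^ e)%E.
Proof.
move=> e0 y0 yx; rewrite -poweR_EFin; apply: gt0_ler_poweR => //.
  by rewrite in_itv /= lee_fin y0 leey.
by rewrite in_itv /= leey andbT (le_trans _ yx)// lee_fin.
Qed.

(** * Testing the estimate on J cubes *)

Section sharpness.
Context {R : realType}.
Notation T := (measurableTypeR R).
Notation mu := (@lebesgue_measure R : {measure set T -> \bar R}).
Context {K : nat} (D : 'I_K -> dyadic_system mu).

(** The first two exponent relations make |f|^p w and its analogue for g equal to the inverse
    truncated distance on the unit ball; the third makes every term independent of its scale. So the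
    sum is at least J times one constant, and [Af], [Ag] record how far the averages exceed pure
    powers of the scale. *)
Lemma sparse_estimate_testing (q L : R) (P : nat -> cube D) (J : nat)
    (a p s al k m Af Ag W eta C t : R) (q0 : \bar R) :
  0 < q < 1 -> 0 < L -> injective P -> half_sparse (range P) ->
  (forall j, ball (0 : T) (q ^+ j) `<=` cube_set (P j)) ->
  (forall j, (mu (dilate 5 (P j)) <= (L * q ^+ j)%:E)%E) ->
  0 < a -> 2 < p -> 0 < s -> star q0 = s ->
  k * p + al = -1 -> m * (p / (p - 2)) + al * (1 - p / (p - 2)) = -1 ->
  2 * k + m + 1 = 0 -> 0 <= Af -> 0 <= Ag ->
  0 < t -> t <= 1 ->
  let w := fun x : T => trunc t x `^ al in
  (forall j, (j < J)%N -> ((Af * (q ^+ j) `^ (k * a) * (L * q ^+ j))%:E <=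
    \int[mu]_(x in ball (0%R : T) (q ^+ j)) (trunc t x `^ (k * a))%:E)%E) ->
  (forall j, (j < J)%N -> ((Ag * (q ^+ j) `^ (m * s) * (L * q ^+ j))%:E <=
    \int[mu]_(x in ball (0%R : T) (q ^+ j)) (trunc t x `^ (m * s))%:E)%E) ->
  (Ap_const D (p / a) w < +oo)%E ->
  (RH_const D (hconj (q0 / p%:E)) w < +oo)%E ->
  (Ap_const D (p / a) w * RH_const D (hconj (q0 / p%:E)) w = W%:E)%E ->
  sparse_estimate D a q0 p eta C ->
  J%:R * (2 * (Af `^ (2 / a) * Ag `^ s^-1)) <= `|C| * W `^ eta * (2 + 2 * - ln t).
Proof.
move=> /andP[qp q1] L0 injP sparseP ballP dilP a0 p2 s0 sE ek em ekm.
move=> Af0 Ag0 t0 t1 w hf hg Aoo Boo AB est.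
have p0 : 0 < p by lra.
have ps0 : p / (p - 2) != 0 by rewrite mulf_neq0 ?invr_neq0// gt_eqF//; lra.
have [S0 S00 S0E] : exists2 y : R, 0 <= y &
    (\int[mu]_(x in ball (0%R : T) 1%R) (trunc t x `^ (-1))%:E)%E = y%:E.
  apply: ge0_lty_EFin; last exact: le_lt_trans (trunc_integral_inv t0 t1) (ltry _).
  by apply: integral_ge0 => x _; rewrite lee_fin powR_ge0.
have S0le : S0 <= 2 + 2 * - ln t.
  by rewrite -lee_fin -S0E; exact: trunc_integral_inv.
have := est _ sparseP _ _ (test_fun_L1loc k t0 t1) (test_fun_L1loc m t0 t1) _
  (trunc_weight al t0 t1) Aoo Boo.
rewrite /= AB star_EFin// sE /weighted_norm => h.
have nf : (\int[mu]_x (`|test_fun t k x| `^ p * trunc t x `^ al)%:E)%E = S0%:E.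
  by rewrite (test_fun_weighted_integral _ _ t0 (lt0r_neq0 p0)) ek.
have ng : (\int[mu]_x (`|test_fun t m x| `^ (p / (p - 2)) *
    (trunc t x `^ al) `^ (1 - p / (p - 2)))%:E)%E = S0%:E.
  rewrite -S0E -em -(test_fun_weighted_integral _ _ t0 ps0).
  by apply: eq_integral => x _; rewrite -powRrM.
rewrite nf ng !poweR_EFin -!EFinM in h.
apply: le_trans (_ : C * W `^ eta * S0 <= _).
  rewrite -lee_fin; apply: le_trans (esum_range_ge injP _) (le_trans h _).
    move=> j jJ; set rho := q ^+ j.
    have rho0 : 0 < rho by exact: exprn_gt0.
    have rho1 : rho <= 1 by rewrite exprn_ile1// ltW.
    have X0 e : 0 < rho `^ e by exact: powR_gt0.
    have mP := cube_set_measurable (@real_line_space R) (P j).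
    have mE := dilate_measurable (@real_line_space R) (P j).
    have PE := @cube_set_sub_dilate _ _ _ _ _ D (P j).
    have rP := ballP j; have rE := subset_trans rP PE.
    have Pge : ((2 * rho)%:E <= mu (cube_set (P j)))%E.
      rewrite -(real_ball_measure (0 : T) (ltW rho0)).
      by apply: le_measure; rewrite ?inE//; exact: measurable_ball.
    have E0 : (0 < mu (dilate 5 (P j)))%E.
      apply: lt_le_trans (cube_set_gt0 (@real_line_space R) (P j)) _.
      by apply: le_measure; rewrite ?inE.
    have a0' : a != 0 by rewrite gt_eqF.
    have s0' : s != 0 by rewrite gt_eqF.
    have hf1 := test_fun_avg_ge t0 a0' rho0 rho1 (mulr_ge0 Af0 (ltW (X0 _))) mE E0
      rE (dilP j) (hf j jJ).
    have hg1 := test_fun_avg_ge t0 s0' rho0 rho1 (mulr_ge0 Ag0 (ltW (X0 _))) mE E0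
      rE (dilP j) (hg j jJ).
    have a2 : 0 <= 2 / a by rewrite divr_ge0// ltW.
    have si : 0 <= s^-1 by rewrite invr_ge0 ltW.
    have hf2 := poweR_ge_fin a2 (mulr_ge0 Af0 (ltW (X0 _))) hf1.
    have hg2 := poweR_ge_fin si (mulr_ge0 Ag0 (ltW (X0 _))) hg1.
    have -> : (2 * (Af `^ (2 / a) * Ag `^ s^-1))%:E =
        (((Af * rho `^ (k * a)) `^ (2 / a))%:E * ((Ag * rho `^ (m * s)) `^ s^-1)%:E
        * (2 * rho)%:E)%E.
      rewrite -!EFinM; congr (_%:E).
      rewrite (powRM _ Af0 (ltW (X0 _))) (powRM _ Ag0 (ltW (X0 _))) -!powRrM.
      have -> : k * a * (2 / a) = 2 * k by rewrite -mulrA (mulrCA a) divff// mulr1 mulrC.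
      have -> : m * s / s = m by exact: mulfK.
      (* All powers of the scale cancel; the factor 2 of the lower bound is the length of an
         interval of radius 1. *)
      have : rho `^ (2 * k) * rho `^ m * rho = 1.
        rewrite -[X in _ * X](powRr1 (ltW rho0)) -!powRD ?(gt_eqF rho0) ?implybT//.
        by rewrite ekm powRr0.
      set u := rho `^ (2 * k); set v := rho `^ m; set x := Af `^ _; set y := Ag `^ _.
      by move=> uv; rewrite -[LHS]mulr1 -uv; ring.
    apply: lee_pmul Pge.
    - by rewrite -EFinM lee_fin mulr_ge0 ?powR_ge0.
    - by rewrite lee_fin mulr_ge0 ?(ltW rho0).
    - by apply: lee_pmul hf2 hg2; rewrite lee_fin powR_ge0.
  rewrite lee_fin le_eqVlt; apply/orP; left; apply/eqP.
  rewrite -(mulrA (C * _)); congr (_ * _).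
  (* The three norm factors are powers of the same integral [S0] with exponents adding up to 1, so
     together they give just one logarithm. *)
  have e1 : p^-1 + p^-1 + (p / (p - 2))^-1 = 1.
    by rewrite invf_div; field; rewrite gt_eqF.
  have e2 : p^-1 + p^-1 != 0 by rewrite gt_eqF// addr_gt0 ?invr_gt0.
  rewrite -powRD ?(negPf e2)// -powRD ?e1 ?oner_eq0// powRr1//.
have N0 : 0 <= 2 + 2 * - ln t by apply: le_trans S0le.
rewrite -!mulrA; apply: le_trans (_ : `|C| * (W `^ eta * S0) <= _).
  by rewrite ler_wpM2r ?ler_norm// mulr_ge0 ?powR_ge0.
by rewrite ler_wpM2l// ler_wpM2l ?powR_ge0.
Qed.

End sharpness.

(** Comparison of powers of J: the left side grows like J^(1 + tau'), while the right side is at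
    most of order J^(1 + eta tau) when eta is nonnegative. *)
Lemma growth_contradiction {R : realType} (c C B l tau tau' eta : R)
    (W : nat -> R) :
  0 < c -> 0 <= C -> 0 <= B -> 0 <= l -> 0 <= tau -> 0 < tau' ->
  eta * tau < tau' ->
  (forall J, (0 < J)%N -> 1 <= W J /\ W J <= B * (4 + 6 * (J%:R * l)) `^ tau) ->
  (forall J, (0 < J)%N ->
    c * (J%:R * J%:R `^ tau') <= C * W J `^ eta * (2 + 4 * (J%:R * l))) -> False.
Proof.
move=> c0 C0 B0 l0 tau0 tau'0 ett hW hJ.
(* As [W J >= 1], a negative exponent may be raised to 0; after that the upper bound on [W J] can be
   used. *)
pose e := Num.max eta 0.
have e0 : 0 <= e by rewrite le_max lexx orbT.
have d0 : 0 < tau' - tau * e.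
  rewrite subr_gt0 /e mulrC; case: (leP eta 0) => h; last by [].
  by rewrite mul0r.
pose d := tau' - tau * e; pose a := 4 + 6 * l.
have a0 : 0 <= a by rewrite addr_ge0 ?mulr_ge0.
pose H := C * (B * a `^ tau) `^ e * a.
have bound J : (0 < J)%N -> J%:R `^ d <= H / c.
  move=> J0; have J1 : 1 <= J%:R :> R by rewrite ler1n.
  have Jp : 0 < J%:R :> R by rewrite ltr0n.
  have [W1 W2] := hW J J0; have h := hJ J J0.
  have aJ : 4 + 6 * (J%:R * l) <= a * J%:R.
    have -> : a * J%:R = 4 * J%:R + 6 * (J%:R * l) by rewrite /a; ring.
    by apply: lerD => //; rewrite ler_peMr.
  have aJ' : 2 + 4 * (J%:R * l) <= a * J%:R.
    by apply: le_trans aJ; apply: lerD; rewrite ?ler_nat// ler_wpM2r ?ler_nat// mulr_ge0// ltW.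
  have We : W J `^ eta <= (B * a `^ tau) `^ e * J%:R `^ (tau * e).
    apply: le_trans (_ : W J `^ e <= _).
      by apply: ler_powR => //; rewrite le_max lexx.
    rewrite powRrM -powRM ?mulr_ge0 ?powR_ge0// -mulrA -powRM ?(ltW Jp)//.
    apply: ge0_ler_powR; rewrite ?nnegrE ?(le_trans ler01 W1) ?mulr_ge0 ?powR_ge0//.
    apply: le_trans W2 _; rewrite ler_wpM2l//.
    by apply: ge0_ler_powR; rewrite ?nnegrE ?mulr_ge0 ?(ltW Jp) ?addr_ge0 ?mulr_ge0 ?(ltW Jp).
  have tE : J%:R `^ tau' = J%:R `^ d * J%:R `^ (tau * e) :> R.
    by rewrite -powRD ?subrK// (gt_eqF Jp) implybT.
  have X0 : 0 < J%:R `^ (tau * e) :> R by exact: powR_gt0.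
  rewrite ler_pdivlMr// -(ler_pM2r (mulr_gt0 X0 Jp)).
  rewrite (_ : _ * _ * _ = c * (J%:R * J%:R `^ tau')); last by rewrite tE; ring.
  apply: le_trans h _.
  rewrite /H (_ : C * _ * _ * _ = C * ((B * a `^ tau) `^ e * J%:R `^ (tau * e)) * (a * J%:R)).
    rewrite ler_pM ?mulr_ge0 ?powR_ge0 ?addr_ge0 ?mulr_ge0 ?(ltW Jp)//.
    by rewrite ler_wpM2l.
  by set x := powR _ e; set y := powR _ (tau * e); ring.
have Hc0 : 0 <= H / c by rewrite divr_ge0 ?(ltW c0)// !mulr_ge0 ?powR_ge0.
(* The first integer beyond the value at which [J^d] reaches [H / c]. *)
pose J := (Num.truncn ((H / c) `^ d^-1)).+1.
have := bound J isT; apply/negP; rewrite -ltNge.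
have hJ1 : (H / c) `^ d^-1 < J%:R by exact: truncnS_gt.
rewrite [ltLHS](_ : _ = ((H / c) `^ d^-1) `^ d).
  by apply: gt0_ltr_powR; rewrite ?nnegrE ?powR_ge0.
by rewrite -powRrM mulVf ?gt_eqF// powRr1.
Qed.

(** * The characteristic as a number and the truncation scale *)

Section sharpness_cases.
Context {R : realType}.
Notation T := (measurableTypeR R).
Notation mu := (@lebesgue_measure R : {measure set T -> \bar R}).
Context {K : nat} (D : 'I_K -> dyadic_system mu).

Lemma characteristic_bound (r tt X Y : R) (w : T -> R) (Q : cube D) :
  1 <= r -> 1 < tt -> weight mu w ->
  (Ap_const D tt w <= X%:E)%E -> (RH_const D r w <= Y%:E)%E ->
  exists W, [/\ (Ap_const D tt w * RH_const D r w = W%:E)%E, 1 <= W & W <= X * Y].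
Proof.
move=> r1 t1 hw hX hY; have space := @real_line_space R.
have Aoo := le_lt_trans hX (ltry X); have Boo := le_lt_trans hY (ltry Y).
have [W [q [U [V [_ AB _ _]]]]] := weight_averages space Q r1 t1 hw Aoo Boo.
exists W; split=> //; first exact: (characteristic_ge1 space Q r1 t1 hw Aoo Boo AB).
have w0 x : 0 <= w x by have [w0 _] := hw; rewrite ltW.
rewrite -lee_fin -AB EFinM; apply: lee_pmul => //.
  apply: le_trans (ereal_sup_ubound _); last by exists Q.
  by apply: mule_ge0; [apply: avg_ge0|exact: poweR_ge0].
apply: le_trans (ereal_sup_ubound _); last by exists Q.
by apply: mule_ge0; [exact: poweR_ge0|rewrite inve_ge0; apply: avg_ge0].
Qed.

Lemma trunc_integral_ge_scales (q L e : R) (J j : nat) : 0 < q < 1 -> 0 < L ->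
  (j < J)%N ->
  ((2 `^ (- `|e|) / 2 / L * (q ^+ j) `^ e * (L * q ^+ j))%:E <=
    \int[mu]_(x in ball (0%R : T) (q ^+ j)) (trunc (q ^+ (2 * J)) x `^ e)%:E)%E.
Proof.
move=> /andP[q0 q1] L0 jJ.
rewrite [X in (X%:E <= _)%E](_ : _ = 2 `^ (- `|e|) / 2 * (q ^+ j) `^ e * q ^+ j).
  apply: trunc_integral_ge; first exact: (exprn_gt0 _ q0).
    exact: ler_wiXn2l (ltW q0) (ltW q1) _ _ (leq_trans (ltnW jJ) (@leq_pmull J 2 isT)).
  exact: exprn_ile1 (ltW q0) (ltW q1).
set u := powR 2 _; set v := powR _ e; set y := q ^+ j.
by field; rewrite gt_eqF.
Qed.

(** The truncation [q^(2J)] lies at least J scales below each of the J cubes, so every integral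
    gains the full [J * - ln q]. Truncating at [q^J] would leave almost no gain for the last
    cubes. *)
Lemma trunc_integral_inv_ge_scales (q L : R) (J j : nat) : 0 < q < 1 -> 0 < L ->
  (j < J)%N ->
  ((J%:R * - ln q / L * (q ^+ j) `^ (-1) * (L * q ^+ j))%:E <=
    \int[mu]_(x in ball (0%R : T) (q ^+ j)) (trunc (q ^+ (2 * J)) x `^ (-1))%:E)%E.
Proof.
move=> /andP[q0 q1] L0 jJ.
have y0 : 0 < q ^+ j by exact: exprn_gt0.
apply: le_trans (trunc_integral_inv_ge _ _ _); first last.
- exact: exprn_ile1 (ltW q0) (ltW q1).
- exact: ler_wiXn2l (ltW q0) (ltW q1) _ _ (leq_trans (ltnW jJ) (@leq_pmull J 2 isT)).
- exact: (exprn_gt0 _ q0).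
rewrite lee_fin powR_inv1 ?(ltW y0)//.
have -> : J%:R * - ln q / L * (q ^+ j)^-1 * (L * q ^+ j) = J%:R * - ln q.
  by field; rewrite !gt_eqF.
have lnE i : ln (q ^+ i) = i%:R * ln q by rewrite lnXn// mulr_natl.
rewrite !lnE natrM.
have l0 : ln q <= 0 by rewrite ln_le0// ltW.
have : j%:R <= J%:R :> R by rewrite ler_nat ltnW.
nra.
Qed.
End sharpness_cases.

(** * From testing to a contradiction *)

Section sharpness_proof.
Context {R : realType}.
Notation T := (measurableTypeR R).
Notation mu := (@lebesgue_measure R : {measure set T -> \bar R}).
Context {K : nat} (D : 'I_K -> dyadic_system mu).

(** Here [tau] is the power of the logarithm in the characteristic and [tau'] the power of J gained
    by each term. Since log(1/t) is 2 J log(1/q), both are powers of J, and the extra logarithm from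
    the norms is matched by the number J of terms. Hence the critical exponent is [tau' / tau]. *)
Lemma sparse_estimate_testing_false (q L a p s r al k m c B tau tau' eta C : R)
    (P : nat -> cube D) (Af Ag : nat -> R) (q0 : \bar R) :
  0 < q < 1 -> 0 < L -> injective P -> half_sparse (range P) ->
  (forall j, ball (0 : T) (q ^+ j) `<=` cube_set (P j)) ->
  (forall j, (mu (dilate 5 (P j)) <= (L * q ^+ j)%:E)%E) ->
  0 < a -> a < p -> 2 < p -> 0 < s -> star q0 = s -> 1 <= r -> hconj (q0 / p%:E) = r ->
  k * p + al = -1 -> m * (p / (p - 2)) + al * (1 - p / (p - 2)) = -1 ->
  2 * k + m + 1 = 0 -> (forall J, 0 <= Af J) -> (forall J, 0 <= Ag J) ->
  (forall J j, (j < J)%N -> ((Af J * (q ^+ j) `^ (k * a) * (L * q ^+ j))%:E <=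
    \int[mu]_(x in ball (0%R : T) (q ^+ j))
      (trunc (q ^+ (2 * J)) x `^ (k * a))%:E)%E) ->
  (forall J j, (j < J)%N -> ((Ag J * (q ^+ j) `^ (m * s) * (L * q ^+ j))%:E <=
    \int[mu]_(x in ball (0%R : T) (q ^+ j))
      (trunc (q ^+ (2 * J)) x `^ (m * s))%:E)%E) ->
  0 < c -> 0 <= B -> 0 <= tau -> 0 < tau' -> eta * tau < tau' ->
  (forall J, c * J%:R `^ tau' <= Af J `^ (2 / a) * Ag J `^ s^-1) ->
  (forall t, 0 < t -> t <= 1 -> let w := fun x : T => trunc t x `^ al in
    exists X Y : R, [/\ (Ap_const D (p / a) w <= X%:E)%E, (RH_const D r w <= Y%:E)%E &
      X * Y <= B * (4 + 3 * - ln t) `^ tau]) ->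
  sparse_estimate D a q0 p eta C -> False.
Proof.
move=> q01 L0 injP sparseP ballP dilP a0 ap p2 s0 sE r1 rE ek em ekm Af0 Ag0 hf hg.
move=> c0 B0 tau0 tau'0 ett hA hW est; have /andP[qp q1] := q01.
have l0 : 0 <= - ln q by rewrite oppr_ge0 ln_le0// ltW.
have lnE i : - ln (q ^+ (2 * i)) = 2 * (i%:R * - ln q).
  by rewrite lnXn// -(mulr_natl (ln q)) natrM; ring.
have t0 J : 0 < q ^+ (2 * J) by exact: exprn_gt0.
have t1 J : q ^+ (2 * J) <= 1 by exact: exprn_ile1 (ltW qp) (ltW q1).
have hw J := trunc_weight al (t0 J) (t1 J).
have tt1 : 1 < p / a by rewrite ltr_pdivlMr// mul1r.
pose w J : T -> R := fun x => trunc (q ^+ (2 * J)) x `^ al.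
have /choice[W hWJ] : forall J, exists W : R,
    [/\ (Ap_const D (p / a) (w J) < +oo)%E, (RH_const D r (w J) < +oo)%E,
    (Ap_const D (p / a) (w J) * RH_const D r (w J) = W%:E)%E, 1 <= W &
    W <= B * (4 + 3 * - ln (q ^+ (2 * J))) `^ tau].
  move=> J; have [X [Y [hX hY XY]]] := hW _ (t0 J) (t1 J).
  have [W [WE W1 WXY]] := characteristic_bound (P 0%N) r1 tt1 (hw J) hX hY.
  exists W; split=> //; first exact: le_lt_trans hX (ltry _).
    exact: le_lt_trans hY (ltry _).
  exact: le_trans WXY XY.
apply: (@growth_contradiction R (2 * c) `|C| B (- ln q) tau tau' eta W) => //.
- by rewrite mulr_gt0.
- move=> J _; have [_ _ _ W1 W2] := hWJ J; split=> //.
  by move: W2; rewrite lnE (mulrA 3) -natrM.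
- move=> J _; have [Aoo Boo WE W1 W2] := hWJ J.
  rewrite -rE in Boo WE.
  have := sparse_estimate_testing q01 L0 injP sparseP ballP dilP a0 p2 s0 sE ek em ekm
    (Af0 J) (Ag0 J) (t0 J) (t1 J) (@hf J) (@hg J) Aoo Boo WE est.
  rewrite lnE (mulrA 2 2) -natrM; apply: le_trans.
  rewrite mulrCA; apply: ler_wpM2l => //.
  by rewrite -mulrA; apply: ler_wpM2l.
Qed.

End sharpness_proof.

(** * The two critical exponents *)

Section sharpness_theorem.
Context {R : realType}.
Notation T := (measurableTypeR R).
Notation mu := (@lebesgue_measure R : {measure set T -> \bar R}).
Context {K : nat} (D : 'I_K -> dyadic_system mu) (coverD : covers_balls D).

(** The weight exponent p/a - 1 forces k = -1/a, so |f|^a is the inverse truncated distance and its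
    averages gain J. The terms gain J^(2/a) and the characteristic carries the power p/a - 1 of the
    logarithm; the quotient of these exponents is 2/(p - a). *)
Lemma sharp_first_exponent (a p z eta C : R) (q0 : \bar R) :
  1 <= a -> a < 2 -> 2 < p -> 0 <= z -> p * z < 1 ->
  star q0 = (1 - 2 * z)^-1 -> hconj (q0 / p%:E) = (1 - p * z)^-1 ->
  eta < 2 / (p - a) -> ~ sparse_estimate D a q0 p eta C.
Proof.
move=> a1 a2 p2 z0 pz1 sE rE ett est.
have pz0 : 0 <= p * z by rewrite mulr_ge0//; lra.
have pz2 : 0 <= (p - 2) * z by rewrite mulr_ge0//; lra.
have z2 : 0 < 1 - 2 * z by lra.
have z3 : 0 < 1 - p * z by lra.
have a0 : 0 < a by lra.
have a_neq0 : a != 0 by rewrite gt_eqF.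
have ap : a < p by lra.
have p20 : p - 2 != 0 by rewrite gt_eqF//; lra.
have pa0 : 0 < p - a by lra.
have r1 : 1 <= (1 - p * z)^-1 by rewrite invf_ge1//; lra.
have s0 : 0 < (1 - 2 * z)^-1 by rewrite invr_gt0.
have tt1 : 1 < p / a by rewrite ltr_pdivlMr// mul1r.
have tt0 : 0 < p / a - 1 by rewrite subr_gt0.
have [q [L [P [q01 L0 [injP sparseP] ballP dilP]]]] := shrinking_cubes coverD.
have /andP[qp q1] := q01.
have l0 : 0 < - ln q by rewrite oppr_gt0 ln_lt0// qp.
have [kap kap1 hkap] := cubes_uniformly_round D.
have kap0 : 0 < kap := lt_le_trans ltr01 kap1.
pose s := (1 - 2 * z)^-1; pose m := 2 / a - 1.
have kaE : - a^-1 * a = -1 by rewrite mulNr mulVf.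
pose g0 := 2 `^ (- `|m * s|) / 2 / L.
have g00 : 0 < g0 by rewrite !divr_gt0// powR_gt0.
apply: (@sparse_estimate_testing_false R K D q L a p s (1 - p * z)^-1 (p / a - 1) (- a^-1) m
  ((- ln q / L) `^ (2 / a) * g0 `^ s^-1)
  (kap `^ (p / a - 1) * (2 * kap * (6 * kap) `^ (p / a - 1))) (p / a - 1) (2 / a) eta C P
  (fun J => J%:R * - ln q / L) (fun=> g0) q0) => //.
- by rewrite mulNr; field.
- by rewrite /m; field; rewrite a_neq0 p20.
- by rewrite /m; field.
- by move=> J; rewrite !mulr_ge0 ?invr_ge0 ?(ltW L0) ?(ltW l0).
- by move=> _; exact: ltW.
- by move=> J j jJ; rewrite kaE; exact: trunc_integral_inv_ge_scales.
- by move=> J j jJ; exact: trunc_integral_ge_scales.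
- by rewrite mulr_gt0 ?powR_gt0 ?divr_gt0.
- by rewrite !mulr_ge0 ?powR_ge0 ?(ltW kap0).
- exact: ltW.
- by rewrite divr_gt0.
- rewrite [ltRHS](_ : _ = 2 / (p - a) * (p / a - 1)); first by rewrite ltr_pM2r.
  by field; rewrite a_neq0 gt_eqF.
- move=> J; rewrite -(mulrA J%:R) (powRM _ (ler0n _ _)) ?divr_ge0 ?(ltW l0) ?(ltW L0)//.
  by rewrite [leLHS]mulrAC [X in X * _ <= _]mulrC.
move=> t t0 t1 w; exists ((kap * (4 + 3 * - ln t)) `^ (p / a - 1)).
exists (2 * kap * (6 * kap) `^ (p / a - 1)).
split; first exact: Ap_trunc_pos.
  exact: RH_trunc_pos.
have N0 : 0 <= 4 + 3 * - ln t by rewrite addr_ge0// mulr_ge0// oppr_ge0 ln_le0.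
by rewrite (powRM _ (ltW kap0) N0) mulrAC.
Qed.

(** The weight exponent -(1 - p z) forces m = -(1 - 2 z), so |g|^s is the inverse truncated
    distance. The terms gain J^(1/s), that is J^(1 - 2 z), against the power 1 - p z of the
    logarithm in the characteristic. *)
Lemma sharp_second_exponent (a p z eta C : R) (q0 : \bar R) :
  1 <= a -> a < 2 -> 2 < p -> 0 <= z -> p * z < 1 ->
  star q0 = (1 - 2 * z)^-1 -> hconj (q0 / p%:E) = (1 - p * z)^-1 ->
  eta < (1 - 2 * z) / (1 - p * z) -> ~ sparse_estimate D a q0 p eta C.
Proof.
move=> a1 a2 p2 z0 pz1 sE rE ett est.
have pz0 : 0 <= p * z by rewrite mulr_ge0//; lra.
have pz2 : 0 <= (p - 2) * z by rewrite mulr_ge0//; lra.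
have z2 : 0 < 1 - 2 * z by lra.
have z3 : 0 < 1 - p * z by lra.
have a0 : 0 < a by lra.
have ap : a < p by lra.
have p20 : p - 2 != 0 by rewrite gt_eqF//; lra.
have r1 : 1 <= (1 - p * z)^-1 by rewrite invf_ge1//; lra.
have s0 : 0 < (1 - 2 * z)^-1 by rewrite invr_gt0.
have tt1 : 1 < p / a by rewrite ltr_pdivlMr// mul1r.
have [q [L [P [q01 L0 [injP sparseP] ballP dilP]]]] := shrinking_cubes coverD.
have /andP[qp q1] := q01.
have l0 : 0 < - ln q by rewrite oppr_gt0 ln_lt0// qp.
have [kap kap1 hkap] := cubes_uniformly_round D.
have kap0 : 0 < kap := lt_le_trans ltr01 kap1.
pose s := (1 - 2 * z)^-1; pose m := - (1 - 2 * z).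
have msE : m * s = -1 by rewrite /m /s mulNr mulfV// gt_eqF.
pose f0 := 2 `^ (- `|- z * a|) / 2 / L.
have f00 : 0 < f0 by rewrite !divr_gt0// powR_gt0.
have [B B0 hB] : exists2 B : R, 0 <= B & forall t, 0 < t -> t <= 1 ->
    let w := fun x : T => trunc t x `^ (- (1 - p * z)) in
    exists X Y : R, [/\ (Ap_const D (p / a) w <= X%:E)%E,
      (RH_const D (1 - p * z)^-1 w <= Y%:E)%E &
      X * Y <= B * (4 + 3 * - ln t) `^ (1 - p * z)].
  have hN (t : R) (t0 : 0 < t) (t1 : t <= 1) : 0 <= 4 + 3 * - ln t.
    by rewrite addr_ge0// mulr_ge0// oppr_ge0 ln_le0.
  (* For z = 0 the weight is the inverse truncated distance itself, for which the bound with
     [1 - th] in the denominator degenerates; the logarithm then comes from the [A_p] constant, with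
     the same power 1. *)
  move: z0; rewrite le_eqVlt => /predU1P[zE|z_gt0].
    rewrite -zE mulr0 subr0 invr1; exists kap; first exact: ltW.
    move=> t t0 t1 w; exists (kap * (4 + 3 * - ln t)), 1.
    split; first exact: Ap_trunc_inv.
      apply: RH_trunc_one => [x|Q]; first exact: powR_ge0.
      have [zQ [rho [rho0 Qz Qk]]] := hkap Q.
      have mQ := cube_set_measurable (@real_line_space R) Q.
      have mw : measurable_fun [set: T] w by exact: measurable_trunc_pow.
      have b0 x : 0 < trunc t x by exact: trunc_gt0.
      apply/andP; split.
        apply: (@lt_le_trans _ _ 1%:E); first exact: lte01.
        apply: (round_set_avg_ge mQ rho0 kap1 Qz Qk mw) => // x _.
        by rewrite /w powR_inv1 ?(ltW (b0 x))// invf_ge1// trunc_le1.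
      apply: (@le_lt_trans _ _ (t^-1)%:E); last exact: ltry.
      apply: (round_set_avg_le mQ rho0 kap1 Qz Qk mw) => [x|x _]; first exact: powR_ge0.
      by rewrite /w powR_inv1 ?(ltW (b0 x))// lef_pV2 ?posrE// trunc_ge.
    by rewrite powRr1 ?hN// mulr1.
  pose th := 1 - p * z; have th01 : 0 < th < 1.
    by rewrite /th z3/= gtrBl mulr_gt0//; lra.
  exists (kap * (4 + 6 * (1 - th)^-1) * kap `^ th).
    have /andP[_ th1] := th01.
    by rewrite !mulr_ge0 ?powR_ge0 ?(ltW kap0)// addr_ge0// mulr_ge0// invr_ge0 subr_ge0 ltW.
  move=> t t0 t1 w; exists (kap * (4 + 6 * (1 - th)^-1)), ((kap * (4 + 3 * - ln t)) `^ th).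
  split; first exact: Ap_trunc_neg.
    exact: RH_trunc_neg.
  by rewrite (powRM _ (ltW kap0) (hN t t0 t1)) mulrA.
apply: (@sparse_estimate_testing_false R K D q L a p s (1 - p * z)^-1 (- (1 - p * z)) (- z) m
  (f0 `^ (2 / a) * (- ln q / L) `^ s^-1) B (1 - p * z) (1 - 2 * z) eta C P
  (fun=> f0) (fun J => J%:R * - ln q / L) q0) => //.
- by rewrite mulNr; ring.
- by rewrite /m; field.
- by rewrite /m; ring.
- by move=> _; exact: ltW.
- by move=> J; rewrite !mulr_ge0 ?invr_ge0 ?(ltW L0) ?(ltW l0).
- by move=> J j jJ; exact: trunc_integral_ge_scales.
- by move=> J j jJ; rewrite msE; exact: trunc_integral_inv_ge_scales.
- by rewrite mulr_gt0 ?powR_gt0 ?divr_gt0.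
- exact: ltW.
- by rewrite -ltr_pdivlMr.
- move=> J; rewrite -(mulrA J%:R) (powRM _ (ler0n _ _)) ?divr_ge0 ?(ltW l0) ?(ltW L0)//.
  by rewrite /s invrK -mulrA ler_wpM2l ?powR_ge0// mulrC.
Qed.

Theorem sparse_estimate_sharp (p0 p eta : R) (q0 : \bar R) :
  1 <= p0 -> p0 < 2 -> 2 < p -> (p%:E < q0)%E -> eta < 2 * gamma p0 q0 p ->
  ~ exists C : R, sparse_estimate D p0 q0 p eta C.
Proof.
move=> a1 a2 p2 pq; have [z [z0 pz sq hq]] := exponent_reciprocal p2 pq.
move=> ett [C]; move: ett; rewrite /gamma hq sq; have [_ h|_ h] := leP (p - p0)^-1.
  apply: (sharp_second_exponent a1 a2 p2 z0 pz sq hq); apply: lt_le_trans h _.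
  rewrite invfM invrK; set y := (1 - p * z)^-1.
  by rewrite le_eqVlt; apply/orP; left; apply/eqP; field.
exact: (sharp_first_exponent a1 a2 p2 z0 pz sq hq).
Qed.

End sharpness_theorem.

Theorem theorem1p7 (R : realType) (p0 : R) (q0 : \bar R)
    (hp0 : 1 <= p0) (hp02 : p0 < 2) (hq0 : (2%:E < q0)%E)
    (p : R) (hp : 2 < p) (hpq0 : (p%:E < q0)%E) :
  (forall (d : measure_display) (M : measurableMetricType d R)
     (mu : {measure set M -> \bar R}),
     doubling_metric_measure_space mu ->
   forall (K : nat) (D : 'I_K -> dyadic_system mu), covers_balls D ->
   exists2 C0 : R, 0 < C0 & sparse_estimate D p0 q0 p (2 * gamma p0 q0 p) C0)
  /\
  (forall (K : nat)
     (D : 'I_K -> @dyadic_system _ R (measurableTypeR R) lebesgue_measure),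
     covers_balls D ->
   forall eta : R, eta < 2 * gamma p0 q0 p ->
   ~ exists C : R, sparse_estimate D p0 q0 p eta C).
Proof.
split=> [d M mu spaceM K D coverD|K D coverD eta heta].
  exact: sparse_estimate_upper.
exact: sparse_estimate_sharp.
Qed.
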